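(* Let $K$ be a compact polar set in a domain $D\subset\mathbb{C}$ and let $f$ be holomorphic on $D\setminus K$. Then there exists a continuous plurisubharmonic function $u$ on $D\times\mathbb{C}$ such that $$\{(z,w)\in D\times\mathbb{C}:u(z,w)=-\infty\}=\{(z,f(z)):z\in D\setminus K\}\cup(K\times\mathbb{C}).$$
   Context: A plurisubharmonic function $u:\Omega\to[-\infty,\infty)$ is called continuous if $e^u:\Omega\to[0,\infty)$ is continuous. *)

(* Defs.v *)
(* The complex plane is R[i] (mathcomp-real-closed's
   [complex R]) for an arbitrary [R : realType]; we use the alias R[i]^o, for
   which MathComp-Analysis provides the normed-field topology
   (numFieldNormedType instances), so that [open], [compact], [connected],
   [derivable] (complex derivative over the scalar field R[i]) are available. *)
From HB Require Import structures.
From mathcomp Require Import all_boot all_order all_algebra.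
From mathcomp Require Import all_classical all_reals all_analysis.
From mathcomp Require Import complex.
Import Order.TTheory GRing.Theory Num.Theory.
Import numFieldTopology.Exports numFieldNormedType.Exports.

Set Implicit Arguments.
Unset Strict Implicit.
Unset Printing Implicit Defensive.

Local Open Scope ring_scope.
Local Open Scope classical_set_scope.

Notation Cplx R := ((complex R)^o).

Definition cexpi (R : realType) (t : R) : Cplx R := Complex (cos t) (sin t).

Definition usc_on (R : realType) (T : topologicalType) (U : set T)
    (u : T -> \bar R) : Prop :=
  forall x, U x ->
    (u x < +oo)%E /\
    (forall M : R, (u x < M%:E)%E -> \forall y \near x, (u y < M%:E)%E).

(* Subharmonic functions on an open set U of C (classical definition:
   upper semicontinuous, with the sub-mean value inequality on every closed
   disc contained in U).  As usual the function identically -oo is allowed. *)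
Definition subharmonic_on (R : realType) (U : set (Cplx R))
    (v : Cplx R -> \bar R) : Prop :=
  usc_on U v /\
  forall (a : Cplx R) (r : R), 0 < r ->
    [set z : Cplx R | `|z - a| <= (r%:C)%C] `<=` U ->
    (v a <= ((2 * pi)^-1)%:E *
       \int[@lebesgue_measure R]_(t in `[0%R, (2 * pi)%R]) v (a + (r%:C)%C * cexpi t)%R)%E.

Definition polar (R : realType) (E : set (Cplx R)) : Prop :=
  forall z : Cplx R, exists r : R, 0 < r /\
    exists v : Cplx R -> \bar R,
      let B := [set y : Cplx R | `|y - z| < (r%:C)%C] in
      subharmonic_on B v /\
      (exists w, B w /\ v w <> -oo%E) /\
      (forall y, B y -> E y -> v y = -oo%E).

(* Plurisubharmonic functions on an open set O of C^2: upper semicontinuous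
   and, for every closed complex affine disc {a + l b : |l| <= 1} contained in
   O, the sub-mean value inequality holds (equivalently: the restriction to
   every complex line is subharmonic or identically -oo). *)
Definition psh_on (R : realType) (O : set (Cplx R * Cplx R))
    (u : Cplx R * Cplx R -> \bar R) : Prop :=
  usc_on O u /\
  forall a b : Cplx R * Cplx R,
    (forall l : Cplx R, `|l| <= 1 -> O (a.1 + l * b.1, a.2 + l * b.2)) ->
    (u a <= ((2 * pi)^-1)%:E *
       \int[@lebesgue_measure R]_(t in `[0%R, (2 * pi)%R])
          u (a.1 + cexpi t * b.1, a.2 + cexpi t * b.2)%R)%E.

(* e^u, with e^{-oo} = 0 (u never takes the value +oo where it is psh). *)
Definition exp_ext (R : realType) (T : Type) (u : T -> \bar R) (x : T) : R :=
  match u x with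
  | EFin r => expR r
  | _ => 0
  end.

Definition cont_psh_on (R : realType) (O : set (Cplx R * Cplx R))
    (u : Cplx R * Cplx R -> \bar R) : Prop :=
  psh_on O u /\
  forall p, O p -> exp_ext u q @[q --> p] --> exp_ext u p.

Definition holomorphic_on (R : realType) (U : set (Cplx R))
    (f : Cplx R -> Cplx R) : Prop :=
  forall z, U z -> derivable f z 1.

Definition domain (R : realType) (D : set (Cplx R)) : Prop :=
  open D /\ connected D.

(* Main.v *)
(* For a compact polar set [K] there are, for every [e > 0], monic polynomials [q]
   of degree [N] with roots in [K] and [|q| <= e ^ N] on [K].  To see this, take
   Fekete points of nets of [K]: if [|q|] were never that small, the potentials
   [ln |q| / N] would be bounded below, and the maximum principle would bound a
   subharmonic function equal to [-oo] on [K] by [b - kappa T] for all [T] on an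
   open set, so that it would be identically [-oo].

   With [Q = q ^ a] and a tiny constant [kappa], the function
   [ln (max (|w - f z| |Q z|, |w| kappa, kappa))] is used away from [K]; near [K]
   the first term is dropped, which is consistent because on a shell around [K] it
   is dominated by the others.  Divided by the degree of [Q], this is continuous,
   very negative on the graph and over [K], and bounded elsewhere uniformly in
   the choice of [q]; a weighted sum of such functions for rapidly decreasing
   [e] is the required function.

   The submean value property on a disc that may meet [K] is obtained from local
   information by symmetrization: averaging over rotations by [n]-th roots of
   unity makes the function nearly constant on the circle, and the maximum
   principle applies to the average.  The latter rests on the maximum modulus
   principle for complex differentiable functions, proved by Goursat's bisection
   with trapezoidal sums in place of path integrals. *)
Require Import Defs.
From HB Require Import structures.
From mathcomp Require Import all_boot all_order all_algebra.
From mathcomp Require Import all_classical all_reals all_analysis.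
From mathcomp Require Import complex ring lra.
Import Order.TTheory GRing.Theory Num.Theory.
Import numFieldTopology.Exports numFieldNormedType.Exports.
Set Implicit Arguments.
Unset Strict Implicit.
Unset Printing Implicit Defensive.
Local Open Scope ring_scope.
Local Open Scope classical_set_scope.


(** The difficulty is that [q] has to be chosen before the bound [C] of [f] on the shell is known,
    and [C] may be huge compared with [1 / e]. Passing from [q] to [q ^ a] does not move the shell,
    hence leaves [C] alone, while the degree [A] of [Q] grows until [1 + C <= 2 ^ A]. The levels
    [(2 e) ^ A] and [(3 e) ^ A] of [|Q|] delimit the shell, and the cap [kappa = (6 e) ^ A] then
    exceeds [(1 + C) (3 e) ^ A]: after division by [A], absorbing [C] costs no more than [ln 2]. The
    cap has to grow with [|w|] because [|w - f z| <= |w| + C] must be dominated for all [w] at once.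

    The same normalization frees all bounds of [A]: [|Q z|] lies between [rho ^ A] and
    [(|z| + Delta) ^ A], where [rho <= 1] is a lower bound for the distance from [z] to [K] and
    [Delta] bounds [K]. On the graph and over [K] the normalized function is at most
    [ln (6 e) <= - 4 ^ n] up to a term depending on [w] alone, so that with the weight [2 ^ - n]
    there remains [- 2 ^ n], and the series diverges exactly there. *)

Definition cmod (R : realType) (z : Cplx R) : R := Normc.normc z.
Arguments cmod : simpl never.

(** * The real-valued modulus and neighbourhoods in the plane *)

Section Modulus.
Variable R : realType.
Implicit Types (x y z : Cplx R) (e : R).

Lemma ReD x y : complex.Re (x + y) = complex.Re x + complex.Re y.
Proof. by case: x y => [? ?] [? ?]. Qed.

Lemma ImD x y : complex.Im (x + y) = complex.Im x + complex.Im y.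
Proof. by case: x y => [? ?] [? ?]. Qed.

Lemma ReN x : complex.Re (- x) = - complex.Re x.
Proof. by case: x. Qed.

Lemma ImN x : complex.Im (- x) = - complex.Im x.
Proof. by case: x. Qed.

(** The norm of [Cplx R] takes its values in [R[i]]; all estimates are carried out with [cmod],
    whose values lie in the totally ordered field [R]. *)
Lemma normE z : `|z| = (cmod z)%:C%C.
Proof. by case: z => a b; rewrite normc_def. Qed.

Lemma cmodM x y : cmod (x * y) = cmod x * cmod y.
Proof. exact: Normc.normcM. Qed.

Lemma cmod_triangle x y : cmod (x + y) <= cmod x + cmod y.
Proof. exact: le_normcD. Qed.

Lemma cmodN x : cmod (- x) = cmod x.
Proof. exact: normcN. Qed.

Lemma cmod0 : cmod (0 : Cplx R) = 0.
Proof. exact: Normc.normc0. Qed.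

Lemma cmod1 : cmod (1 : Cplx R) = 1.
Proof. exact: Normc.normc1. Qed.

Lemma cmod_ge0 x : 0 <= cmod x.
Proof. by rewrite -ler0c -normE. Qed.
Hint Resolve cmod_ge0 : core.

Lemma cmod_eq0 x : (cmod x == 0) = (x == 0).
Proof.
apply/eqP/eqP => [|->]; [exact: Normc.eq0_normc | exact: cmod0].
Qed.

Lemma cmod_gt0 x : (0 < cmod x) = (x != 0).
Proof. by rewrite lt_def cmod_eq0 cmod_ge0 andbT. Qed.

Lemma cmodV x : cmod x^-1 = (cmod x)^-1.
Proof. exact: Normc.normcV. Qed.

Lemma cmodX x n : cmod (x ^+ n) = cmod x ^+ n.
Proof.
elim: n => [|n IH]; first by rewrite !expr0 cmod1.
by rewrite !exprS cmodM IH.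
Qed.

Lemma cmod_prod (I : Type) (s : seq I) (P : pred I) (F : I -> Cplx R) :
  cmod (\prod_(i <- s | P i) F i) = \prod_(i <- s | P i) cmod (F i).
Proof. exact: (big_morph _ cmodM cmod1). Qed.

Lemma cmodB x y : cmod (x - y) = cmod (y - x).
Proof. by rewrite -cmodN opprB. Qed.

Lemma cmod_real e : cmod (e%:C%C : Cplx R) = `|e|.
Proof. by rewrite /cmod /= expr0n /= addr0 sqrtr_sqr. Qed.

Lemma cmod_sub_triangle y x z : cmod (x - z) <= cmod (x - y) + cmod (y - z).
Proof. by have := cmod_triangle (x - y) (y - z); rewrite addrA subrK. Qed.

Lemma cmod_dist x y : `|cmod x - cmod y| <= cmod (x - y).
Proof.
have H (u v : Cplx R) : cmod u - cmod v <= cmod (u - v).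
  by have := cmod_triangle (u - v) v; rewrite subrK lerBlDr.
by rewrite ler_norml H lerNl opprB cmodB H.
Qed.

Lemma cmod_sqr z : cmod z ^+ 2 = complex.Re z ^+ 2 + complex.Im z ^+ 2.
Proof. by case: z => a b; rewrite /cmod /= sqr_sqrtr // addr_ge0 // sqr_ge0. Qed.

Lemma Re_le_cmod z : `|complex.Re z| <= cmod z.
Proof. by rewrite -lecR -normE; exact: normc_ge_Re. Qed.

Lemma Im_le_cmod z : `|complex.Im z| <= cmod z.
Proof.
rewrite -(@ler_pXn2r _ 2) ?nnegrE // cmod_sqr real_normK ?num_real //.
by rewrite lerDr sqr_ge0.
Qed.

Lemma cmod_le_ReIm z : cmod z <= `|complex.Re z| + `|complex.Im z|.
Proof.
rewrite -(@ler_pXn2r _ 2) ?nnegrE ?addr_ge0 // cmod_sqr sqrrD !real_normK ?num_real //.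
by rewrite addrAC lerDl mulrn_wge0 // mulr_ge0.
Qed.

(** Balls of [Cplx R] have radii in [R[i]], but [0 < e] there forces [e] to be real. *)
Lemma nbhs_cmodP z (A : set (Cplx R)) :
  nbhs z A <-> exists e, 0 < e /\ forall y, cmod (y - z) < e -> A y.
Proof.
split.
  case/(@nbhs_ballP _ (Cplx R)) => e; rewrite /= ltcE /= => /andP[/eqP e0 ep] h.
  exists (complex.Re e); split=> // y yz.
  apply: h; rewrite /ball /= -opprB normrN normE ltcE /=.
  by rewrite e0 eqxx.
case=> e [e0 h]; apply/(@nbhs_ballP _ (Cplx R)); exists (e%:C)%C; first by rewrite /= ltcR.
by move=> y; rewrite /ball /= -opprB normrN normE ltcR; exact: h.
Qed.

Lemma nbhs_cmod_ball z e : 0 < e -> \forall y \near z, cmod (y - z) < e.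
Proof. by move=> e0; apply/nbhs_cmodP; exists e. Qed.

Lemma cvg_cmod (T : Type) (F : set_system T) {FF : Filter F}
    (g : T -> Cplx R) (l : Cplx R) :
  g x @[x --> F] --> l <-> forall e, 0 < e -> \forall x \near F, cmod (g x - l) < e.
Proof.
split=> [h e e0|h].
  by have /= := h _ (nbhs_cmod_ball l e0).
move=> A /nbhs_cmodP[e [e0 eA]]; rewrite /nbhs /=.
by apply: filterS (h e e0) => x /= /eA.
Qed.

End Modulus.
#[export] Hint Extern 0 (is_true (0 <= cmod _)) => solve [apply: cmod_ge0] : core.


(** * Complex differentiability and discrete path integrals *)

Section ContinuousAt.
Variable R : realType.
Implicit Types (c z : Cplx R) (g h : Cplx R -> Cplx R).

Section Filter.
Context {T : Type} {F : set_system T} {FF : Filter F}.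
Implicit Types (u v : T -> Cplx R) (a b : Cplx R).

Lemma cvgCD u v a b : u x @[x --> F] --> a -> v x @[x --> F] --> b ->
  (u x + v x) @[x --> F] --> a + b.
Proof.
move=> /cvg_cmod ua /cvg_cmod vb; apply/cvg_cmod => e e0.
have e2 : 0 < e / 2 by rewrite divr_gt0.
apply: filterS2 (ua _ e2) (vb _ e2) => x x1 x2.
rewrite opprD addrACA (splitr e).
exact: le_lt_trans (cmod_triangle _ _) (ltrD x1 x2).
Qed.

Lemma cvgCN u a : u x @[x --> F] --> a -> (- u x) @[x --> F] --> - a.
Proof.
move=> /cvg_cmod ua; apply/cvg_cmod => e e0.
by apply: filterS (ua _ e0) => x; rewrite -opprD cmodN.
Qed.

Lemma cvgCM u v a b : u x @[x --> F] --> a -> v x @[x --> F] --> b ->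
  (u x * v x) @[x --> F] --> a * b.
Proof.
move=> /cvg_cmod ua /cvg_cmod vb; apply/cvg_cmod => e e0.
have b1 : 0 < cmod b + 1 by rewrite ltr_wpDl ?cmod_ge0.
have a1 : 0 < cmod a + 1 by rewrite ltr_wpDl ?cmod_ge0.
have eb : 0 < e / 2 / (cmod b + 1) by rewrite !divr_gt0.
have ea : 0 < e / 2 / (cmod a + 1) by rewrite !divr_gt0.
apply: filterS3 (ua _ eb) (vb _ ea) (vb _ ltr01) => x x1 x2 x3.
have -> : u x * v x - a * b = (u x - a) * v x + a * (v x - b) by ring.
apply: le_lt_trans (cmod_triangle _ _) _; rewrite !cmodM (splitr e).
have vx : cmod (v x) <= cmod b + 1.
  have := cmod_triangle (v x - b) b; rewrite subrK => /le_trans; apply.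
  by rewrite addrC lerD2l ltW.
apply: ltr_leD; first last.
  rewrite ltr_pdivlMr // in x2.
  by apply: le_trans (ltW x2); rewrite [leLHS]mulrC ler_wpM2l ?cmod_ge0 ?lerDl.
  apply: le_lt_trans (ler_wpM2l (cmod_ge0 _) vx) _.
  by rewrite -ltr_pdivlMr.
Qed.

Lemma cvgCV u a : a != 0 -> u x @[x --> F] --> a -> (u x)^-1 @[x --> F] --> a^-1.
Proof.
move=> a0 /cvg_cmod ua; apply/cvg_cmod => e e0.
have ca : 0 < cmod a by rewrite cmod_gt0.
have h1 := ua _ (divr_gt0 ca (ltr0n _ 2)).
have h2 := ua (e * (cmod a / 2 * cmod a)) (mulr_gt0 e0 (mulr_gt0 (divr_gt0 ca (ltr0n _ 2)) ca)).
apply: filterS2 h1 h2 => x x1 x2.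
have ux : cmod a / 2 < cmod (u x).
  have := cmod_sub_triangle (u x) a 0; rewrite !subr0 cmodB => h.
  rewrite -(ltrD2l (cmod a / 2)) -splitr; apply: le_lt_trans h _.
  by rewrite ltrD2r.
have u0 : u x != 0 by rewrite -cmod_gt0 (lt_trans _ ux) // divr_gt0.
have -> : (u x)^-1 - a^-1 = (a - u x) * ((u x)^-1 * a^-1) by field; rewrite u0 a0.
rewrite cmodM cmodB cmodM !cmodV -invfM ltr_pdivrMr ?mulr_gt0 ?cmod_gt0 //.
by apply: lt_trans x2 _; rewrite ltr_pM2l // ltr_pM2r.
Qed.

End Filter.

Lemma contP g z : {for z, continuous g} <->
  forall e : R, 0 < e -> \forall y \near z, cmod (g y - g z) < e.
Proof. exact: (@cvg_cmod R (Cplx R) (nbhs z) _ g (g z)). Qed.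

Lemma cont_cst c z : {for z, continuous (fun _ : Cplx R => c)}.
Proof. exact: cst_continuous. Qed.

Lemma cont_id z : {for z, continuous (fun y : Cplx R => y)}.
Proof. by []. Qed.

Lemma contD g h z : {for z, continuous g} -> {for z, continuous h} ->
  {for z, continuous (fun y => g y + h y)}.
Proof. by move=> cg ch; exact: cvgCD cg ch. Qed.

Lemma contM g h z : {for z, continuous g} -> {for z, continuous h} ->
  {for z, continuous (fun y => g y * h y)}.
Proof. by move=> cg ch; exact: cvgCM cg ch. Qed.

Lemma contN g z : {for z, continuous g} -> {for z, continuous (fun y => - g y)}.
Proof. by move=> cg; exact: cvgCN cg. Qed.

Lemma contV g z : g z != 0 -> {for z, continuous g} ->
  {for z, continuous (fun y => (g y)^-1)}.
Proof. by move=> g0 cg; exact: cvgCV g0 cg. Qed.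

Lemma cont_comp g h z : {for z, continuous h} -> {for h z, continuous g} ->
  {for z, continuous (fun y => g (h y))}.
Proof. by move=> ch cg; exact: (@continuous_comp _ _ _ h g z ch cg). Qed.

Lemma cont_affine (a b z : Cplx R) : {for z, continuous (fun y : Cplx R => a + y * b)}.
Proof. by apply: contD; [exact: cont_cst|apply: contM; [exact: cont_id|exact: cont_cst]]. Qed.

End ContinuousAt.

(* Caratheodory's form of complex differentiability. *)
Definition cdiff (R : realType) (g : Cplx R -> Cplx R) (z : Cplx R) : Prop :=
  exists phi : Cplx R -> Cplx R, {for z, continuous phi} /\
    \forall y \near z, g y = g z + phi y * (y - z).

Section ComplexDifferentiability.
Variable R : realType.
Implicit Types (x y z : Cplx R) (e : R) (g h : Cplx R -> Cplx R).

Lemma cdiff_continuous g z : cdiff g z -> {for z, continuous g}.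
Proof.
case=> phi [cphi near_g].
have c : {for z, continuous (fun y => g z + phi y * (y - z))}.
  apply: contD; first exact: cont_cst.
  by apply: contM cphi _; apply: contD; [exact: cont_id|exact: cont_cst].
apply/contP => e e0; have := (contP _ _).1 c e e0.
by apply: filterS2 near_g => y ->; rewrite subrr mulr0 addr0.
Qed.

Lemma cdiff_cst (c : Cplx R) z : cdiff (fun _ => c) z.
Proof.
exists (fun _ => 0); split; first exact: cont_cst.
by near=> y; rewrite mul0r addr0.
Unshelve. all: by end_near. Qed.

Lemma cdiff_id z : cdiff id z.
Proof.
exists (fun _ => 1); split; first exact: cont_cst.
by near=> y; rewrite mul1r addrC subrK.
Unshelve. all: by end_near. Qed.

Lemma cdiffD g h z : cdiff g z -> cdiff h z -> cdiff (fun y => g y + h y) z.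
Proof.
move=> [p [cp gp]] [q [cq hq]]; exists (fun y => p y + q y); split; first exact: contD.
near=> y; rewrite (near gp y) // (near hq y) //; ring.
Unshelve. all: by end_near. Qed.

Lemma cdiffM g h z : cdiff g z -> cdiff h z -> cdiff (fun y => g y * h y) z.
Proof.
move=> gz hz; have ch := cdiff_continuous hz; move: gz hz.
move=> [p [cp gp]] [q [cq hq]]; exists (fun y => p y * h y + g z * q y); split.
  exact: (contD (contM cp ch) (contM (@cont_cst R _ _) cq)).
near=> y; rewrite (near gp y) // (near hq y) //; ring.
Unshelve. all: by end_near. Qed.

Lemma cdiffB g h z : cdiff g z -> cdiff h z -> cdiff (fun y => g y - h y) z.
Proof.
move=> gz hz; have -> : (fun y => g y - h y) = (fun y => g y + (-1) * h y).
  by apply/funext => y; rewrite mulN1r.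
by apply: cdiffD => //; apply: cdiffM => //; exact: cdiff_cst.
Qed.

Lemma cdiffV g z : g z != 0 -> cdiff g z -> cdiff (fun y => (g y)^-1) z.
Proof.
move=> g0 gz; have cg := cdiff_continuous gz.
have near0 : \forall y \near z, g y != 0.
  have gz0 : 0 < cmod (g z) by rewrite cmod_gt0.
  apply: filterS ((contP _ _).1 cg _ gz0) => y yz; apply/eqP => gy0.
  by move: yz; rewrite gy0 sub0r cmodN ltxx.
case: gz => p [cp gp]; exists (fun y => - p y * ((g y)^-1 * (g z)^-1)); split.
  exact: (contM (contN cp) (contM (contV g0 cg) (@cont_cst R _ _))).
near=> y; have gy : g y != 0 by near: y.
have gyz : p y * (y - z) = g y - g z by rewrite (near gp y) // addrAC subrr add0r.
rewrite mulrAC mulNr gyz; field.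
by rewrite ?gy ?g0.
Unshelve. all: by end_near. Qed.

Lemma cdiffX g z n : cdiff g z -> cdiff (fun y => g y ^+ n) z.
Proof.
move=> gz; elim: n => [|n IH]; first exact: cdiff_cst.
have -> : (fun y => g y ^+ n.+1) = (fun y => g y * g y ^+ n) by apply/funext => y; rewrite exprS.
exact: cdiffM.
Qed.

Lemma cdiff_prod (I : Type) (s : seq I) (F : I -> Cplx R -> Cplx R) z :
  (forall i, cdiff (F i) z) -> cdiff (fun y => \prod_(i <- s) F i y) z.
Proof.
move=> Fz; elim: s => [|i s IH].
  have -> : (fun y => \prod_(i <- [::]) F i y) = (fun=> 1) by apply/funext => y; rewrite big_nil.
  exact: cdiff_cst.
have -> : (fun y => \prod_(j <- i :: s) F j y) = (fun y => F i y * \prod_(j <- s) F j y).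
  by apply/funext => y; rewrite big_cons.
exact: cdiffM.
Qed.

Lemma cdiff_comp_affine g (a b z : Cplx R) :
  cdiff g (a + z * b) -> cdiff (fun y => g (a + y * b)) z.
Proof.
move=> [p [cp gp]].
have ca := @cont_affine R a b z.
exists (fun y => p (a + y * b) * b); split.
  have cpa : {for z, continuous (fun y => p (a + y * b))}.
    exact: (@cont_comp R p (fun y => a + y * b) z ca cp).
  exact: (contM cpa (@cont_cst R b z)).
have H : \forall y \near z, g (a + y * b) = g (a + z * b) + p (a + y * b) * (a + y * b - (a + z * b)).
  exact: (ca _ gp).
by apply: filterS H => y ->; ring.
Qed.

Lemma derivable_cdiff g z : derivable g z 1 -> cdiff g z.
Proof.
move=> dg; pose d := 'D_1 g z.
(* The difference quotient completed by the derivative; its continuity at [z] is the existence of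
   the limit [d]. *)
exists (fun y => if y == z then d else (y - z)^-1 * (g y - g z)); split; last first.
  near=> y; case: eqVneq => [->|yz]; first by rewrite subrr mulr0 addr0.
  by rewrite mulrAC mulVf ?subr_eq0 // mul1r addrC subrK.
have : h^-1 *: ((g \o shift z) (h *: (1 : Cplx R)) - g z) @[h --> (0 : Cplx R)^'] --> d by exact: dg.
move=> /(@cvg_cmod R (Cplx R) (dnbhs (0 : Cplx R)) _) H; apply/contP => e e0.
have [r [r0 hr]] := (nbhs_cmodP _ _).1 (H _ e0).
apply/nbhs_cmodP; exists r; split => // y yz.
rewrite eqxx; case: eqVneq => [_|ne]; first by rewrite subrr cmod0.
have := hr (y - z); rewrite subr0 => /(_ yz); rewrite subr_eq0 => /(_ ne).
rewrite /shift /=; have -> : (y - z) *: (1 : Cplx R) + z = y.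
  by rewrite -[_ *: _]/((y - z) * 1) mulr1 subrK.
exact.
Unshelve. all: by end_near. Qed.

End ComplexDifferentiability.

(** * Trapezoidal sums along segments and triangles *)

Section DiscreteGoursat.
Variable R : realType.
Implicit Types (a b c z : Cplx R) (e d : R) (f g : Cplx R -> Cplx R) (X : set (Cplx R)).

(** Trapezoidal sums evaluate the function at iterated midpoints only, so this replaces
    convexity. *)
Definition midconvex X := forall a b, X a -> X b -> X ((a + b) / 2).

(* The trapezoidal sum with [2 ^ n] steps stands in for the path integral along
   the segment from [a] to [b]: it is exact on affine functions and additive
   under bisection, which is all that Goursat's argument needs. *)
Fixpoint trap n g a b : Cplx R :=
  if n is n'.+1 then
    trap n' g a ((a + b) / 2) + trap n' g ((a + b) / 2) b
  else (b - a) * ((g a + g b) / 2).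

Lemma trap_rev n g a b : trap n g b a = - trap n g a b.
Proof.
elim: n a b => [|n IH] a b /=; first by ring.
rewrite (addrC b a); set m := (a + b) / 2.
by rewrite (IH a m) (IH m b) opprD addrC.
Qed.

Lemma trap_affine n c0 c1 a b :
  trap n (fun z => c0 + c1 * z) a b = (b - a) * (c0 + c1 * ((a + b) / 2)).
Proof.
elim: n a b => [|n IH] a b /=; first by field.
by rewrite !IH; field.
Qed.

Lemma trapB n f g a b :
  trap n (fun z => f z - g z) a b = trap n f a b - trap n g a b.
Proof.
elim: n a b => [|n IH] a b /=; first by field.
by rewrite !IH; ring.
Qed.

Lemma cmod2 : cmod (2 : Cplx R) = 2.
Proof.
have -> : (2 : Cplx R) = (2 : R)%:C%C by rewrite rmorphMn.
by rewrite cmod_real ger0_norm.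
Qed.

Lemma cmod_half z : cmod (z / 2) = cmod z / 2.
Proof. by rewrite cmodM cmodV cmod2. Qed.

Lemma trap_bound n g X a b d : midconvex X -> X a -> X b ->
  (forall z, X z -> cmod (g z) <= d) -> cmod (trap n g a b) <= cmod (b - a) * d.
Proof.
move=> cX + + gd; elim: n a b => [|n IH] a b Xa Xb /=.
  rewrite cmodM ler_wpM2l // cmod_half ler_pdivrMr // mulr_natr mulr2n.
  exact: le_trans (cmod_triangle _ _) (lerD (gd _ Xa) (gd _ Xb)).
have Xm := cX _ _ Xa Xb; apply: le_trans (cmod_triangle _ _) _.
apply: le_trans (lerD (IH _ _ Xa Xm) (IH _ _ Xm Xb)) _.
have -> : (a + b) / 2 - a = (b - a) / 2 by field.
have -> : b - (a + b) / 2 = (b - a) / 2 by field.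
by rewrite cmod_half -mulrDl -splitr.
Qed.

Definition tri n g a b c := trap n g a b + trap n g b c + trap n g c a.

(** Each side of the middle triangle is run through once in either direction and cancels by
    [trap_rev]. The level drops by one because a sum of level [n.+1] is made of two sums of level
    [n] over the half segments. *)
Lemma tri_split n g a b c :
  tri n.+1 g a b c =
    tri n g a ((a + b) / 2) ((c + a) / 2) +
    tri n g ((a + b) / 2) b ((b + c) / 2) +
    tri n g ((c + a) / 2) ((b + c) / 2) c +
    tri n g ((a + b) / 2) ((b + c) / 2) ((c + a) / 2).
Proof.
rewrite /tri /=.
rewrite (trap_rev n g ((a + b) / 2) ((c + a) / 2)) (trap_rev n g ((b + c) / 2) ((a + b) / 2)).
rewrite (trap_rev n g ((c + a) / 2) ((b + c) / 2)); ring.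
Qed.

End DiscreteGoursat.


(** * Goursat's lemma by bisection *)

Section Goursat.
Variable R : realType.
Implicit Types (a b c z : Cplx R) (e d : R) (f g : Cplx R -> Cplx R) (X : set (Cplx R)).

(** The intervals of centre [u k] and radius [2 * d / 2 ^+ k] are nested, and the supremum of their
    left ends lies in all of them. *)
Lemma geometric_limit_real (u : nat -> R) d :
  (forall k, `|u k.+1 - u k| <= d / 2 ^+ k) ->
  exists l, forall k, `|l - u k| <= 2 * d / 2 ^+ k.
Proof.
move=> hu; pose r k := 2 * d / 2 ^+ k.
have d0 : 0 <= d by have := hu 0%N; rewrite expr0 divr1; apply: le_trans.
have lo k : u k - r k <= u k.+1 - r k.+1.
  have := hu k; rewrite ler_norml => /andP[h _].
  have -> : r k = d / 2 ^+ k + r k.+1 by rewrite /r exprS; field.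
  by lra.
have hi k : u k.+1 + r k.+1 <= u k + r k.
  have := hu k; rewrite ler_norml => /andP[_ h].
  have -> : r k = d / 2 ^+ k + r k.+1 by rewrite /r exprS; field.
  by lra.
have r0 k : 0 <= r k by rewrite /r divr_ge0 ?mulr_ge0 // exprn_ge0.
have lom : {homo (fun k => u k - r k) : i j / (i <= j)%N >-> i <= j}.
  exact: (homo_leq (@lexx _ R) le_trans lo).
have him i j : (i <= j)%N -> u j + r j <= u i + r i.
  elim: j => [|j IH]; first by rewrite leqn0 => /eqP ->.
  rewrite leq_eqVlt => /orP[/eqP -> //|]; rewrite ltnS => /IH.
  exact: le_trans (hi j).
have lh i j : u i - r i <= u j + r j.
  have h1 := lom _ _ (leq_maxl i j); have h2 := him _ _ (leq_maxr i j).
  apply: le_trans h1 (le_trans _ h2).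
  by rewrite lerBlDr -addrA lerDl addr_ge0.
pose S := range (fun k => u k - r k).
have S0 : S !=set0 by exists (u 0%N - r 0%N), 0%N.
exists (sup S) => k; rewrite ler_norml; apply/andP; split.
  suff : u k - r k <= sup S by rewrite /r => h; lra.
  apply: ub_le_sup; last by exists k.
  by exists (u 0%N + r 0%N) => _ [i _ <-]; exact: lh.
suff : sup S <= u k + r k by rewrite /r => h; lra.
by apply: ge_sup => // _ [i _ <-]; exact: lh.
Qed.

Lemma geometric_limit (u : nat -> Cplx R) d :
  (forall k, cmod (u k.+1 - u k) <= d / 2 ^+ k) ->
  exists l, forall k, cmod (l - u k) <= 4 * d / 2 ^+ k.
Proof.
move=> hu.
have [|x hx] := @geometric_limit_real (fun k => complex.Re (u k)) d.
  move=> k; apply: le_trans (hu k); rewrite -raddfB; exact: Re_le_cmod.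
have [|y hy] := @geometric_limit_real (fun k => complex.Im (u k)) d.
  move=> k; apply: le_trans (hu k); rewrite -raddfB; exact: Im_le_cmod.
exists (Complex x y) => k; apply: le_trans (cmod_le_ReIm _) _.
have -> : 4 * d / 2 ^+ k = 2 * d / 2 ^+ k + 2 * d / 2 ^+ k by field.
by apply: lerD; rewrite raddfB /=; [exact: hx|exact: hy].
Qed.

Record triangle := Triangle { v0 : Cplx R; v1 : Cplx R; v2 : Cplx R }.

Definition tri_in X d (t : triangle) :=
  [/\ X (v0 t), X (v1 t), X (v2 t) & [/\ cmod (v1 t - v0 t) <= d,
      cmod (v2 t - v1 t) <= d & cmod (v0 t - v2 t) <= d]].

(** Stands for an integral of modulus at most [e]: the sums need not be known to converge, only to
    be eventually small. *)
Definition tri_small g e (t : triangle) :=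
  exists n0, forall n, (n0 <= n)%N -> cmod (tri n g (v0 t) (v1 t) (v2 t)) <= e.

(** If all four subtriangles were eventually within [e / 4], then [tri_split] would bring the whole
    triangle within [e] one level later. The bound on the first vertices makes iterated choices
    converge geometrically. *)
Lemma tri_bisect g X d e t : midconvex X -> tri_in X d t -> ~ tri_small g e t ->
  exists t', [/\ tri_in X (d / 2) t', ~ tri_small g (e / 4) t'
               & cmod (v0 t' - v0 t) <= d].
Proof.
case: t => a b c cX [/= Xa Xb Xc [ab bc ca]] nsm.
set p := (a + b) / 2; set q := (b + c) / 2; set r := (c + a) / 2.
have Xp : X p by exact: cX.
have Xq : X q by exact: cX.
have Xr : X r by exact: cX.
have d0 : 0 <= d by exact: le_trans ab.
have half (x y : Cplx R) : cmod x <= d -> y = x / 2 -> cmod y <= d / 2.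
  by move=> xd ->; rewrite cmod_half ler_pM2r // invr_gt0.
have half' (x y : Cplx R) : cmod x <= d -> y = x / 2 -> cmod y <= d.
  move=> xd xy; apply: le_trans (half _ _ xd xy) _.
  by rewrite ler_pdivrMr // mulr_natr mulr2n lerDl.
have nab : cmod (a - b) <= d by rewrite cmodB.
have nbc : cmod (b - c) <= d by rewrite cmodB.
have nca : cmod (c - a) <= d by rewrite cmodB.
apply: contrapT => none.
have sm t' : tri_in X (d / 2) t' -> cmod (v0 t' - a) <= d -> tri_small g (e / 4) t'.
  by move=> h1 h2; apply: contrapT => h3; apply: none; exists t'.
have [|/= |n1 h1] := sm (Triangle a p r).
- split=> //; split=> /=; [apply: (half _ _ ab)|apply: (half _ _ bc)|apply: (half _ _ ca)];
    by rewrite /p /q /r; field.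
- by rewrite subrr cmod0.
have [|/= |n2 h2] := sm (Triangle p b q).
- split=> //; split=> /=; [apply: (half _ _ ab)|apply: (half _ _ bc)|apply: (half _ _ ca)];
    by rewrite /p /q /r; field.
- by apply: (half' _ _ ab); rewrite /p; field.
have [|/= |n3 h3] := sm (Triangle r q c).
- split=> //; split=> /=; [apply: (half _ _ ab)|apply: (half _ _ bc)|apply: (half _ _ ca)];
    by rewrite /p /q /r; field.
- by apply: (half' _ _ nca); rewrite /r; field.
have [|/= |n4 h4] := sm (Triangle p q r).
- split=> //; split=> /=; [apply: (half _ _ nca)|apply: (half _ _ nab)|apply: (half _ _ nbc)];
    by rewrite /p /q /r; field.
- by apply: (half' _ _ ab); rewrite /p; field.
apply: nsm; exists (maxn (maxn n1 n2) (maxn n3 n4)).+1 => -[//|n].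
rewrite ltnS !geq_max => /andP[/andP[g1 g2] /andP[g3 g4]] /=.
rewrite tri_split.
have {}h1 := h1 _ g1; have {}h2 := h2 _ g2; have {}h3 := h3 _ g3; have {}h4 := h4 _ g4.
rewrite /= in h1 h2 h3 h4.
have -> : e = e / 4 + e / 4 + e / 4 + e / 4 by field.
do 3![apply: le_trans (cmod_triangle _ _) _; apply: lerD => //].
Qed.

(** Near the limit point [l] of the bisected triangles, [g] differs from an affine function by at
    most [e'] times the distance to [l]. Affine functions have sum zero around a triangle at every
    level, so the [k]-th triangle satisfies the bound [e / 4 ^+ k] for all [n], against its
    choice. *)
Lemma goursat g X a b c e : midconvex X ->
  (forall l, (forall r, 0 < r -> exists y, X y /\ cmod (y - l) < r) -> X l) ->
  (forall z, X z -> cdiff g z) -> X a -> X b -> X c -> 0 < e ->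
  exists n0, forall n, (n0 <= n)%N -> cmod (tri n g a b c) <= e.
Proof.
move=> cX clX gX Xa Xb Xc e0; apply: contrapT => nsm.
pose d := cmod (b - a) + cmod (c - b) + cmod (a - c).
have d0 : 0 <= d by rewrite !addr_ge0.
pose P k t := tri_in X (d / 2 ^+ k) t /\ ~ tri_small g (e / 4 ^+ k) t.
have P0 : P 0%N (Triangle a b c).
  split; last by rewrite expr0 divr1.
  rewrite expr0 divr1; split => //; split => /=; rewrite /d.
  - by rewrite -addrA lerDl addr_ge0.
  - by rewrite addrAC lerDr addr_ge0.
  - by rewrite lerDr addr_ge0.
have step (x : nat * triangle) : exists t', P x.1 x.2 ->
    P x.1.+1 t' /\ cmod (v0 t' - v0 x.2) <= d / 2 ^+ x.1.
  case: (pselect (P x.1 x.2)) => [[h1 h2]|h]; last by exists x.2.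
  have [t' [t1 t2 t3]] := tri_bisect cX h1 h2.
  exists t' => _; split=> //; rewrite /P !exprS; split.
    suff -> : d / (2 * 2 ^+ x.1) = d / 2 ^+ x.1 / 2 by [].
    by field.
  suff -> : e / (4 * 4 ^+ x.1) = e / 4 ^+ x.1 / 4 by [].
  by field.
have [F hF] := choice step.
pose t := fix t k := if k is k'.+1 then F (k', t k') else Triangle a b c.
have Pt k : P k (t k).
  elim: k => [//|k IH]; exact: (hF (k, t k) IH).1.
have [l hl] : exists l, forall k, cmod (l - v0 (t k)) <= 4 * d / 2 ^+ k.
  by apply: geometric_limit => k; exact: (hF (k, t k) (Pt k)).2.
have small (r : R) : 0 < r -> exists k, 5 * d / 2 ^+ k < r.
  move=> r0; have [k hk] : exists k : nat, 5 * d / r < k%:R.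
    exists (Num.bound (5 * d / r)); apply: archi_boundP; by apply: divr_ge0; [exact: mulr_ge0|exact: ltW].
  exists k; rewrite ltr_pdivrMr ?exprn_gt0 // [ltRHS]mulrC -ltr_pdivrMr //.
  apply: lt_trans hk _.
  by rewrite -natrX ltr_nat ltn_expl.
have Xl : X l.
  apply: clX => r r0; have [k hk] := small _ r0.
  have [[X0 _ _ _] _] := Pt k; exists (v0 (t k)); split=> //.
  rewrite cmodB; apply: le_lt_trans (hl k) (le_lt_trans _ hk).
  by rewrite ler_pM2r ?invr_gt0 ?exprn_gt0 // ler_wpM2r // ler_nat.
have [phi [cphi /nbhs_cmodP[r1 [r10 hphi]]]] := gX _ Xl.
(* Three sides of length at most [d / 2 ^+ k], on which the distance to [l] is at most
   [5 * d / 2 ^+ k] (four from [geometric_limit], one from the side), give [15 * d ^+ 2]; the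
   summand 1 covers [d = 0]. *)
pose e' := e / (15 * d ^+ 2 + 1).
have D0 : 0 < 15 * d ^+ 2 + 1 by rewrite ltr_wpDl // mulr_ge0 // sqr_ge0.
have e'0 : 0 < e' by rewrite divr_gt0.
have /nbhs_cmodP[r2 [r20 hr2]] := (contP _ _).1 cphi _ e'0.
have [k hk] := small (Num.min r1 r2) (ltac:(by rewrite lt_min r10 r20)).
have [[X0 X1 X2 [e1 e2 e3]] []] := Pt k; exists 0%N => n _.
set s := 5 * d / 2 ^+ k in hk; pose Y := [set y : Cplx R | cmod (y - l) <= s].
have s4 : 4 * d / 2 ^+ k + d / 2 ^+ k = s by rewrite /s; field.
have dk0 : 0 <= d / 2 ^+ k by rewrite divr_ge0 // exprn_ge0.
have cY : midconvex Y.
  move=> x y xY yY; rewrite /Y /=.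
  have -> : (x + y) / 2 - l = ((x - l) + (y - l)) / 2 by field.
  rewrite cmod_half ler_pdivrMr // mulr_natr mulr2n.
  exact: le_trans (cmod_triangle _ _) (lerD xY yY).
have Y0 : Y (v0 (t k)).
  by rewrite /Y /= cmodB -s4; apply: le_trans (hl k) _; rewrite lerDl.
have Y1 : Y (v1 (t k)).
  rewrite /Y /= -s4 [leRHS]addrC; apply: le_trans (cmod_sub_triangle (v0 (t k)) _ _) _.
  by apply: lerD => //; rewrite cmodB.
have Y2 : Y (v2 (t k)).
  rewrite /Y /= -s4 [leRHS]addrC; apply: le_trans (cmod_sub_triangle (v0 (t k)) _ _) _.
  by apply: lerD => //; rewrite cmodB.
pose aff := fun z : Cplx R => (g l - phi l * l) + phi l * z.
have near_aff z : Y z -> cmod (g z - aff z) <= e' * s.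
  move=> Yz; have zr : cmod (z - l) < Num.min r1 r2 by exact: le_lt_trans Yz hk.
  move: zr; rewrite lt_min => /andP[z1 z2].
  have -> : g z - aff z = (phi z - phi l) * (z - l).
    by rewrite /aff (hphi _ z1); ring.
  by rewrite cmodM ler_pM // ltW // hr2.
have -> : tri n g (v0 (t k)) (v1 (t k)) (v2 (t k)) =
    tri n (fun z => g z - aff z) (v0 (t k)) (v1 (t k)) (v2 (t k)).
  by rewrite /tri !trapB !trap_affine; field.
have B x y : Y x -> Y y -> cmod (y - x) <= d / 2 ^+ k ->
    cmod (trap n (fun z => g z - aff z) x y) <= d / 2 ^+ k * (e' * s).
  move=> Yx Yy xy; apply: le_trans (trap_bound n cY Yx Yy near_aff) _.
  apply: ler_wpM2r => //; apply: mulr_ge0; [exact: ltW|rewrite -s4].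
  by apply: addr_ge0 => //; rewrite -mulrA; apply: mulr_ge0.
apply: le_trans (_ : d / 2 ^+ k * (e' * s) * 3 <= _).
  rewrite (_ : 3 = 1 + 1 + 1 :> R); last by ring.
  rewrite !mulrDr mulr1; apply: le_trans (cmod_triangle _ _) _; apply: lerD; last exact: B.
  by apply: le_trans (cmod_triangle _ _) _; apply: lerD; exact: B.
have -> : d / 2 ^+ k * (e' * s) * 3 = (15 * d ^+ 2) / (15 * d ^+ 2 + 1) * (e / 4 ^+ k).
  rewrite /s /e' (_ : (4 : R) ^+ k = 2 ^+ k * 2 ^+ k); last by rewrite -exprMn; congr (_ ^+ _); ring.
  by field; rewrite expf_neq0 ?pnatr_eq0 //= lt0r_neq0.
rewrite -[leRHS]mul1r ler_wpM2r ?divr_ge0 ?(ltW e0) ?exprn_ge0 //.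
by rewrite ler_pdivrMr // mul1r lerDl.
Qed.

End Goursat.


(** * A triangle with a singular apex, and the kernel [1 / w] along one side of a square *)

Section MaximumModulus.
Variable R : realType.
Implicit Types (a b c z w : Cplx R) (e d M : R) (f g H : Cplx R -> Cplx R) (X : set (Cplx R)).
Local Notation ii := ('i%C : Cplx R).

Lemma ii_sqr : ii * ii = -1.
Proof. by rewrite -[LHS]expr2 sqr_i. Qed.

Lemma cmod_ii : cmod ii = 1.
Proof. by rewrite /cmod /= expr0n /= add0r expr1n sqrtr1. Qed.

Lemma trap_comp_affine n g a0 b x y :
  trap n g (a0 + x * b) (a0 + y * b) = b * trap n (fun w => g (a0 + w * b)) x y.
Proof.
elim: n x y => [|n IH] x y /=; first by field.
have -> : (a0 + x * b + (a0 + y * b)) / 2 = a0 + (x + y) / 2 * b by field.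
by rewrite !IH mulrDr.
Qed.

Definition ReIm z : R := complex.Re z + complex.Im z.

Lemma ReImD z w : ReIm (z + w) = ReIm z + ReIm w.
Proof. by rewrite /ReIm ReD ImD; ring. Qed.

Lemma ReIm_half z : ReIm (z / 2) = ReIm z / 2.
Proof.
suff : ReIm z = ReIm (z / 2) + ReIm (z / 2) by move=> ->; field.
by rewrite -ReImD; congr ReIm; field.
Qed.

Lemma ReIm_le z : ReIm z <= 2 * cmod z.
Proof.
have h1 := le_trans (ler_norm _) (Re_le_cmod z).
have h2 := le_trans (ler_norm _) (Im_le_cmod z).
by rewrite /ReIm; lra.
Qed.

(** Nothing but boundedness is assumed at the apex 0. Bisection leaves three subtriangles that avoid
    0 to [goursat]; the fourth is the whole triangle scaled by [1 / 2], which halves its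
    contribution. The constant 6 comes from three sides of length at most 2. *)
Lemma tri_apex_aux M j g e :
  (forall w, cmod w <= 1 -> cmod (g w) <= M) ->
  (forall w, cmod w <= 1 -> w != 0 -> cdiff g w) -> 0 < e ->
  exists n0, forall n, (n0 <= n)%N -> cmod (tri n g 0 1 ii) <= e + 6 * M / 2 ^+ j.
Proof.
elim: j g e => [|j IH] g e gM gd e0.
  exists 0%N => n _; rewrite expr0 divr1.
  have M0 : 0 <= M by apply: le_trans (gM 0 _) => //; rewrite cmod0.
  pose X := [set z : Cplx R | cmod z <= 1].
  have cX : midconvex X.
    move=> x y xX yX; rewrite /X /= cmod_half ler_pdivrMr // mulr_natr mulr2n.
    exact: le_trans (cmod_triangle _ _) (lerD xX yX).
  have B x y : X x -> X y -> cmod (trap n g x y) <= 2 * M.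
    move=> Xx Xy; apply: le_trans (trap_bound n cX Xx Xy gM) _.
    apply: ler_wpM2r => //; apply: le_trans (cmod_triangle _ _) _.
    by rewrite cmodN (_ : 2 = 1 + 1 :> R) ?lerD.
  have X0 : X 0 by rewrite /X /= cmod0.
  have X1 : X 1 by rewrite /X /= cmod1.
  have Xi : X ii by rewrite /X /= cmod_ii.
  rewrite (_ : e + _ = e + (2 * M + 2 * M + 2 * M)); last by ring.
  apply: ler_wpDl; first exact: ltW.
  apply: le_trans (cmod_triangle _ _) _; apply: lerD; last exact: B.
  by apply: le_trans (cmod_triangle _ _) _; apply: lerD; exact: B.
(* A part of the disc that contains the three subtriangles away from the apex and stays away from
   0. *)
pose X := [set z : Cplx R | 1 / 2 <= ReIm z /\ cmod z <= 1].
have cX : midconvex X.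
  move=> x y [x1 x2] [y1 y2]; split.
    by rewrite ReIm_half ReImD; lra.
  rewrite cmod_half ler_pdivrMr // mulr_natr mulr2n.
  exact: le_trans (cmod_triangle _ _) (lerD x2 y2).
have clX l : (forall r, 0 < r -> exists y, X y /\ cmod (y - l) < r) -> X l.
  move=> hl; split; rewrite leNgt; apply/negP => hlt.
    have [|y [[y1 _] y2]] := hl ((1 / 2 - ReIm l) / 2); first by rewrite divr_gt0 // subr_gt0.
    have := ReIm_le (y - l); have : ReIm y = ReIm (y - l) + ReIm l by rewrite -ReImD subrK.
    by lra.
  have [|y [[_ y1] y2]] := hl (cmod l - 1); first by rewrite subr_gt0.
  have := cmod_triangle y (l - y); rewrite addrC subrK -(cmodB y).
  by lra.
have gX z : X z -> cdiff g z.
  move=> [z1 z2]; apply: gd => //; apply/eqP => z0.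
  by move: z1; rewrite z0 /ReIm /= addr0; lra.
(* Three errors [e / 8], together with half of the error [e] of the induction hypothesis, stay below
   [e]. *)
have e8 : 0 < e / 8 by rewrite divr_gt0.
have R1 : ReIm 1 = 1 by rewrite /ReIm /= addr0.
have Ri : ReIm ii = 1 by rewrite /ReIm /= add0r.
have X1 : X 1 by split; rewrite ?R1 ?cmod1 //; lra.
have Xi : X ii by split; rewrite ?Ri ?cmod_ii //; lra.
have Xp : X ((0 + 1) / 2).
  by split; rewrite ?ReIm_half ?cmod_half add0r ?R1 ?cmod1; lra.
have Xr : X ((ii + 0) / 2).
  by split; rewrite ?ReIm_half ?cmod_half addr0 ?Ri ?cmod_ii; lra.
have Xq : X ((1 + ii) / 2) by exact: cX.
have [n1 h1] := goursat cX clX gX Xp X1 Xq e8.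
have [n2 h2] := goursat cX clX gX Xr Xq Xi e8.
have [n3 h3] := goursat cX clX gX Xp Xq Xr e8.
have [|w w1 w0|//|n4 h4] := IH (fun w => g (w * (1 / 2))) e.
- move=> w w1; apply: gM; rewrite mulrC mul1r mulrC cmod_half.
  by have := cmod_ge0 w; lra.
- have -> : (fun w => g (w * (1 / 2))) = (fun w => g (0 + w * (1 / 2))).
    by apply/funext => y; rewrite add0r.
  apply: cdiff_comp_affine; apply: gd; rewrite add0r mulrC mul1r mulrC.
    by rewrite cmod_half; have := cmod_ge0 w; lra.
  by rewrite mulf_neq0 // invr_neq0 // pnatr_eq0.
exists (maxn (maxn n1 n2) (maxn n3 n4)).+1 => -[//|n].
rewrite ltnS !geq_max => /andP[/andP[g1 g2] /andP[g3 g4]].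
rewrite tri_split.
have {}h1 := h1 _ g1; have {}h2 := h2 _ g2; have {}h3 := h3 _ g3; have {}h4 := h4 _ g4.
have E : tri n g 0 ((0 + 1) / 2) ((ii + 0) / 2) = (1 / 2) * tri n (fun w => g (w * (1 / 2))) 0 1 ii.
  have S x y : trap n g (x * (1 / 2)) (y * (1 / 2)) = (1 / 2) * trap n (fun w => g (w * (1 / 2))) x y.
    have := trap_comp_affine n g 0 (1 / 2) x y; rewrite !add0r => ->; congr (_ * trap _ _ _ _).
    by apply/funext => w; rewrite add0r.
  have m1 : (0 + 1) / 2 = 1 * (1 / 2) :> Cplx R by rewrite add0r !mul1r.
  have mi : (ii + 0) / 2 = ii * (1 / 2) by rewrite addr0 mul1r.
  by rewrite /tri m1 mi !mulrDr -!S mul0r.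
apply: le_trans (cmod_triangle _ _) _.
apply: le_trans (lerD (cmod_triangle _ _) h3) _.
apply: le_trans (lerD (lerD (cmod_triangle _ _) h2) (lexx _)) _.
apply: le_trans (lerD (lerD (lerD (lexx _) h1) (lexx _)) (lexx _)) _.
rewrite E cmodM (_ : cmod (1 / 2) = 1 / 2); last by rewrite cmod_half cmod1.
rewrite exprS (_ : 6 * M / (2 * 2 ^+ j) = 6 * M / 2 ^+ j / 2); last by field.
by lra.
Qed.

Lemma small_pow2 (x e : R) : 0 < e -> exists j : nat, x / 2 ^+ j < e.
Proof.
move=> e0; exists (Num.bound (`|x| / e)); rewrite ltr_pdivrMr ?exprn_gt0 //.
rewrite [ltRHS]mulrC -ltr_pdivrMr //.
apply: (@le_lt_trans _ _ (`|x| / e)); first by rewrite ler_pM2r ?invr_gt0 // ler_norm.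
apply: lt_trans (archi_boundP _) _; first by rewrite divr_ge0 // ltW.
by rewrite -natrX ltr_nat ltn_expl.
Qed.

Lemma tri_apex M g e :
  (forall w, cmod w <= 1 -> cmod (g w) <= M) ->
  (forall w, cmod w <= 1 -> w != 0 -> cdiff g w) -> 0 < e ->
  exists n0, forall n, (n0 <= n)%N -> cmod (tri n g 0 1 ii) <= e.
Proof.
move=> gM gd e0; have e2 : 0 < e / 2 by rewrite divr_gt0.
have [j hj] := small_pow2 (6 * M) e2.
have [n0 hn] := tri_apex_aux j gM gd e2; exists n0 => n /hn /le_trans; apply.
by rewrite [leRHS]splitr lerD2l ltW.
Qed.

Definition edge (t : R) : Cplx R := Complex (1 - t) t.

Lemma edge_mid s t : (edge s + edge t) / 2 = edge ((s + t) / 2).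
Proof.
apply: (@mulIf _ 2); first by rewrite pnatr_eq0.
rewrite divfK ?pnatr_eq0 // mulr_natr mulr2n.
by rewrite /edge; apply/eqP; rewrite eq_complex /=; apply/andP; split; apply/eqP; field.
Qed.

(** Replaces the value of the integral of [1 / w] around 0. Each term is controlled by [Im ((edge t
    - edge s) / edge u) = (t - s) / cmod (edge u) ^+ 2], and the segment lies in the unit disc. A
    lower bound by 1 for the whole side is enough. *)
Lemma trap_inv_edge n s t : 0 <= s -> s <= t -> t <= 1 ->
  t - s <= complex.Im (trap n (fun w => w^-1) (edge s) (edge t)).
Proof.
elim: n s t => [|n IH] s t s0 st t1.
  have key u : 0 <= u -> u <= 1 -> t - s <= complex.Im ((edge t - edge s) * (edge u)^-1).
    move=> u0 u1; rewrite /edge /=.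
    have q0 : 0 < (1 - u) ^+ 2 + u ^+ 2 by nra.
    have -> : (1 - t - (1 - s)) * - (u / ((1 - u) ^+ 2 + u ^+ 2)) + (t - s) * ((1 - u) / ((1 - u) ^+ 2 + u ^+ 2))
       = (t - s) / ((1 - u) ^+ 2 + u ^+ 2) by field; rewrite lt0r_neq0.
    rewrite ler_pdivlMr // -[leRHS]mulr1 ler_wpM2l ?subr_ge0 //; nra.
  have k1 := key s s0 (le_trans st t1); have k2 := key t (le_trans s0 st) t1.
  set z := trap _ _ _ _.
  have E : z + z = (edge t - edge s) * (edge s)^-1 + (edge t - edge s) * (edge t)^-1.
    by rewrite /z /trap; set x := (edge s)^-1; set y := (edge t)^-1; field.
  by have := congr1 (@complex.Im R) E; rewrite !ImD; lra.
have -> : trap n.+1 (fun w => w^-1) (edge s) (edge t) =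
    trap n (fun w => w^-1) (edge s) ((edge s + edge t) / 2) +
    trap n (fun w => w^-1) ((edge s + edge t) / 2) (edge t) by [].
rewrite edge_mid ImD.
have h1 := IH s ((s + t) / 2) s0; have h2 := IH ((s + t) / 2) t.
have {}h1 : (s + t) / 2 - s <= complex.Im (trap n (fun w => w^-1) (edge s) (edge ((s + t) / 2))).
  by apply: h1; lra.
have {}h2 : t - (s + t) / 2 <= complex.Im (trap n (fun w => w^-1) (edge ((s + t) / 2)) (edge t)).
  by apply: h2; lra.
by apply: le_trans (lerD h1 h2); lra.
Qed.

End MaximumModulus.


(** * The Cauchy estimate and the exclusion of strict maxima of the modulus *)

Section MaximumModulus2.
Variable R : realType.
Implicit Types (a b c z w : Cplx R) (e d M : R) (f g H : Cplx R -> Cplx R) (X : set (Cplx R)).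
Local Notation ii := ('i%C : Cplx R).

Lemma ii4 : ii ^+ 4 = 1.
Proof.
have -> : ii ^+ 4 = (ii * ii) * (ii * ii) by ring.
by rewrite ii_sqr mulrNN mulr1.
Qed.

Lemma trapZ n c f a b : trap n (fun z => c * f z) a b = c * trap n f a b.
Proof.
elim: n a b => [|n IH] a b /=; first by ring.
by rewrite !IH mulrDr.
Qed.

(* Comparing [H] with the kernel [1 / (z - z0)] along the square with vertices
   [z0 + r i^k]; the crude constant [4] is removed by taking powers in
   [no_strict_max]. *)
Lemma cauchy_estimate H z0 (rho r B m : R) :
  (forall z, cmod (z - z0) < rho -> cdiff H z) -> 0 < r -> r < rho ->
  (forall z, cmod (z - z0) <= r -> cmod (H z) <= B) ->
  (forall (t : R) k, 0 <= t <= 1 -> cmod (H (z0 + edge t * (r%:C%C * ii ^+ k))) <= m) ->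
  cmod (H z0) <= 4 * m.
Proof.
move=> Hd r0 rrho HB Hm; apply/ler_addgt0Pl => e e0.
have crk k : cmod (r%:C%C * ii ^+ k) = r.
  by rewrite cmodM cmodX cmod_ii expr1n mulr1 cmod_real gtr0_norm.
have inr k w : cmod w <= 1 -> cmod (z0 + w * (r%:C%C * ii ^+ k) - z0) <= r.
  by move=> w1; rewrite addrAC subrr add0r cmodM crk ler_piMl // ltW.
have Hz0 : cdiff H z0 by apply: Hd; rewrite subrr cmod0 (lt_trans r0).
have [phi [cphi /nbhs_cmodP[d1 [d10 hphi]]]] := Hz0.
have /nbhs_cmodP[d2 [d20 hd2]] := (contP _ _).1 cphi _ ltr01.
set d := Num.min d1 d2; have d0 : 0 < d by rewrite lt_min d10 d20.
have B0 : 0 <= B by apply: le_trans (HB z0 _) => //; rewrite subrr cmod0 ltW.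
have Ma : 0 <= (cmod (phi z0) + 1) * r by apply: mulr_ge0; [exact: addr_ge0|exact: ltW].
(* The square is cut into four triangles with apex [z0], each parametrized by the triangle 0, 1,
   [ii]. The difference quotient is differentiable off the apex and bounded, as [tri_apex] requires;
   its value at the apex is 0 by division by zero. *)
pose g k w := (H (z0 + w * (r%:C%C * ii ^+ k)) - H z0) / w.
(* The first summand bounds the quotient near the apex through [phi]; the second bounds it where
   [d <= cmod w * r], through [2 * B / cmod w]. *)
pose M := (cmod (phi z0) + 1) * r + 2 * B * r / d.
have gM k w : cmod w <= 1 -> cmod (g k w) <= M.
  move=> w1; case: (eqVneq w 0) => [->|w0].
    rewrite /g invr0 mulr0 cmod0 addr_ge0 //.
    by rewrite divr_ge0 ?(ltW d0) // mulr_ge0 ?(ltW r0) // mulr_ge0.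
  have cw0 : 0 < cmod w by rewrite cmod_gt0.
  rewrite /g cmodM cmodV ler_pdivrMr //.
  have iw := inr k w w1; have ew : cmod (z0 + w * (r%:C%C * ii ^+ k) - z0) = cmod w * r.
    by rewrite addrAC subrr add0r cmodM crk.
  set z := z0 + _ in iw ew *.
  case: (ltP (cmod (z - z0)) d) => zd.
    move: (zd); rewrite lt_min => /andP[zd1 zd2].
    rewrite (hphi _ zd1) addrAC subrr add0r cmodM ew.
    have p1 : cmod (phi z) <= cmod (phi z0) + 1.
      have := cmod_triangle (phi z - phi z0) (phi z0); rewrite subrK => /le_trans; apply.
      by rewrite addrC lerD2l ltW // hd2.
    rewrite mulrCA [leRHS]mulrC ler_pM2l // /M.
    apply: ler_wpDr; first by rewrite divr_ge0 ?(ltW d0) // mulr_ge0 ?(ltW r0) // mulr_ge0.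
    by rewrite ler_pM2r.
  apply: (@le_trans _ _ (2 * B)).
    apply: le_trans (cmod_triangle _ _) _; rewrite cmodN mulrDl !mul1r.
    by apply: lerD; apply: HB => //; rewrite subrr cmod0 ltW.
  rewrite /M [leRHS]mulrDl; apply: ler_wpDl; first exact: mulr_ge0.
  rewrite ew in zd.
  rewrite (_ : 2 * B * r / d * cmod w = 2 * B * ((cmod w * r) / d)); last by field; rewrite lt0r_neq0.
  by rewrite ler_peMr ?mulr_ge0 // ler_pdivlMr // mul1r.
have gd k w : cmod w <= 1 -> w != 0 -> cdiff (g k) w.
  move=> w1 w0; apply: cdiffM; last by apply: cdiffV => //; exact: cdiff_id.
  apply: cdiffB; last exact: cdiff_cst.
  apply: cdiff_comp_affine; apply: Hd; exact: le_lt_trans (inr k w w1) rrho.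
have [n0 h0] := tri_apex (gM 0%N) (gd 0%N) e0.
have [n1 h1] := tri_apex (gM 1%N) (gd 1%N) e0.
have [n2 h2] := tri_apex (gM 2%N) (gd 2%N) e0.
have [n3 h3] := tri_apex (gM 3%N) (gd 3%N) e0.
pose n := maxn (maxn n0 n1) (maxn n2 n3).
have {}h0 := h0 n (leq_trans (leq_maxl _ _) (leq_maxl _ _)).
have {}h1 := h1 n (leq_trans (leq_maxr _ _) (leq_maxl _ _)).
have {}h2 := h2 n (leq_trans (leq_maxl _ _) (leq_maxr _ _)).
have {}h3 := h3 n (leq_trans (leq_maxr _ _) (leq_maxr _ _)).
(* Neighbouring triangles share a spoke, run through in opposite directions, so that only the sides
   of the square survive in the total. *)
have spoke k : trap n (g k) ii 0 = - trap n (g k.+1) 0 1.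
  rewrite trap_rev; congr (- _).
  have -> : trap n (g k) 0 ii = trap n (g k) (0 + 0 * ii) (0 + 1 * ii).
    by rewrite mul0r mul1r !add0r.
  rewrite trap_comp_affine -trapZ; congr (trap _ _ _ _); apply/funext => w.
  rewrite /g add0r exprS.
  have -> : w * ii * (r%:C%C * ii ^+ k) = w * (r%:C%C * (ii * ii ^+ k)) by ring.
  case: (eqVneq w 0) => [->|w0]; first by rewrite !mul0r !invr0 !mulr0.
  have i0 : ii != 0 by rewrite -cmod_gt0 cmod_ii.
  by field; rewrite w0 i0.
have g4 : g 4%N = g 0%N.
  by rewrite /g ii4 expr0.
pose h k w := H (z0 + w * (r%:C%C * ii ^+ k)) / w.
pose L := trap n (fun w => w^-1) 1 ii.
have edge_k k : trap n (g k) 1 ii = trap n (h k) 1 ii - H z0 * L.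
  rewrite /L -trapZ -trapB; congr (trap _ _ _ _); apply/funext => w.
  by rewrite /g /h mulrBl.
have e1 : 1 = edge 0 :> Cplx R by rewrite /edge subr0.
have ei : ii = edge 1 by rewrite /edge subrr.
have L1 : 1 <= cmod L.
  have := @trap_inv_edge R n 0 1 (lexx _) ler01 (lexx _); rewrite -e1 -ei subr0 => /le_trans; apply.
  exact: le_trans (ler_norm _) (Im_le_cmod _).
pose X := [set w : Cplx R | exists t, 0 <= t <= 1 /\ w = edge t].
have cX : midconvex X.
  move=> _ _ [s [/andP[s0 s1] ->]] [t [/andP[t0 t1] ->]]; exists ((s + t) / 2); split.
    by apply/andP; split; lra.
  exact: edge_mid.
have m0 : 0 <= m.
  by apply: le_trans (Hm 0 0%N _); rewrite ?lexx ?ler01.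
(* On a side [cmod (edge t)] is at least [1 / 2], so the integrand is at most [2 * m], and the side
   has length at most 2. *)
have hb k : cmod (trap n (h k) 1 ii) <= 4 * m.
  have hX w : X w -> cmod (h k w) <= 2 * m.
    move=> [t [t01 ->]]; rewrite /h cmodM cmodV.
    have he : 1 / 2 <= cmod (edge t).
      have := ReIm_le (edge t); rewrite /ReIm /= subrK; lra.
    have he0 : 0 < cmod (edge t) by apply: lt_le_trans he.
    rewrite ler_pdivrMr //; apply: le_trans (Hm t k t01) _.
    by rewrite -mulrA (mulrC m) mulrA ler_peMl //; lra.
  apply: le_trans (trap_bound n cX _ _ hX) _; rewrite /X /=.
  - by exists 0; rewrite lexx ler01.
  - by exists 1; rewrite lexx ler01.
  rewrite (_ : 4 * m = 2 * (2 * m)); last by ring.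
  apply: ler_wpM2r; first by rewrite mulr_ge0.
  by apply: le_trans (cmod_triangle _ _) _; rewrite cmodN cmod_ii cmod1 (_ : 1 + 1 = 2).
(* In the parameter [w] the kernel is the same on all four sides, whence one [L] taken four times.
   With [1 <= cmod L] the estimate becomes [cmod (H z0) <= 4 * m + e]. *)
have key : 4 * (H z0 * L) = trap n (h 0%N) 1 ii + trap n (h 1%N) 1 ii + trap n (h 2%N) 1 ii + trap n (h 3%N) 1 ii
   - (tri n (g 0%N) 0 1 ii + tri n (g 1%N) 0 1 ii + tri n (g 2%N) 0 1 ii + tri n (g 3%N) 0 1 ii).
  by rewrite /tri !spoke !edge_k g4; ring.
have : cmod (4 * (H z0 * L)) <= 4 * m + 4 * m + 4 * m + 4 * m + (e + e + e + e).
  rewrite key; apply: le_trans (cmod_triangle _ _) _; rewrite cmodN; apply: lerD.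
    by do 3![apply: le_trans (cmod_triangle _ _) _; apply: lerD => //].
  by do 3![apply: le_trans (cmod_triangle _ _) _; apply: lerD => //].
have c4 : cmod (4 : Cplx R) = 4.
  have -> : (4 : Cplx R) = (4 : R)%:C%C by rewrite rmorphMn.
  by rewrite cmod_real ger0_norm.
rewrite !cmodM c4 => hh.
have : cmod (H z0) <= cmod (H z0) * cmod L by rewrite ler_peMr.
by lra.
Qed.

Lemma unbounded_pow (x C : R) : 1 < x -> exists n : nat, C < x ^+ n.
Proof.
move=> x1; have [n hn] : exists n : nat, C < n%:R * (x - 1).
  exists (Num.bound (`|C| / (x - 1))); rewrite -ltr_pdivrMr ?subr_gt0 //.
  apply: (@le_lt_trans _ _ (`|C| / (x - 1))).
    by rewrite ler_pM2r ?invr_gt0 ?subr_gt0 // ler_norm.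
  by apply: archi_boundP; rewrite divr_ge0 // subr_ge0 ltW.
exists n; apply: lt_le_trans hn _; elim: n => [|n IH]; first by rewrite mul0r.
rewrite exprS -natr1 mulrDl mul1r.
have xn : 1 <= x ^+ n by rewrite exprn_ege1 // ltW.
nra.
Qed.

(** By compactness, strictness leaves a gap between [cmod (H z0)] and the maximum on the square.
    Powers of [H] widen the ratio beyond the constant 4 of [cauchy_estimate]. *)
Lemma no_strict_max H z0 rho : 0 < rho ->
  (forall z, cmod (z - z0) < rho -> cdiff H z) ->
  (forall z, cmod (z - z0) < rho -> z != z0 -> cmod (H z) < cmod (H z0)) -> False.
Proof.
move=> rho0 Hd Hlt; pose r := rho / 2.
have r0 : 0 < r by rewrite divr_gt0.
have rrho : r < rho by rewrite /r ltr_pdivrMr // mulr_natr mulr2n ltrDl.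
have crk k : cmod (r%:C%C * ii ^+ k) = r.
  by rewrite cmodM cmodX cmod_ii expr1n mulr1 cmod_real gtr0_norm.
have edge1 t : 0 <= t <= 1 -> cmod (edge t) <= 1.
  move=> /andP[t0 t1]; rewrite -(@ler_pXn2r _ 2) ?nnegrE // cmod_sqr /= expr1n; nra.
have edge0 t : edge t != 0.
  apply/eqP => et; have := ReIm_le (edge t); rewrite {2}et cmod0 /ReIm /= subrK; lra.
pose p k t := z0 + edge t * (r%:C%C * ii ^+ k).
have pk k t : 0 <= t <= 1 -> cmod (p k t - z0) < rho /\ p k t != z0.
  move=> t01; rewrite /p addrAC subrr add0r cmodM crk; split.
    by apply: le_lt_trans rrho; rewrite ler_piMl ?edge1 // ltW.
  by rewrite -subr_eq0 addrAC subrr add0r mulf_neq0 ?edge0 // -cmod_gt0 crk.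
have cont k t : 0 <= t <= 1 -> {for t, continuous (fun t => cmod (H (p k t)))}.
  move=> t01; have [pr _] := pk k t t01.
  have cH := cdiff_continuous (Hd _ pr).
  apply/(@cvgrPdist_lt _ R^o) => e e0.
  have /nbhs_cmodP[d [d0 hd]] := (contP _ _).1 cH _ e0.
  have : \forall s \near t, `|t - s| < d / (2 * r).
    by apply: nbhsx_ballx; rewrite divr_gt0 // mulr_gt0.
  apply: filterS => s st; rewrite distrC; apply: le_lt_trans (cmod_dist _ _) _.
  apply: hd; rewrite /p opprD addrACA subrr add0r -mulrBl cmodM crk.
  apply: (@le_lt_trans _ _ (2 * `|t - s| * r)).
    rewrite ler_pM2r //; apply: le_trans (cmod_le_ReIm _) _; rewrite ReD ImD ReN ImN /=.
    by rewrite (_ : 1 - s - (1 - t) = t - s) ?(distrC s t); [lra|ring].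
  by rewrite mulrAC mulrC -ltr_pdivlMr ?mulr_gt0.
have mx k : exists m, m < cmod (H z0) /\ forall t, 0 <= t <= 1 -> cmod (H (p k t)) <= m.
  have [|c c01 cm] := @EVT_max R (fun t => cmod (H (p k t))) 0 1 ler01.
    apply: continuous_in_subspaceT => t; rewrite inE /= in_itv /=; exact: cont.
  move: c01; rewrite in_itv /= => /(pk k)[c1 c2].
  exists (cmod (H (p k c))); split; first exact: Hlt.
  by move=> t t01; apply: cm; rewrite in_itv.
have [m [mlt hm]] : exists m, m < cmod (H z0) /\ forall t k, 0 <= t <= 1 -> cmod (H (p k t)) <= m.
  have [m0 [l0 h0]] := mx 0%N; have [m1 [l1 h1]] := mx 1%N.
  have [m2 [l2 h2]] := mx 2%N; have [m3 [l3 h3]] := mx 3%N.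
  exists (Num.max (Num.max m0 m1) (Num.max m2 m3)); split; first by rewrite !gt_max l0 l1 l2 l3.
  have i4 : ii ^+ 4 = 1 by exact: ii4.
  move=> t k t01; have -> : p k t = p (k %% 4)%N t.
    by rewrite /p {1}(divn_eq k 4) exprD mulnC exprM i4 expr1n mul1r.
  have : (k %% 4 < 4)%N by rewrite ltn_pmod.
  case: (k %% 4)%N => [|[|[|[|//]]]] _; rewrite !le_max.
  - by rewrite h0.
  - by rewrite h1 // orbT.
  - by rewrite h2 // orbT.
  - by rewrite h3 // !orbT.
have mge0 : 0 <= m by apply: le_trans (hm 0 0%N _); rewrite ?lexx ?ler01.
have H0 : 0 < cmod (H z0) by apply: le_lt_trans mlt.
(* An intermediate value, positive even if [m = 0], so that one can divide by it. *)
pose m' := (m + cmod (H z0)) / 2.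
have m'0 : 0 < m' by rewrite divr_gt0 // ltr_wpDl.
have m'lt : m' < cmod (H z0) by rewrite /m'; lra.
have mm' : m <= m' by rewrite /m'; lra.
have [N hN] := @unbounded_pow (cmod (H z0) / m') 4 (ltac:(by rewrite ltr_pdivlMr // mul1r)).
have := @cauchy_estimate (fun z => H z ^+ N) z0 rho r (cmod (H z0) ^+ N) (m' ^+ N).
rewrite cmodX => /(_ _ r0 rrho _ _)/Wrap[].
- by move=> z zr; apply: cdiffX; exact: Hd.
- move=> z zr; rewrite cmodX lerXn2r ?nnegrE //.
  by case: (eqVneq z z0) => [->//|zz]; apply/ltW/Hlt => //; exact: le_lt_trans rrho.
- move=> t k t01; rewrite cmodX lerXn2r ?nnegrE ?(ltW m'0) //.
  exact: le_trans (hm t k t01) mm'.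
apply/negP; rewrite -ltNge -ltr_pdivlMr ?exprn_gt0 //.
by move: hN; rewrite expr_div_n.
Qed.

End MaximumModulus2.


(** * Topology and integration on the circle *)

(** Compactness as an induction principle: the sets [A] with [P (K \ A)] form a filter, and if [P K]
    failed it would be proper; a cluster point in [K] then contradicts the local hypothesis. It
    replaces the extraction of finite subcovers. *)
Lemma compact_ind (T : topologicalType) (K : set T) (P : set T -> Prop) :
  compact K -> P set0 -> (forall A B, P A -> P B -> P (A `|` B)) ->
  (forall A B, A `<=` B -> P B -> P A) ->
  (forall x, K x -> exists U, nbhs x U /\ P (K `&` U)) -> P K.
Proof.
move=> cK P0 PU PS Ploc; apply: contrapT => nPK.
pose F : set_system T := [set A | P (K `\` A)].
have FF : ProperFilter F.
  apply: Build_ProperFilter_ex => [A FA|].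
    apply: contrapT => nA; apply: nPK; apply: PS FA => x Kx; split=> // Ax.
    by apply: nA; exists x.
  split; rewrite /F /=.
  - by rewrite setDT.
  - move=> A B FA FB; apply: PS (PU _ _ FA FB) => x [Kx nAB].
    by case: (pselect (A x)) => Ax; [right; split=> // Bx; exact: nAB|left].
  - by move=> A B AB; apply: PS; exact: setDS.
have FK : F K by rewrite /F /= setDv.
have [x [Kx clx]] := cK F FF FK.
have [U [xU PU']] := Ploc x Kx.
have : F (~` U) by rewrite /F /= setDE setCK.
by move=> /clx /(_ xU) [y []].
Qed.

Section PlaneTopology.
Variable R : realType.
Implicit Types (a z : Cplx R) (r e : R) (A : set (Cplx R)).

Lemma closed_cmodP A :
  (forall l, (forall r, 0 < r -> exists y, A y /\ cmod (y - l) < r) -> A l) -> closed A.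
Proof.
move=> hA l cl; apply: hA => r r0.
have [y [Ay yl]] := cl _ (nbhs_cmod_ball l r0).
by exists y.
Qed.

Lemma contRP (u : Cplx R -> R) z : {for z, continuous u} <->
  forall e, 0 < e -> exists d, 0 < d /\ forall y, cmod (y - z) < d -> `|u y - u z| < e.
Proof.
have H := @cvgrPdist_lt R R^o (Cplx R) (nbhs z) _ u (u z); split.
  move=> /H h e /h /nbhs_cmodP[d [d0 hd]]; exists d; split=> // y /hd.
  by rewrite distrC.
move=> h; apply/H => e /h[d [d0 hd]]; apply/nbhs_cmodP; exists d; split=> // y /hd.
by rewrite distrC.
Qed.

Lemma closed_cmod_le (u : Cplx R -> R) r :
  (forall z, {for z, continuous u}) -> closed [set z | u z <= r].
Proof.
move=> cu; apply: closed_cmodP => l hl /=; rewrite leNgt; apply/negP => rl.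
have e0 : 0 < u l - r by rewrite subr_gt0.
have [d [d0 hd]] := (contRP _ _).1 (cu l) _ e0.
have [y [/= ur /hd]] := hl _ d0.
by rewrite ltr_norml => /andP[]; lra.
Qed.

Lemma cont_cmodB a z : {for z, continuous (fun z : Cplx R => cmod (z - a))}.
Proof.
apply/contRP => e e0; exists e; split => // y yz.
by apply: le_lt_trans (cmod_dist _ _) _; rewrite opprB addrA subrK.
Qed.

Lemma cont_cmod z : {for z, continuous (fun z : Cplx R => cmod z)}.
Proof.
have -> : (fun z : Cplx R => cmod z) = (fun z => cmod (z - 0)).
  by apply/funext => y; rewrite subr0.
exact: cont_cmodB.
Qed.

Lemma compact_disc a r : compact [set z : Cplx R | cmod (z - a) <= r].
Proof.
pose S := (`[- r, r]%classic `*` `[- r, r]%classic : set (R * R)).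
pose h (p : R * R) : Cplx R := a + Complex p.1 p.2.
have cS : compact S by apply: compact_setX; exact: segment_compact.
have ch : continuous h.
  move=> p; apply/(@cvg_cmod R (R * R)%type (nbhs p) _ h (h p)) => e e0.
  have e2 : 0 < e / 2 by rewrite divr_gt0.
  exists (ball p.1 (e / 2), ball p.2 (e / 2)); first by split; exact: nbhsx_ballx.
  move=> q [/= q1 q2]; rewrite /h opprD addrACA subrr add0r.
  apply: le_lt_trans (cmod_le_ReIm _) _; rewrite ReD ReN ImD ImN /= (splitr e).
  by rewrite distrC [X in _ + X]distrC; exact: ltrD.
have cI : compact (h @` S) by apply: continuous_compact => //; exact: continuous_subspaceT.
apply: subclosed_compact cI _; first by apply: closed_cmod_le => z; exact: cont_cmodB.
move=> z /= zr; exists (complex.Re (z - a), complex.Im (z - a)).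
  split; rewrite /= in_itv /= -ler_norml.
    exact: le_trans (Re_le_cmod _) zr.
  exact: le_trans (Im_le_cmod _) zr.
by rewrite /h /= -[in RHS](subrK a z) addrC; congr (_ + _); case: (z - a).
Qed.

Lemma uniform_continuity (F : R -> R) (a b e : R) :
  continuous F -> 0 < e ->
  exists d : R, 0 < d /\ forall x y, a <= x <= b -> `|x - y| < d -> `|F x - F y| <= e.
Proof.
move=> cF e0.
have := @compact_ind R `[a, b]%classic (fun A : set R => exists d, 0 < d /\
  forall x y, A x -> `|x - y| < d -> `|F x - F y| <= e) (@segment_compact R a b).
case.
- by exists 1; split.
- move=> A B [d1 [d10 h1]] [d2 [d20 h2]]; exists (Num.min d1 d2).
  split; first by rewrite lt_min d10 d20.
  by move=> x y [Ax|Bx]; rewrite lt_min => /andP[x1 x2]; [exact: h1|exact: h2].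
- move=> A B AB [d [d0 h]]; exists d; split=> // x y /AB; exact: h.
- move=> x _; have e2 : 0 < e / 2 by rewrite divr_gt0.
  have /nbhs_ballP[d /= d0 hd] : \forall y \near x, `|F x - F y| < e / 2.
    by move/(@cvgrPdist_lt _ R^o): (cF x); exact.
  have d2 : 0 < d / 2 by rewrite divr_gt0.
  exists (ball x (d / 2)); split; first exact: nbhsx_ballx.
  exists (d / 2); split=> // y z [_ xy] yz.
  have hy : `|F x - F y| < e / 2.
    by apply: hd; rewrite /ball /=; apply: lt_trans xy _; rewrite ltr_pdivrMr // mulr_natr mulr2n ltrDl.
  have hz : `|F x - F z| < e / 2.
    apply: hd; rewrite /ball /= (splitr d).
    exact: le_lt_trans (ler_distD y _ _) (ltrD xy yz).
  rewrite (splitr e); apply/ltW/(le_lt_trans (ler_distD (F x) _ _)).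
  by rewrite distrC; exact: ltrD.
- by move=> d [d0 hd]; exists d; split=> // x y xab; apply: hd; rewrite /= in_itv.
Qed.

End PlaneTopology.


Section RealContinuity.
Variables (R : realType) (T : topologicalType).
Implicit Types (u v : T -> R) (x : T).

Lemma contR_cst (c : R) x : {for x, continuous (fun _ : T => c)}.
Proof. exact: cst_continuous. Qed.

Lemma contRD u v x : {for x, continuous u} -> {for x, continuous v} ->
  {for x, continuous (fun y => u y + v y)}.
Proof. by move=> cu cv; rewrite /prop_for /continuous_at; apply: (@cvgD R R^o T (nbhs x) _ u v). Qed.

Lemma contRM u v x : {for x, continuous u} -> {for x, continuous v} ->
  {for x, continuous (fun y => u y * v y)}.
Proof. by move=> cu cv; apply: (@cvgM R T (nbhs x) _ u v). Qed.

Lemma contR_comp (h : R -> R) u x : {for x, continuous u} -> {for u x, continuous h} ->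
  {for x, continuous (fun y => h (u y))}.
Proof. by move=> cu ch; exact: (@continuous_comp _ _ _ u h x cu ch). Qed.

Lemma contR_sum (I : eqType) (s : seq I) (u : I -> T -> R) x :
  (forall i, i \in s -> {for x, continuous (u i)}) ->
  {for x, continuous (fun y => \sum_(i <- s) u i y)}.
Proof.
elim: s => [|i s IH] cu.
  have -> : (fun y => \sum_(i <- [::]) u i y) = (fun=> 0) by apply/funext => y; rewrite big_nil.
  exact: contR_cst.
have -> : (fun y => \sum_(j <- i :: s) u j y) = (fun y => u i y + \sum_(j <- s) u j y).
  by apply/funext => y; rewrite big_cons.
apply: contRD; first by apply: cu; rewrite mem_head.
by apply: IH => j js; apply: cu; rewrite in_cons js orbT.
Qed.

Lemma contR_prod (I : eqType) (s : seq I) (u : I -> T -> R) x :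
  (forall i, i \in s -> {for x, continuous (u i)}) ->
  {for x, continuous (fun y => \prod_(i <- s) u i y)}.
Proof.
elim: s => [|i s IH] cu.
  have -> : (fun y => \prod_(i <- [::]) u i y) = (fun=> 1) by apply/funext => y; rewrite big_nil.
  exact: contR_cst.
have -> : (fun y => \prod_(j <- i :: s) u j y) = (fun y => u i y * \prod_(j <- s) u j y).
  by apply/funext => y; rewrite big_cons.
apply: contRM; first by apply: cu; rewrite mem_head.
by apply: IH => j js; apply: cu; rewrite in_cons js orbT.
Qed.

End RealContinuity.

(** * The unit circle and Riemann sums of circle averages *)

Section Circle.
Variable R : realType.
Implicit Types (l : Cplx R) (r e s t : R) (F : R -> R).
Local Notation mu := (@lebesgue_measure R).

Lemma cexpiD s t : cexpi (s + t) = cexpi s * cexpi t.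
Proof.
rewrite /cexpi cosD sinD; apply/eqP; rewrite eq_complex /=.
by apply/andP; split; apply/eqP; ring.
Qed.

Lemma cexpi0 : cexpi (0 : R) = 1.
Proof. by rewrite /cexpi cos0 sin0. Qed.

Lemma cmod_cexpi t : cmod (cexpi t) = 1.
Proof.
apply/eqP; rewrite -(@eqrXn2 _ 2) // cmod_sqr /= cos2Dsin2 expr1n //.
Qed.

Lemma cexpi_pi : cexpi (pi : R) = -1.
Proof. by rewrite /cexpi cospi sinpi; apply/eqP; rewrite eq_complex /= oppr0 !eqxx. Qed.

Lemma cexpi_2pi : cexpi (2 * pi : R) = 1.
Proof. by rewrite mulr_natl mulr2n cexpiD cexpi_pi mulrNN mulr1. Qed.

Lemma cont_cexpi_comp (Phi : Cplx R -> R) (a : Cplx R) r t :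
  {for a + r%:C%C * cexpi t, continuous Phi} ->
  {for t, continuous (fun t => Phi (a + r%:C%C * cexpi t))}.
Proof.
move=> cPhi; have cc : {for t, continuous (fun t => a + r%:C%C * cexpi t)}.
  apply/(@cvg_cmod R R (nbhs t) _) => e e0.
  pose h := e / (2 * (`|r| + 1)).
  have r1 : 0 < `|r| + 1 by rewrite ltr_wpDl.
  have h0 : 0 < h by rewrite divr_gt0 // mulr_gt0.
  have c1 : \forall s \near t, `|cos t - cos s| < h.
    by move/(@cvgrPdist_lt _ R^o): (@continuous_cos R t); exact.
  have s1 : \forall s \near t, `|sin t - sin s| < h.
    by move/(@cvgrPdist_lt _ R^o): (@continuous_sin R t); exact.
  apply: filterS2 c1 s1 => s hc hs.
  rewrite opprD addrACA subrr add0r -mulrBr cmodM cmod_real.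
  have : cmod (cexpi s - cexpi t) <= 2 * h.
    apply: le_trans (cmod_le_ReIm _) _; rewrite ReD ReN ImD ImN /=.
    by rewrite distrC [X in _ + X]distrC; lra.
  move=> hh; apply: (@le_lt_trans _ _ (`|r| * (2 * h))); first exact: ler_wpM2l.
  have -> : e = (`|r| + 1) * (2 * h) by rewrite /h; field; rewrite lt0r_neq0.
  by rewrite ltr_pM2r ?mulr_gt0 // ltrDl.
exact: (@continuous_comp _ _ _ (fun t => a + r%:C%C * cexpi t) Phi t cc cPhi).
Qed.

Lemma polar_form l : cmod l = 1 -> exists t, 0 <= t <= 2 * pi /\ l = cexpi t.
Proof.
move=> l1; set x := complex.Re l; set y := complex.Im l.
have xy : x ^+ 2 + y ^+ 2 = 1 by rewrite -cmod_sqr l1 expr1n.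
have x1 : -1 <= x <= 1 by rewrite -ler_norml -l1 Re_le_cmod.
have lE : l = Complex x y by rewrite /x /y; case: (l).
have ca : cos (acos x) = x by rewrite acosK // in_itv.
have sa : sin (acos x) = `|y|.
  by rewrite sin_acos // -xy addrAC subrr add0r sqrtr_sqr.
have a0 := acos_ge0 x1; have ap := acos_lepi x1; have pp := pi_gt0 R.
case: (leP 0 y) => y0.
  exists (acos x); split; first by apply/andP; split => //; lra.
  by rewrite /cexpi ca sa ger0_norm.
exists (2 * pi - acos x); split; first by apply/andP; split; lra.
rewrite cexpiD cexpi_2pi mul1r /cexpi cosN sinN ca sa ltr0_norm // opprK //.
Qed.

Lemma integrable_itv F (i : interval R) (a b : R) : continuous F ->
  [set` i] `<=` `[a, b]%classic -> mu.-integrable [set` i] (EFin \o F).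
Proof.
move=> cF iab; apply: (@integrableS _ _ _ mu `[a, b]%classic) => //.
apply: continuous_compact_integrable; first exact: segment_compact.
exact: continuous_subspaceT.
Qed.

Lemma Rintegral_piece F (a b c e : R) : continuous F -> a <= b ->
  (forall x, a <= x <= b -> `|F x - c| <= e) ->
  `|\int[mu]_(x in `]a, b]) F x - (b - a) * c| <= (b - a) * e.
Proof.
move=> cF ab Fc.
have sub : `]a, b]%classic `<=` `[a, b]%classic.
  by move=> x /=; rewrite !in_itv /= => /andP[h1 h2]; rewrite (ltW h1) h2.
have muab : fine (mu `]a, b]%classic) = b - a.
  rewrite lebesgue_measure_itv /= lte_fin; case: ltP => // ba.
  by have -> : a = b; [apply/eqP; rewrite eq_le ab ba|rewrite subrr].
have cst k : \int[mu]_(x in `]a, b]) (fun=> k) x = (b - a) * k.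
  by rewrite Rintegral_cst // muab mulrC.
have ic k : mu.-integrable `]a, b]%classic (EFin \o (fun=> k)).
  apply: integrable_itv sub; exact: cst_continuous.
have iF := integrable_itv cF sub.
have up : \int[mu]_(x in `]a, b]) F x <= (b - a) * (c + e).
  rewrite -cst; apply: le_Rintegral => // x /sub; rewrite /= in_itv /= => /Fc.
  by rewrite ler_norml => /andP[_]; rewrite lerBlDl.
have lo : (b - a) * (c - e) <= \int[mu]_(x in `]a, b]) F x.
  rewrite -cst; apply: le_Rintegral => // x /sub; rewrite /= in_itv /= => /Fc.
  by rewrite ler_norml => /andP[]; lra.
rewrite mulrDr in up; rewrite mulrBr in lo; rewrite ler_norml lerBlDr lerBrDr.
by rewrite [- _ + _]addrC lo addrC up.
Qed.

(** The threshold [n0] does not depend on the tags: [submean_log] fixes [n] before it finds the tags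
    it needs. *)
Lemma riemann_sum F e : continuous F -> 0 < e ->
  exists n0, forall n (t : nat -> R), (n0 < n)%N ->
    (forall j, (j < n)%N -> 2 * pi * j%:R / n%:R <= t j <= 2 * pi * j.+1%:R / n%:R) ->
    `|\int[mu]_(x in `[0%R, 2 * pi]) F x - 2 * pi / n%:R * \sum_(j < n) F (t j)| <= e.
Proof.
move=> cF e0; have pp := pi_gt0 R; have p2 : 0 < 2 * pi :> R by rewrite mulr_gt0.
have e'0 : 0 < e / (2 * pi) by rewrite divr_gt0.
have [d [d0 hd]] := uniform_continuity 0 (2 * pi) cF e'0.
exists (Num.bound (2 * pi / d)) => n t n0 ht.
have n1 : (0 < n)%N by exact: leq_ltn_trans n0.
have nR : 0 < n%:R :> R by rewrite ltr0n.
have step : 2 * pi / n%:R < d.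
  rewrite ltr_pdivrMr // [ltRHS]mulrC -ltr_pdivrMr //.
  apply: lt_trans (archi_boundP _) _; first by apply: divr_ge0; exact: ltW.
  by rewrite ltr_nat.
pose x (m : nat) : R := 2 * pi * m%:R / n%:R.
have xS m : x m.+1 - x m = 2 * pi / n%:R by rewrite /x -natr1; field; rewrite lt0r_neq0.
have xle m : x m <= x m.+1 by rewrite -subr_ge0 xS divr_ge0 // ltW.
have x0 m : 0 <= x m by rewrite /x divr_ge0 ?mulr_ge0 // ltW.
have xn m : (m <= n)%N -> x m <= 2 * pi.
  by move=> mn; rewrite /x ler_pdivrMr // ler_pM2l // ler_nat.
have main m : (m <= n)%N -> `|\int[mu]_(y in `[0%R, x m]) F y - 2 * pi / n%:R * \sum_(j < m) F (t j)|
    <= m%:R * (2 * pi / n%:R * (e / (2 * pi))).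
  elim: m => [|m IH] mn.
    rewrite big_ord0 mulr0 subr0 mul0r /x mulr0 mul0r set_itv1 Rintegral_set1 normr0 //.
  have {}IH := IH (ltnW mn).
  have iF : mu.-integrable `[0%R, x m.+1]%classic (EFin \o F).
    by apply: (@integrable_itv F _ 0 (x m.+1)).
  have := Rintegral_itvB (x := x m) iF; rewrite !bnd_simp => /(_ (x0 m) (xle m)) split_int.
  have := @Rintegral_piece F (x m) (x m.+1) (F (t m)) (e / (2 * pi)) cF (xle m).
  rewrite -split_int xS => piece.
  have {}piece := piece _.
  have Hp : forall y, x m <= y <= x m.+1 -> `|F y - F (t m)| <= e / (2 * pi).
    move=> y /andP[y1 y2]; apply: hd.
      by rewrite (le_trans (x0 m) y1) (le_trans y2 (xn _ mn)).
    have /andP[t1 t2] := ht m mn; rewrite -/(x m) -/(x m.+1) in t1 t2.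
    apply: le_lt_trans step; rewrite -(xS m) ler_norml; apply/andP; split; lra.
  have {}piece := piece Hp.
  rewrite big_ord_recr /= -[m.+1%:R]natr1 mulrDr [leRHS]mulrDl mul1r.
  have := le_trans (ler_normD _ _) (lerD IH piece) => h; apply: (le_trans _ h).
  by rewrite le_eqVlt; apply/orP; left; apply/eqP; congr (`|_|); ring.
have := main n (leqnn n).
have -> : x n = 2 * pi by rewrite /x mulfK // lt0r_neq0.
have cancel (p u w : R) : p != 0 -> u != 0 -> u * (p / u * (w / p)) = w.
  by move=> p0 u0; field; rewrite p0 u0.
by rewrite cancel // lt0r_neq0.
Qed.

End Circle.


(** * The submean value property *)

(* [Phi] is touched from below at [l0] by the modulus of a holomorphic
   function: a substitute for local log-subharmonicity, stable under products
   and sufficient for the maximum principle. *)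
Definition log_support (R : realType) (Phi : Cplx R -> R) (l0 : Cplx R) :=
  exists (G : Cplx R -> Cplx R) (d : R), [/\ 0 < d, cmod (G l0) = Phi l0 &
    forall l, cmod (l - l0) < d -> cdiff G l /\ cmod (G l) <= Phi l].

Section SubmeanValue.
Variable R : realType.
Implicit Types (l : Cplx R) (r e s t : R) (F : R -> R) (Phi : Cplx R -> R).
Local Notation mu := (@lebesgue_measure R).

Lemma max_principle Phi (m : R) :
  (forall l, cmod l <= 1 -> 0 < Phi l) ->
  (forall l, cmod l <= 1 -> {for l, continuous Phi}) ->
  (forall l, cmod l < 1 -> log_support Phi l) ->
  (forall l, cmod l = 1 -> Phi l <= m) -> Phi 0 <= m.
Proof.
move=> Phi_gt0 cPhi sPhi mPhi; rewrite leNgt; apply/negP => mlt.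
have m0 : 0 < m by apply: lt_le_trans (mPhi 1 (cmod1 R)); apply: Phi_gt0; rewrite cmod1.
(* Small enough that the factor [1 + eta] on the circle does not lift [m] up to [Phi 0]; hence the
   maximum of [chi] is interior. *)
pose eta := (Phi 0 - m) / (2 * m).
have eta0 : 0 < eta by rewrite divr_gt0 ?mulr_gt0 // subr_gt0.
have etam : m * (1 + eta) < Phi 0.
  have -> : m * (1 + eta) = (m + Phi 0) / 2 by rewrite /eta; field; rewrite lt0r_neq0.
  by lra.
(* The factor [1 + eta |l|^2] is strictly log-subharmonic: near [l0] it exceeds
   a multiple of [|1 + b (l - l0)|^2], so that a maximum of [chi] would be a
   strict maximum of the modulus of the holomorphic function [H]. *)
pose chi l := Phi l * (1 + eta * cmod l ^+ 2).
have cc l : cmod l <= 1 -> {for l, continuous chi}.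
  move=> l1; apply: contRM; first exact: cPhi.
  apply: contRD; first exact: contR_cst.
  apply: contRM; first exact: contR_cst.
  have c0 := @cont_cmod R l.
  exact: (contRM c0 c0).
pose D := [set l : Cplx R | cmod l <= 1].
have cD : compact D.
  have := @compact_disc R 0 1; rewrite /D; congr compact.
  by apply/seteqP; split => z /=; rewrite subr0.
have [||l0 l0D l0max] := @compact_EVT_max _ R chi D _ cD.
- by exists 0; rewrite /D /= cmod0.
- by apply: continuous_in_subspaceT => l; rewrite inE; exact: cc.
have {}l0max l : cmod l <= 1 -> chi l <= chi l0 by move=> l1; apply: l0max; rewrite inE.
move: l0D; rewrite inE /D /= => l01.
have chi0 : chi 0 = Phi 0 by rewrite /chi cmod0 expr0n /= mulr0 addr0 mulr1.
have big0 : Phi 0 <= chi l0 by rewrite -chi0; apply: l0max; rewrite cmod0.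
have {}l01 : cmod l0 < 1.
  rewrite lt_neqAle l01 andbT; apply/eqP => l1.
  move: big0; rewrite /chi l1 expr1n mulr1 leNgt => /negP; apply.
  apply: le_lt_trans etam; apply: ler_wpM2r; last exact: mPhi.
  by apply: addr_ge0 => //; exact: ltW.
have [G [d [d0 Gl0 hG]]] := sPhi _ l01.
pose s := 1 + eta * cmod l0 ^+ 2.
have s1 : 1 <= s by rewrite /s lerDl mulr_ge0 ?sqr_ge0 // ltW.
have s0 : 0 < s by apply: lt_le_trans s1.
(* This is [eta / s] times the conjugate of [l0], the choice for which [s * cmod (q l) ^+ 2] and
   [1 + eta * cmod l ^+ 2] agree to first order at [l0]; the remainder in [key] is positive off
   [l0]. *)
pose b : Cplx R := Complex (eta * complex.Re l0 / s) (- (eta * complex.Im l0 / s)).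
pose q l : Cplx R := 1 + (l - l0) * b.
have key l : s * cmod (q l) ^+ 2 + eta / s * cmod (l - l0) ^+ 2 = 1 + eta * cmod l ^+ 2.
  rewrite !cmod_sqr /q.
  set u := complex.Re (l - l0); set v := complex.Im (l - l0).
  have Rl : complex.Re l = complex.Re l0 + u by rewrite /u ReD ReN addrC subrK.
  have Il : complex.Im l = complex.Im l0 + v by rewrite /v ImD ImN addrC subrK.
  have -> : l - l0 = Complex u v by rewrite /u /v; case: (l - l0).
  rewrite ReD ImD Rl Il /b /=.
  have se : s = 1 + eta * (complex.Re l0 ^+ 2 + complex.Im l0 ^+ 2) by rewrite /s cmod_sqr.
  have sn : s != 0 by rewrite lt0r_neq0.
  move: se sn; move: (complex.Re l0) (complex.Im l0) => x y se sn.
  apply: (@mulfI _ s) => //.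
  have -> : s * (s * ((1 + (u * (eta * x / s) - v * - (eta * y / s))) ^+ 2 +
      (0 + (u * - (eta * y / s) + v * (eta * x / s))) ^+ 2) + eta / s * (u ^+ 2 + v ^+ 2))
    = (s + eta * (u * x + v * y)) ^+ 2 + eta ^+ 2 * (v * x - u * y) ^+ 2 + eta * (u ^+ 2 + v ^+ 2).
    by field.
  by rewrite se; ring.
pose H l := G l * q l ^+ 2.
have dn : 0 < Num.min d (1 - cmod l0) by rewrite lt_min d0 subr_gt0.
apply: (@no_strict_max R H l0 _ dn) => [l|l]; rewrite lt_min => /andP[ld ll0].
  apply: cdiffM; first exact: (hG l ld).1.
  apply: cdiffX; apply: cdiffD; first exact: cdiff_cst.
  apply: cdiffM; last exact: cdiff_cst.
  by apply: cdiffB; [exact: cdiff_id|exact: cdiff_cst].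
move=> ne.
have Hl0 : cmod (H l0) = cmod (G l0) by rewrite /H /q subrr mul0r addr0 expr1n mulr1.
have Phil0 : 0 < Phi l0 by exact/Phi_gt0/ltW.
rewrite Hl0 Gl0; case: (eqVneq (G l) 0) => [Gl|Gl].
  by rewrite /H Gl mul0r cmod0.
have l1 : cmod l < 1.
  by have := cmod_triangle (l - l0) l0; rewrite subrK; lra.
have [_ GP] := hG l ld.
have := l0max l (ltW l1); rewrite /chi -key -/s => cl.
have D0 : 0 < eta / s * cmod (l - l0) ^+ 2.
  by apply: mulr_gt0; [exact: divr_gt0|rewrite exprn_gt0 // cmod_gt0 subr_eq0].
rewrite -(ltr_pM2r s0); apply: lt_le_trans cl.
have G0 : 0 < cmod (G l) by rewrite cmod_gt0.
rewrite cmodM cmodX.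
apply: (@lt_le_trans _ _ (cmod (G l) * (s * cmod (q l) ^+ 2 + eta / s * cmod (l - l0) ^+ 2))).
  by rewrite -[ltLHS]mulrA (ltr_pM2l G0) [_ * s]mulrC ltrDl.
apply: ler_wpM2r => //; apply: addr_ge0; last exact: ltW.
by apply: mulr_ge0; [exact: ltW|exact: sqr_ge0].
Qed.

End SubmeanValue.


(** * The submean inequality for [ln Phi], and products over roots of unity *)

Section LogSubmean.
Variable R : realType.
Implicit Types (l : Cplx R) (r e s t : R) (F : R -> R) (Phi Psi : Cplx R -> R).
Local Notation mu := (@lebesgue_measure R).

Lemma log_support_cst (c : R) l : 0 <= c -> log_support (fun=> c) l.
Proof.
move=> c0; exists (fun=> c%:C%C), 1; split=> //; first by rewrite cmod_real ger0_norm.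
by move=> y _; split; [exact: cdiff_cst|rewrite cmod_real ger0_norm].
Qed.

Lemma log_supportM Phi Psi l : log_support Phi l -> log_support Psi l ->
  log_support (fun y => Phi y * Psi y) l.
Proof.
move=> [G [d [d0 Gl hG]]] [H [d' [d'0 Hl hH]]].
exists (fun y => G y * H y), (Num.min d d'); split.
- by rewrite lt_min d0 d'0.
- by rewrite cmodM Gl Hl.
- move=> y; rewrite lt_min => /andP[/hG[g1 g2] /hH[h1 h2]]; split; first exact: cdiffM.
  by rewrite cmodM ler_pM.
Qed.

Lemma log_support_prod (I : Type) (s : seq I) (Phi : I -> Cplx R -> R) l :
  (forall i, log_support (Phi i) l) ->
  log_support (fun y => \prod_(i <- s) Phi i y) l.
Proof.
move=> sPhi; elim: s => [|i s IH].
  have -> : (fun y => \prod_(i <- [::]) Phi i y) = (fun=> 1) by apply/funext => y; rewrite big_nil.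
  exact: log_support_cst.
have -> : (fun y => \prod_(j <- i :: s) Phi j y) = (fun y => Phi i y * \prod_(j <- s) Phi j y).
  by apply/funext => y; rewrite big_cons.
exact: log_supportM.
Qed.

Lemma log_support_rot Phi l (w : Cplx R) : cmod w = 1 ->
  log_support Phi (l * w) -> log_support (fun y => Phi (y * w)) l.
Proof.
move=> w1 [G [d [d0 Gl hG]]]; exists (fun y => G (y * w)), d; split=> //.
move=> y yl; have [|h1 h2] := hG (y * w).
  by rewrite -mulrBl cmodM w1 mulr1.
split=> //; have -> : (fun y => G (y * w)) = (fun y => G (0 + y * w)).
  by apply/funext => z; rewrite add0r.
by apply: cdiff_comp_affine; rewrite add0r.
Qed.

Lemma prod_expR (I : Type) (s : seq I) (f : I -> R) :
  expR (\sum_(i <- s) f i) = \prod_(i <- s) expR (f i).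
Proof. by apply: (big_morph expR); [exact: expRD|exact: expR0]. Qed.

(* The product of the rotates of [Phi] by the [n]-th roots of unity has the same
   value at [0] up to the power [n], satisfies the maximum principle, and is
   nearly constant on the unit circle by the convergence of Riemann sums. *)
Lemma submean_log Phi :
  (forall l, cmod l <= 1 -> 0 < Phi l) ->
  (forall l, cmod l <= 1 -> {for l, continuous Phi}) ->
  (forall l, cmod l < 1 -> log_support Phi l) ->
  2 * pi * ln (Phi 0) <= \int[mu]_(t in `[0%R, 2 * pi]) ln (Phi (cexpi t)).
Proof.
move=> Phi0 cPhi sPhi; pose F t := ln (Phi (cexpi t)); rewrite -/F.
have c1 t : cmod (cexpi t) <= 1 by rewrite cmod_cexpi.
have cF : continuous F.
  move=> t; apply: (@contR_comp R R (@ln R) (fun t => Phi (cexpi t))); last exact/continuous_ln/Phi0.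
  have E : (fun t => Phi (cexpi t)) = (fun t => Phi (0 + 1%:C%C * cexpi t)).
    by apply/funext => u; rewrite mul1r add0r.
  by rewrite E; apply: cont_cexpi_comp; rewrite mul1r add0r; exact: cPhi.
have F2pi t : F (t + 2 * pi) = F t by rewrite /F cexpiD cexpi_2pi mulr1.
apply/ler_addgt0Pr => e e0.
have [n0 hn0] := riemann_sum cF e0.
set n := n0.+1; pose dl : R := 2 * pi / n%:R.
have nR : 0 < n%:R :> R by rewrite ltr0n.
have pp := pi_gt0 R.
have dl0 : 0 < dl by rewrite divr_gt0 // mulr_gt0.
have ndl : n%:R * dl = 2 * pi by rewrite /dl mulrC divfK // lt0r_neq0.
pose S t := \sum_(j < n) F (t + j%:R * dl).
have Sper t : S (t + dl) = S t.
  rewrite /S big_ord_recr [in RHS]big_ord_recl /= mul0r addr0 addrC; congr (_ + _).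
    rewrite -(F2pi t) -ndl; congr F.
    by rewrite -addrA; congr (_ + _); rewrite /n -natr1 mulrDl mul1r addrC.
  apply: eq_bigr => j _; congr F; rewrite -addrA; congr (_ + _).
  by rewrite /bump /= add1n -natr1 mulrDl mul1r addrC.
(* [S] has period [dl], so its values on the whole circle already occur on [[0, dl]]. *)
have Sred k t : 0 <= t <= k.+1%:R * dl -> exists t', 0 <= t' <= dl /\ S t = S t'.
  elim: k t => [|k IH] t /andP[t0 tk]; first by exists t; rewrite t0 -[dl]mul1r.
  case: (leP t dl) => tdl; first by exists t; rewrite t0 tdl.
  have [|t' [t'1 t'2]] := IH (t - dl).
    rewrite subr_ge0 ltW //= lerBlDr; apply: le_trans tk _.
    by rewrite -[k.+2%:R]natr1 mulrDl mul1r.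
  by exists t'; split=> //; rewrite -t'2 -(Sper (t - dl)) subrK.
have cS : continuous S.
  move=> t; apply: (@contR_sum R R _ _ (fun (j : 'I_n) t => F (t + j%:R * dl))) => j _.
  apply: (@contR_comp R R F (fun t => t + j%:R * dl)); last exact: cF.
  apply: (@contRD R R id (fun=> j%:R * dl)); last exact: contR_cst.
  by move=> A.
(* With [s] in [[0, dl]], the points [s + j%:R * dl] fall one into each interval of the subdivision,
   so [dl * S s] is a Riemann sum of the integral. *)
have [|s] := @EVT_max R S 0 dl (ltW dl0); first exact: continuous_subspaceT.
rewrite in_itv /= => s01 smax.
pose Psi l := \prod_(j < n) Phi (l * cexpi (j%:R * dl)).
have cw l j : cmod (l * cexpi (j%:R * dl)) = cmod l by rewrite cmodM cmod_cexpi mulr1.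
have Psi_circle t : Psi (cexpi t) = expR (S t).
  rewrite /S prod_expR; apply: eq_bigr => j _.
  by rewrite /F lnK ?posrE ?cexpiD // Phi0 // cw.
have : Psi 0 <= expR (S s).
  apply: max_principle.
  - by move=> l l1; apply: prodr_gt0 => j _; apply: Phi0; rewrite cw.
  - move=> l l1; apply: (@contR_prod R _ _ _ (fun (j : 'I_n) l => Phi (l * cexpi (j%:R * dl)))) => j _.
    have caff : {for l, continuous (fun y : Cplx R => y * cexpi (j%:R * dl))}.
      exact: (contM (@cont_id R l) (@cont_cst R (cexpi (j%:R * dl)) l)).
    have cP : {for l * cexpi (j%:R * dl), continuous Phi} by apply: cPhi; rewrite cw.
    exact: (@continuous_comp _ _ _ (fun y : Cplx R => y * cexpi (j%:R * dl)) Phi l caff cP).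
  - move=> l l1; apply: (@log_support_prod _ _ (fun (j : 'I_n) l => Phi (l * cexpi (j%:R * dl)))) => j.
    by apply: log_support_rot; [exact: cmod_cexpi|apply: sPhi; rewrite cw].
  - move=> l /polar_form[t [t2 ->]]; rewrite Psi_circle ler_expR.
    have [|t' [t'1 ->]] := Sred n0 t; first by rewrite -/n ndl.
    by apply: smax; rewrite in_itv.
have -> : Psi 0 = expR (n%:R * ln (Phi 0)).
  rewrite /Psi (eq_bigr (fun=> Phi 0)) => [|j _]; last by rewrite mul0r.
  rewrite prodr_const card_ord expRM_natl lnK // posrE; apply: Phi0.
  by rewrite cmod0.
rewrite ler_expR => nS.
have := hn0 n (fun j => s + j%:R * dl) (ltnSn _).
have /andP[s0 sdl] := s01.
have Hj j : (j < n)%N -> 2 * pi * j%:R / n%:R <= s + j%:R * dl <= 2 * pi * j.+1%:R / n%:R.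
  move=> _; have E i : 2 * pi * i%:R / n%:R = i%:R * dl by rewrite /dl; ring.
  by rewrite !E lerDr s0 -natr1 mulrDl mul1r addrC lerD2l.
move=> /(_ Hj) /=; rewrite -/dl -/(S s) ler_norml => /andP[h _].
rewrite -[X in X * ln _]ndl; have : n%:R * dl * ln (Phi 0) <= dl * S s.
  by rewrite [leLHS]mulrAC mulrC ler_pM2l.
move: h; set I := Rintegral _ _ _; lra.
Qed.

Lemma pow2S k : (2 ^ k.+1 = 2 ^ k + 2 ^ k)%N.
Proof. by rewrite expnS mul2n addnn. Qed.

Lemma cexpi_half_turn k (j : nat) :
  cexpi (2 * pi * (2 ^ k + j)%:R / (2 ^ k.+1)%:R) =
  - cexpi (2 * pi * j%:R / (2 ^ k.+1)%:R) :> Cplx R.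
Proof.
rewrite -[RHS]mulN1r -cexpi_pi -cexpiD; congr cexpi.
have p0 : (2 ^ k)%:R != 0 :> R by rewrite pnatr_eq0 expn_eq0.
have -> : (2 ^ k.+1)%:R = 2 * (2 ^ k)%:R :> R by rewrite pow2S natrD; ring.
by rewrite ?natrD; move: (pi : R) ((2 ^ k)%:R : R) p0 => p q p0; field; rewrite p0.
Qed.

Lemma cexpi_sqr_angle k (j : nat) :
  cexpi (2 * pi * j%:R / (2 ^ k.+1)%:R) ^+ 2 = cexpi (2 * pi * j%:R / (2 ^ k)%:R) :> Cplx R.
Proof.
rewrite expr2 -cexpiD; congr cexpi.
have p0 : (2 ^ k)%:R != 0 :> R by rewrite pnatr_eq0 expn_eq0.
have -> : (2 ^ k.+1)%:R = 2 * (2 ^ k)%:R :> R by rewrite pow2S natrD; ring.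
by rewrite ?natrD; move: (pi : R) ((2 ^ k)%:R : R) p0 => p q p0; field; rewrite p0.
Qed.

(** Restricting to powers of two makes the factorization an induction: opposite nodes [u] and [- u]
    pair to [x ^+ 2 - y ^+ 2 * u ^+ 2], and their squares are the nodes of the previous level. *)
Lemma prod_circle k (x y : Cplx R) :
  \prod_(j < 2 ^ k) (x + y * cexpi (2 * pi * j%:R / (2 ^ k)%:R)) =
  x ^+ (2 ^ k) - (- y) ^+ (2 ^ k).
Proof.
elim: k x y => [|k IH] x y.
  by rewrite expn0 big_ord1 /= mulr0 mul0r cexpi0 mulr1 !expr1 opprK.
transitivity (\prod_(j < 2 ^ k + 2 ^ k) (x + y * cexpi (2 * pi * j%:R / (2 ^ k.+1)%:R))).
  by rewrite -(big_mkord xpredT (fun j => x + y * cexpi (2 * pi * j%:R / (2 ^ k.+1)%:R))) pow2S big_mkord.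
rewrite big_split_ord /= -big_split /=.
transitivity (\prod_(j < 2 ^ k) (x ^+ 2 + - y ^+ 2 * cexpi (2 * pi * j%:R / (2 ^ k)%:R))).
  apply: eq_bigr => j _; rewrite cexpi_half_turn -(cexpi_sqr_angle k j); ring.
by rewrite IH opprK -(sqrrN y) -!exprM -!expnS.
Qed.

(** A discrete upper half of the mean value property of the logarithm. The product of the moduli is
    at most [2 * cmod x ^+ (2 ^ k)], so the average exceeds the value at the centre by at most
    [ln 2 / 2 ^ k]. *)
Lemma log_circle_sum k (x : Cplx R) r : 0 <= r < cmod x ->
  \sum_(j < 2 ^ k) ln (cmod (x + r%:C%C * cexpi (2 * pi * j%:R / (2 ^ k)%:R))) <=
  (2 ^ k)%:R * ln (cmod x) + ln 2.
Proof.
move=> /andP[r0 rx].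
have pos t : 0 < cmod (x + r%:C%C * cexpi t).
  have := cmod_triangle (x + r%:C%C * cexpi t) (- (r%:C%C * cexpi t)).
  rewrite addrK cmodN cmodM cmod_cexpi mulr1 cmod_real ger0_norm //; lra.
have x0 : 0 < cmod x by apply: le_lt_trans rx.
rewrite -ler_expR prod_expR expRD expRM_natl !lnK ?posrE //.
rewrite (eq_bigr (fun j : 'I__ => cmod (x + r%:C%C * cexpi (2 * pi * j%:R / (2 ^ k)%:R)))).
  rewrite -cmod_prod prod_circle; apply: le_trans (cmod_triangle _ _) _.
  rewrite cmodN !cmodX cmodN cmod_real ger0_norm // mulr_natr mulr2n lerD2l.
  by rewrite lerXn2r ?nnegrE // ltW.
by move=> j _; rewrite lnK // posrE.
Qed.

(** Opposite nodes are paired by the parallelogram law; this needs at least two nodes, hence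
    [k.+1]. *)
Lemma sqr_circle_sum k (x : Cplx R) r :
  \sum_(j < 2 ^ k.+1) cmod (x + r%:C%C * cexpi (2 * pi * j%:R / (2 ^ k.+1)%:R)) ^+ 2 =
  (2 ^ k.+1)%:R * (cmod x ^+ 2 + r ^+ 2).
Proof.
transitivity (\sum_(j < 2 ^ k + 2 ^ k) cmod (x + r%:C%C * cexpi (2 * pi * j%:R / (2 ^ k.+1)%:R)) ^+ 2).
  by rewrite -(big_mkord xpredT (fun j => cmod (x + r%:C%C * cexpi (2 * pi * j%:R / (2 ^ k.+1)%:R)) ^+ 2)) pow2S big_mkord.
rewrite big_split_ord /= -big_split /=.
rewrite (eq_bigr (fun=> 2 * (cmod x ^+ 2 + r ^+ 2))) => [|j _].
  by rewrite sumr_const card_ord -[LHS]mulr_natl pow2S natrD; ring.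
rewrite cexpi_half_turn; have u1 := cmod_cexpi (2 * pi * j%:R / (2 ^ k.+1)%:R : R).
set u := cexpi _ in u1 *; have : cmod u ^+ 2 = 1 by rewrite u1 expr1n.
rewrite !cmod_sqr; clearbody u; case: u u1 => a b _; case: (x) => c d /= ab.
have -> : r ^+ 2 = r ^+ 2 * (a ^+ 2 + b ^+ 2) by rewrite ab mulr1.
ring.
Qed.

End LogSubmean.


(** * Subharmonic functions and polar compact sets *)

(** Spares measurability proofs for integrands such as a subharmonic function on a circle: each
    integral is by definition a difference of suprema over simple functions, and these are
    monotone. *)
Lemma le_integral_nomeas d (T : measurableType d) (R : realType)
    (mu : {measure set T -> \bar R}) (D : set T) (f g : T -> \bar R) :
  (forall x, D x -> (f x <= g x)%E) ->
  (\int[mu]_(x in D) f x <= \int[mu]_(x in D) g x)%E.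
Proof.
move=> fg; have restr x : ((f \_ D) x <= (g \_ D) x)%E.
  by rewrite /patch; case: ifPn => // /set_mem; exact: fg.
rewrite /integral; apply: leeB; apply: le_ereal_sup => _ [h hu <-]; exists h => //= x.
  by apply: le_trans (hu x) _; apply: (@funepos_le _ _ setT) => //; rewrite inE.
by apply: le_trans (hu x) _; apply: (@funeneg_le _ _ setT) => //; rewrite inE.
Qed.

Section UscMaximum.
Variables (R : realType) (T : topologicalType).

Lemma usc_max (X : set T) (phi : T -> \bar R) : compact X -> X !=set0 ->
  (forall x (M : R), X x -> (phi x < M%:E)%E -> \forall y \near x, (phi y < M%:E)%E) ->
  (forall x, X x -> (phi x < +oo)%E) ->
  exists2 x, X x & forall y, X y -> (phi y <= phi x)%E.
Proof.
move=> cX [x0 Xx0] usc fin; apply: contrapT => nomax.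
have nm x : X x -> exists2 y, X y & (phi x < phi y)%E.
  move=> Xx; apply: contrapT => h; apply: nomax; exists x => // y Xy.
  by rewrite leNgt; apply/negP => xy; apply: h; exists y.
have [||||y Xy] := @compact_ind T X (fun A => exists2 y, X y & forall x, A x -> X x -> (phi x < phi y)%E) cX.
- by exists x0.
- move=> A B [y Xy hy] [z Xz hz]; case: (leP (phi y) (phi z)) => yz.
    exists z => // x [Ax|Bx] Xx; last exact: hz.
    exact: lt_le_trans (hy x Ax Xx) yz.
  exists y => // x [Ax|Bx] Xx; first exact: hy.
  exact: lt_trans (hz x Bx Xx) yz.
- by move=> A B AB [y Xy hy]; exists y => // x /AB; exact: hy.
- move=> x Xx; have [y Xy xy] := nm x Xx.
  have [M xM My] : exists2 M : R, (phi x < M%:E)%E & (M%:E <= phi y)%E.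
    move: (fin y Xy) xy; case: (phi y) => [r|//|] _ xr; last by rewrite ltNge leNye in xr.
    by exists r.
  exists [set z | (phi z < M%:E)%E]; split; first exact: usc.
  by exists y => // z [Xz zM] _; exact: lt_le_trans zM My.
by move=> /(_ y Xy Xy); rewrite ltxx.
Qed.

End UscMaximum.

(** * Comparison of subharmonic functions with logarithmic potentials *)

Section Comparison.
Variable R : realType.
Implicit Types (z a : Cplx R) (r e : R) (s : seq (Cplx R)) (v : Cplx R -> \bar R).
Local Notation mu := (@lebesgue_measure R).

Definition log_sum s z : R := \sum_(zeta <- s) ln (cmod (z - zeta)).

Lemma cont_log_sum s z : (forall zeta, zeta \in s -> z != zeta) ->
  {for z, continuous (log_sum s)}.
Proof.
move=> zs; apply: contR_sum => zeta /zs zz.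
apply: (@contR_comp R _ (@ln R) (fun y : Cplx R => cmod (y - zeta))).
  exact: cont_cmodB.
by apply: continuous_ln; rewrite cmod_gt0 subr_eq0.
Qed.

Lemma discE z r : [set y : Cplx R | `|y - z| <= (r%:C)%C] = [set y | cmod (y - z) <= r].
Proof. by apply/seteqP; split => y /=; rewrite normE lecR. Qed.

Lemma integral_real (F : R -> R) : continuous F ->
  (\int[mu]_(t in `[0%R, (2 * pi)%R]) (F t)%:E)%E =
  (\int[mu]_(t in `[0%R, (2 * pi)%R]) F t)%:E.
Proof.
move=> cF; rewrite /Rintegral fineK //; apply: integrable_fin_num => //.
exact: (@integrable_itv R F _ 0 (2 * pi)).
Qed.

(** On the circle of radius [rho] the majorant has mean at most [a - eta * rho ^+ 2]: the logarithms
    are harmonic on the disc, whose closure avoids the points of [s], and the quadratic term loses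
    exactly [eta * rho ^+ 2]. This contradicts the submean inequality at [zm]. *)
Lemma no_interior_max (U : set (Cplx R)) v (zm z0 : Cplx R) (rho lam eta a : R) s :
  subharmonic_on U v -> 0 < rho ->
  (forall z, cmod (z - zm) <= rho -> U z) ->
  (forall zeta, zeta \in s -> rho < cmod (zm - zeta)) ->
  0 <= lam -> 0 < eta -> v zm = a%:E ->
  (forall z, cmod (z - zm) <= rho ->
     (v z <= (a - lam * log_sum s zm + eta * cmod (zm - z0) ^+ 2
                + lam * log_sum s z - eta * cmod (z - z0) ^+ 2)%:E)%E) -> False.
Proof.
move=> [_ subm] rho0 hU hs lam0 eta0 va vle.
have := subm zm rho rho0; rewrite discE => /(_ hU); rewrite va => mean.
pose c := a - lam * log_sum s zm + eta * cmod (zm - z0) ^+ 2.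
pose h z := c + (lam * log_sum s z + (- eta) * cmod (z - z0) ^+ 2).
pose F t := h (zm + rho%:C%C * cexpi t).
have on_circle t : cmod (zm + rho%:C%C * cexpi t - zm) = rho.
  by rewrite addrAC subrr add0r cmodM cmod_cexpi mulr1 cmod_real gtr0_norm.
have cF : continuous F.
  move=> t; apply: cont_cexpi_comp; set z := zm + _.
  apply: contRD; first exact: contR_cst.
  apply: contRD; apply: contRM; try exact: contR_cst.
    apply: cont_log_sum => zeta /hs hz; apply/eqP => zz.
    by have := on_circle t; rewrite -/z zz cmodB => E; rewrite E ltxx in hz.
  have c0 := @cont_cmodB R z0 z.
  exact: (contRM c0 c0).
have p2 : 0 < 2 * pi :> R by rewrite mulr_gt0 // pi_gt0.
have {mean} mean : 2 * pi * a <= \int[mu]_(t in `[0%R, 2 * pi]) F t.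
  rewrite mulrC -ler_pdivlMr // mulrC -lee_fin EFinM -integral_real //.
  apply: le_trans mean _; apply: lee_wpmul2l; first by rewrite lee_fin invr_ge0 ltW.
  apply: le_integral_nomeas => t _; apply: le_trans (vle _ _) _; first by rewrite on_circle.
  by rewrite lee_fin /F /h /c; lra.
suff : \int[mu]_(t in `[0%R, 2 * pi]) F t <= 2 * pi * (a - eta * rho ^+ 2).
  move=> /(le_trans mean); rewrite ler_pM2l // => hh.
  have : 0 < eta * rho ^+ 2 by rewrite mulr_gt0 // exprn_gt0.
  lra.
apply/ler_addgt0Pr => e e0; have e2 : 0 < e / 2 by rewrite divr_gt0.
have [n0 hn0] := riemann_sum cF e2.
have [k1 hk1] := @small_pow2 R (2 * pi * lam * (size s)%:R * ln 2) (e / 2) e2.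
(* [n0] controls the Riemann sum, [k1] the errors [ln 2] of [log_circle_sum], and the successor
   serves [sqr_circle_sum]. *)
pose k := (maxn n0 k1).+1; pose n := (2 ^ k)%N.
have nR : 0 < n%:R :> R by rewrite ltr0n expn_gt0.
have n0n : (n0 < n)%N.
  by apply: leq_ltn_trans (ltn_expl k (ltnSn 1)); rewrite (leq_trans (leq_maxl n0 k1)).
pose t j : R := 2 * pi * j%:R / n%:R.
have Ht j : (j < n)%N -> 2 * pi * j%:R / n%:R <= t j <= 2 * pi * j.+1%:R / n%:R.
  move=> _; rewrite /t lexx /= ler_pM2r ?invr_gt0 // ler_pM2l // ler_nat //.
have := hn0 n t n0n Ht; rewrite ler_norml => /andP[_ hr].
have sumF : \sum_(j < n) F (t j) <= n%:R * (a - eta * rho ^+ 2) + lam * (size s)%:R * ln 2.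
  have -> : \sum_(j < n) F (t j) = n%:R * c
      + lam * \sum_(zeta <- s) \sum_(j < n) ln (cmod ((zm - zeta) + rho%:C%C * cexpi (t j)))
      - eta * \sum_(j < n) cmod ((zm - z0) + rho%:C%C * cexpi (t j)) ^+ 2.
    rewrite /F /h big_split /= sumr_const card_ord -[c *+ n]mulr_natl -addrA; congr (_ + _).
    rewrite big_split /= -!mulr_sumr mulNr exchange_big /=; congr (_ * _ - _ * _).
      by apply: eq_bigr => j _; apply: eq_bigr => zeta _; rewrite addrAC.
    by apply: eq_bigr => j _; rewrite addrAC.
  rewrite [X in _ - eta * X]sqr_circle_sum -/n.
  have logs : \sum_(zeta <- s) \sum_(j < n) ln (cmod ((zm - zeta) + rho%:C%C * cexpi (t j))) <=
     n%:R * log_sum s zm + (size s)%:R * ln 2.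
    have -> : (size s)%:R * ln 2 = \sum_(zeta <- s) ln 2 :> R.
      by rewrite big_const_seq count_predT iter_addr_0 mulr_natl.
    rewrite /log_sum mulr_sumr -big_split big_seq [leRHS]big_seq /=.
    apply: ler_sum => zeta /hs hz; apply: log_circle_sum.
    by rewrite ltW.
  have := ler_wpM2l lam0 logs; rewrite /c; lra.
have n1 : (2 ^ k1)%:R <= n%:R :> R.
  by rewrite ler_nat leq_exp2l // (leq_trans (leq_maxr n0 k1)).
have q0 : 0 <= 2 * pi * lam * (size s)%:R * ln 2.
  by rewrite !mulr_ge0 ?ln_ge0 ?ler1n // pi_ge0.
have small : 2 * pi / n%:R * (lam * (size s)%:R * ln 2) <= e / 2.
  apply: le_trans (ltW hk1); rewrite -natrX.
  rewrite (_ : 2 * pi / _ * _ = 2 * pi * lam * (size s)%:R * ln 2 / n%:R); last by ring.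
  by rewrite ler_wpM2l // lef_pV2 // posrE ltr0n expn_gt0.
have dn0 : 0 <= 2 * pi / n%:R :> R by apply: divr_ge0; exact: ltW.
have := ler_wpM2l dn0 sumF; rewrite [leRHS]mulrDr mulrA divfK ?lt0r_neq0 // => hs2.
move: hr; set I := Rintegral _ _ _; set S := _ * \sum_(j < n) _ in hs2 *; lra.
Qed.

End Comparison.


Section FiniteExtrema.
Variable R : realType.

Lemma seq_max (T : eqType) (s : seq T) (f : T -> R) : s != [::] ->
  exists2 x, x \in s & forall y, y \in s -> f y <= f x.
Proof.
elim: s => // a s IH _; case: (eqVneq s [::]) => [->|s0].
  by exists a; rewrite ?mem_head // => y; rewrite inE => /eqP ->.
have [x xs hx] := IH s0; case: (leP (f a) (f x)) => ax.
  by exists x; [rewrite in_cons xs orbT|move=> y; rewrite in_cons => /orP[/eqP -> //|/hx]].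
exists a; first exact: mem_head.
move=> y; rewrite in_cons => /orP[/eqP -> //|/hx] h; exact: le_trans h (ltW ax).
Qed.

Lemma fin_max (T : finType) (x0 : T) (f : T -> R) : exists x, forall y, f y <= f x.
Proof.
have [|x _ hx] := @seq_max _ (enum T) f.
  by apply/eqP => e; have := mem_enum T x0; rewrite e.
by exists x => y; apply: hx; rewrite mem_enum.
Qed.

Lemma seq_lower (T : eqType) (s : seq T) (f : T -> R) :
  (forall x, x \in s -> 0 < f x) -> exists2 r, 0 < r & forall x, x \in s -> r <= f x.
Proof.
move=> f0; case: (eqVneq s [::]) => [->|s0]; first by exists 1.
have [x xs hx] := @seq_max _ s (fun x => - f x) s0.
by exists (f x); [exact: f0|move=> y /hx; rewrite lerN2].
Qed.

End FiniteExtrema.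

Section Comparison2.
Variable R : realType.
Implicit Types (z w a : Cplx R) (r e : R) (s : seq (Cplx R)) (v : Cplx R -> \bar R).

(** A two-constants estimate. The potential on the right is at least [b] on the outer circle,
    because of [R1], and at least [b - T] outside the discs of radius [delta], because of [c]; its
    coefficient is fixed by the second requirement. A point violating the estimate would lead to a
    maximum excluded by [no_interior_max]. *)
Lemma comparison (U : set (Cplx R)) v (z0 : Cplx R) s (r delta R1 c b T : R) :
  subharmonic_on U v -> 0 < r -> s != [::] -> 0 < delta -> 0 < c < R1 -> 0 < T ->
  (forall z, cmod (z - z0) <= r -> U z) ->
  (forall z, cmod (z - z0) <= r -> (v z <= b%:E)%E) ->
  (forall z zeta, zeta \in s -> cmod (z - z0) <= r -> cmod (z - zeta) <= delta ->
     (v z <= (b - T)%:E)%E) ->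
  (forall z zeta, zeta \in s -> cmod (z - z0) = r -> R1 <= cmod (z - zeta)) ->
  (forall z, (forall zeta, zeta \in s -> delta <= cmod (z - zeta)) ->
     (size s)%:R * ln c <= log_sum s z) ->
  forall w, cmod (w - z0) <= r -> (forall zeta, zeta \in s -> delta <= cmod (w - zeta)) ->
  (v w <= (b + T / ((size s)%:R * (ln R1 - ln c)) * (log_sum s w - (size s)%:R * ln R1))%:E)%E.
Proof.
move=> subv r0 s0 delta0 /andP[c0 cR1] T0 hU H1 H2 H3 H4 w wr ws.
have [uscv _] := subv.
have N0 : 0 < (size s)%:R :> R by rewrite ltr0n lt0n size_eq0.
have R10 : 0 < R1 by exact: lt_trans cR1.
have lncR : 0 < ln R1 - ln c by rewrite subr_gt0 ltr_ln.
set N := (size s)%:R in N0 H4 *.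
set lam := T / (N * (ln R1 - ln c)).
have lam0 : 0 < lam by rewrite divr_gt0 // mulr_gt0.
have lamT : lam * (N * ln c - N * ln R1) = - T.
  have E (x y q : R) : x - y != 0 -> q != 0 -> T / (q * (x - y)) * (q * y - q * x) = - T.
    by move=> xy q0; field; rewrite xy q0.
  by apply: E; exact: lt0r_neq0.
pose g z := b + lam * (log_sum s z - N * ln R1); rewrite -/(g w).
rewrite leNgt; apply/negP => gv.
have [A vA gA] : exists2 A : R, v w = A%:E & g w < A.
  move: gv (H1 w wr); case: (v w) => [A|//|]; last by rewrite ltNge leNye.
  by rewrite lte_fin => ? _; exists A.
(* Half of the excess of [v w] over [g w], spread over [r ^+ 2]: the quadratic perturbation still
   leaves the excess [eta * r ^+ 2] at the maximum. *)
pose eta := (A - g w) / (2 * r ^+ 2).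
have eta0 : 0 < eta by rewrite divr_gt0 ?subr_gt0 // mulr_gt0 // exprn_gt0.
have AE : A = g w + 2 * eta * r ^+ 2 by rewrite /eta; field; rewrite lt0r_neq0.
pose X := [set z | cmod (z - z0) <= r /\ forall zeta, zeta \in s -> delta <= cmod (z - zeta)].
have Xneq z : X z -> forall zeta, zeta \in s -> z != zeta.
  move=> [_ zs] zeta /zs; apply: contraTneq => ->.
  by rewrite subrr cmod0 -ltNge.
have cX : compact X.
  apply: subclosed_compact (@compact_disc R z0 r) _; last by move=> z [].
  apply: closed_cmodP => l hl; split.
    rewrite leNgt; apply/negP => lr.
    have [|y [[yr _] yl]] := hl (cmod (l - z0) - r); first by rewrite subr_gt0.
    by have := cmod_sub_triangle y l z0; rewrite cmodB in yl; lra.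
  move=> zeta zs; rewrite leNgt; apply/negP => ld.
  have [|y [[_ ys] yl]] := hl (delta - cmod (l - zeta)); first by rewrite subr_gt0.
  by have := ys _ zs; have := cmod_sub_triangle l y zeta; lra.
pose h z := eta * cmod (z - z0) ^+ 2 - lam * log_sum s z.
have ch z : X z -> {for z, continuous h}.
  move=> Xz; have -> : h = (fun z => eta * cmod (z - z0) ^+ 2 + (- lam) * log_sum s z).
    by apply/funext => y; rewrite mulNr.
  have c2 := @cont_cmodB R z0 z.
  apply: contRD; apply: contRM; try exact: contR_cst; last exact: cont_log_sum (Xneq z Xz).
  exact: (contRM c2 c2).
have vlt z : X z -> (v z < +oo)%E by move=> [zr _]; apply: le_lt_trans (H1 z zr) _; rewrite ltry.
have [|||zm Xm maxm] := @usc_max R _ X (fun z => v z + (h z)%:E)%E cX.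
- by exists w.
- move=> z M Xz vM; have [_ usz] := uscv z (hU z Xz.1).
  have [M' vM' hM] : exists2 M' : R, (v z < M'%:E)%E & h z < M - M'.
    move: vM (vlt z Xz); case: (v z) => [q|//|] vM _.
      move: vM; rewrite -EFinD lte_fin => vM.
      by exists ((q + M - h z) / 2); rewrite ?lte_fin; lra.
    by exists (M - h z - 1); rewrite ?ltNyr //; lra.
  have /nbhs_cmodP[d1 [d10 hd1]] := usz _ vM'.
  have hM0 : 0 < M - M' - h z by lra.
  have [d2 [d20 hd2]] := (contRP _ _).1 (ch z Xz) _ hM0.
  apply/nbhs_cmodP; exists (Num.min d1 d2); split; first by rewrite lt_min d10 d20.
  move=> y; rewrite lt_min => /andP[/hd1 y1 /hd2]; rewrite ltr_norml => /andP[_ y2].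
  move: y1; case: (v y) => [q|//|_]; last by rewrite addNye ltNyr.
  by rewrite -EFinD !lte_fin; lra.
- by move=> z Xz; rewrite lte_add_pinfty // ?vlt // ltry.
have Xw : X w by [].
have [a va] : exists a : R, v zm = a%:E.
  have := maxm w Xw; rewrite vA; have := vlt zm Xm.
  case: (v zm) => [a _ _|//|_]; first by exists a.
  by rewrite addNye -EFinD leeNy_eq.
have am : A + h w <= a + h zm by have := maxm w Xw; rewrite vA va -!EFinD lee_fin.
have agm : g zm + eta * r ^+ 2 <= a.
  have hw0 : 0 <= eta * cmod (w - z0) ^+ 2 by rewrite mulr_ge0 ?sqr_ge0 // ltW.
  have hz0 : eta * cmod (zm - z0) ^+ 2 <= eta * r ^+ 2.
    by rewrite ler_pM2l // lerXn2r ?nnegrE ?Xm.1 // ltW.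
  move: am; rewrite /h AE /g; lra.
have er0 : 0 < eta * r ^+ 2 by rewrite mulr_gt0 // exprn_gt0.
have mr : cmod (zm - z0) < r.
  rewrite lt_neqAle Xm.1 andbT; apply/eqP => E.
  have ab : a <= b by have := H1 zm Xm.1; rewrite va lee_fin.
  have : N * ln R1 <= log_sum s zm.
    rewrite /log_sum (_ : N * ln R1 = \sum_(zeta <- s) ln R1); last first.
      by rewrite big_const_seq count_predT iter_addr_0 mulr_natl.
    rewrite big_seq [leRHS]big_seq; apply: ler_sum => zeta zs.
    by have := H3 zm zeta zs E => h3; rewrite ler_ln ?posrE // (lt_le_trans R10).
  rewrite -subr_ge0 => /(mulr_ge0 (ltW lam0)) hh.
  by move: agm; rewrite /g; lra.
have ms zeta : zeta \in s -> 0 < cmod (zm - zeta) - delta.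
  move=> zs; rewrite subr_gt0 ltNge; apply/negP => zd.
  have ab : a <= b - T by have := H2 zm zeta zs Xm.1 zd; rewrite va lee_fin.
  have : lam * (N * ln c) <= lam * log_sum s zm by rewrite ler_pM2l // H4 // => y /Xm.2.
  by move: agm lamT; rewrite /g; lra.
have [rho1 rho10 hrho1] := seq_lower ms.
pose rho := Num.min rho1 (r - cmod (zm - z0)).
have rho0 : 0 < rho by rewrite lt_min rho10 subr_gt0.
have Xrho z : cmod (z - zm) <= rho -> X z.
  rewrite le_min => /andP[z1 z2]; split.
    by have := cmod_sub_triangle zm z z0; lra.
  by move=> zeta zs; have := hrho1 _ zs; have := cmod_sub_triangle z zm zeta; rewrite (cmodB zm z); lra.
apply: (@no_interior_max R U v zm z0 rho lam eta a s) => //.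
- by move=> z /Xrho[zr _]; exact: hU.
- move=> zeta zs; have := hrho1 _ zs; have : rho <= rho1 by rewrite ge_min lexx.
  by lra.
- exact: ltW.
- move=> z /Xrho Xz; have := maxm z Xz; rewrite va /h; have := vlt z Xz.
  case: (v z) => [q _|//|_ _]; last by rewrite leNye.
  by rewrite -!EFinD !lee_fin; lra.
Qed.

End Comparison2.


(** * Fekete points of finite nets *)

Section Fekete.
Variable R : realType.
Implicit Types (z w a : Cplx R) (r e : R) (s : seq (Cplx R)) (E : set (Cplx R)).

Definition dist_prod s z : R := \prod_(zeta <- s) cmod (z - zeta).

Lemma finite_net E (d : R) : compact E -> 0 < d ->
  exists t : seq (Cplx R), (forall y, y \in t -> E y) /\
    forall z, E z -> exists2 y, y \in t & cmod (z - y) <= d.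
Proof.
move=> cE d0.
have [||||t [tE ht]] := @compact_ind _ E (fun A => exists t : seq (Cplx R),
    (forall y, y \in t -> E y) /\ forall z, A z -> exists2 y, y \in t & cmod (z - y) <= d) cE.
- by exists [::].
- move=> A B [t [tE ht]] [u [uE hu]]; exists (t ++ u); split.
    by move=> y; rewrite mem_cat => /orP[/tE|/uE].
  move=> z [/ht[y yt yz]|/hu[y yu yz]]; exists y => //; rewrite mem_cat.
    by rewrite yt.
  by rewrite yu orbT.
- by move=> A B AB [t [tE ht]]; exists t; split=> // z /AB /ht.
- move=> x Ex; exists [set z | cmod (z - x) < d]; split; first exact: nbhs_cmod_ball.
  exists [:: x]; split; first by move=> y; rewrite inE => /eqP ->.
  by move=> z [_ /ltW zx]; exists x; rewrite ?mem_head.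
by exists t.
Qed.

(* Fekete points of a [d]-net of [E], for the kernel [max |x - y| d]. *)
Lemma fekete E (e0 : R) : 0 < e0 -> compact E -> E !=set0 ->
  (forall s, s != [::] -> (forall y, y \in s -> E y) ->
     exists2 z, E z & e0 ^+ size s < dist_prod s z) ->
  forall d, 0 < d -> exists s, [/\ s != [::], forall y, y \in s -> E y &
    forall z, (forall y, y \in s -> d <= cmod (z - y)) ->
      (e0 / 8) ^+ size s <= dist_prod s z].
Proof.
move=> e00 cE [x0 Ex0] hE d d0.
have [t [tE ht]] := finite_net cE d0.
(* In the final product the factor with equal indices is only [d]; for this many points [d] exceeds
   the share [e0 / 4 / 2 ^+ N] required of it. *)
have [n hn] := @small_pow2 R (e0 / 4) d d0.
pose N := n.+1; pose k (x y : Cplx R) := Num.max (cmod (x - y)) d.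
have kd x y : d <= k x y by rewrite le_max lexx orbT.
have kc x y : cmod (x - y) <= k x y by rewrite le_max lexx.
have k0 x y : 0 < k x y by apply: lt_le_trans (kd x y).
have ksym x y : k x y = k y x by rewrite /k cmodB.
have t0 : t != [::].
  by apply/eqP => te; have [y] := ht x0 Ex0; rewrite te.
have m0 : (0 < size t)%N by rewrite lt0n size_eq0.
pose pt (i : 'I_(size t)) := nth 0 t i.
have ptE i : E (pt i) by apply: tE; rewrite mem_nth.
have ptP y : y \in t -> exists i, pt i = y.
  by move=> yt; exists (Ordinal (ltac:(by rewrite index_mem) : (index y t < size t)%N)); rewrite /pt /= nth_index.
pose P (tau : {ffun 'I_N.+1 -> 'I_(size t)}) : R :=
  \prod_i \prod_(l | l != i) k (pt (tau i)) (pt (tau l)).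
have [tau htau] := @fin_max R _ [ffun=> Ordinal m0] P.
pose A (tau : {ffun 'I_N.+1 -> 'I_(size t)}) j (y : Cplx R) : R := \prod_(l | l != j) k y (pt (tau l)).
(* [P] runs over ordered pairs, so each kernel value involving [j] occurs twice, and [A] enters as a
   square. *)
have PE tau' j : P tau' = A tau' j (pt (tau' j)) * (A tau' j (pt (tau' j)) *
    \prod_(i | i != j) \prod_(l | (l != i) && (l != j)) k (pt (tau' i)) (pt (tau' l))).
  rewrite /P (bigD1 j) //=; congr (_ * _); rewrite /A -big_split /=.
  apply: eq_bigr => i ij; rewrite (bigD1 j) 1?eq_sym //= ksym; congr (_ * _).
have exch j q : A tau j (pt q) <= A tau j (pt (tau j)).
  pose tau' := [ffun i => if i == j then q else tau i].
  have := htau tau'; rewrite (PE tau j) (PE tau' j).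
  have -> : tau' j = q by rewrite ffunE eqxx.
  have -> : A tau' j (pt q) = A tau j (pt q).
    by apply: eq_bigr => l lj; rewrite ffunE (negbTE lj).
  have -> : \prod_(i | i != j) \prod_(l | (l != i) && (l != j)) k (pt (tau' i)) (pt (tau' l)) =
      \prod_(i | i != j) \prod_(l | (l != i) && (l != j)) k (pt (tau i)) (pt (tau l)).
    apply: eq_bigr => i ij; apply: eq_bigr => l /andP[_ lj].
    by rewrite !ffunE (negbTE ij) (negbTE lj).
  have B0 : 0 < \prod_(i | i != j) \prod_(l | (l != i) && (l != j)) k (pt (tau i)) (pt (tau l)).
    by apply: prodr_gt0 => i _; apply: prodr_gt0.
  have A0 y : 0 < A tau j y by exact: prodr_gt0.
  by rewrite !mulrA ler_pM2r // -!expr2 ler_pXn2r ?nnegrE ?(ltW (A0 _)) //.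
(* Apply [hE] to the other [N] points and move the resulting [z] to a net point [q]: each distance
   from [z] is at most [d + k (pt q) x <= 2 * k (pt q) x], which costs the factor [2 ^+ N]. By
   maximality the [j]-th point does at least as well as [q]. *)
have lower j : (e0 / 2) ^+ N <= A tau j (pt (tau j)).
  pose s := [seq pt (tau l) | l <- enum 'I_N.+1 & l != j].
  have sN : size s = N.
    rewrite size_map size_filter -sum1_count big_enum_cond /= sum1_card cardC1 card_ord //.
  have [||z Ez hz] := hE s.
  - by rewrite -size_eq0 sN.
  - by move=> y /mapP[l _ ->].
  have [y /ptP[q <-] yz] := ht z Ez.
  apply: le_trans (exch j q).
  move: hz; rewrite sN /dist_prod big_map big_filter big_enum_cond /= => hz.
  have : \prod_(l < N.+1 | l != j) cmod (z - pt (tau l)) <= 2 ^+ N * A tau j (pt q).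
    have -> : 2 ^+ N = \prod_(l < N.+1 | l != j) (2 : R).
      by rewrite prodr_const cardC1 card_ord.
    rewrite -big_split /=; apply: ler_prod => l lj; apply/andP; split => //.
    have := cmod_sub_triangle (pt q) z (pt (tau l)); have := kd (pt q) (pt (tau l)).
    have := kc (pt q) (pt (tau l)); lra.
  move=> /(lt_le_trans hz) /ltW; rewrite expr_div_n ler_pdivrMr ?exprn_gt0 // mulrC //.
pose s := [seq pt (tau l) | l <- enum 'I_N.+1].
have sN : size s = N.+1 by rewrite size_map size_enum_ord.
exists s; split.
- by rewrite -size_eq0 sN.
- by move=> y /mapP[l _ ->].
move=> z zs.
have {}zs l : d <= cmod (z - pt (tau l)).
  by apply: zs; apply: map_f; rewrite mem_enum.
(* The Fekete point nearest to [z]; its distances to the others are at most twice those of [z]. *)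
have [j hj] := @fin_max R 'I_N.+1 ord0 (fun l => - cmod (z - pt (tau l))).
have {}hj l : cmod (z - pt (tau j)) <= cmod (z - pt (tau l)) by rewrite -lerN2.
rewrite sN /dist_prod big_map big_enum /=.
apply: (@le_trans _ _ (\prod_(l < N.+1) (k (pt (tau j)) (pt (tau l)) / 2))).
  rewrite big_split /= prodr_const card_ord (bigD1 j) //= -/(A tau j (pt (tau j))).
  have -> : k (pt (tau j)) (pt (tau j)) = d by rewrite /k subrr cmod0 max_r // ltW.
  have -> : (e0 / 8) ^+ N.+1 = (e0 / 4 / 2 ^+ N) * (e0 / 2) ^+ N * 2^-1 ^+ N.+1.
    have e8 : (8^-1 : R) ^+ N = 2^-1 ^+ N * 2^-1 ^+ N * 2^-1 ^+ N.
      by rewrite -!exprMn; congr (_ ^+ _); field.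
    rewrite -[(2 ^+ N)^-1]exprVn 2!exprS !exprMn e8.
    by move: (2^-1 ^+ N) (e0 ^+ N) => u v; field.
  rewrite ler_wpM2r ?exprn_ge0 ?invr_ge0 //; apply: ler_pM => //.
  - by rewrite !divr_ge0 ?exprn_ge0 // ltW.
  - by rewrite exprn_ge0 // divr_ge0 // ltW.
  - apply: le_trans (ltW hn); rewrite ler_wpM2l ?divr_ge0 ?(ltW e00) // lef_pV2 ?posrE ?exprn_gt0 //.
    by rewrite ler_weXn2l // ler1n.
apply: ler_prod => l _; apply/andP; split; first by rewrite divr_ge0 // ltW.
rewrite ler_pdivrMr // ge_max; apply/andP; split; last by have := zs l; lra.
have := cmod_sub_triangle z (pt (tau j)) (pt (tau l)); rewrite (cmodB (pt (tau j)) z).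
by have := hj l; lra.
Qed.

End Fekete.


(* [A] has logarithmic capacity zero, witnessed by monic polynomials with roots in [K]. *)
Definition thin (R : realType) (K A : set (Cplx R)) := forall e : R, 0 < e ->
  exists s : seq (Cplx R), [/\ s != [::], forall y, y \in s -> K y &
    forall z, A z -> dist_prod s z <= e ^+ size s].

(** * Compact polar sets are thin *)

Section PolarThin.
Variable R : realType.
Implicit Types (z w x a : Cplx R) (r e : R) (s : seq (Cplx R)) (K A E : set (Cplx R)) (v : Cplx R -> \bar R).

Lemma compact_away K x : compact K -> ~ K x ->
  exists2 r : R, 0 < r & forall y, K y -> r <= cmod (y - x).
Proof.
move=> cK nKx.
have [||||r r0 hr] := @compact_ind _ K (fun A => exists2 r : R, 0 < r & forall y, A y -> r <= cmod (y - x)) cK.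
- by exists 1.
- move=> A B [r r0 hr] [r' r'0 hr']; exists (Num.min r r'); first by rewrite lt_min r0 r'0.
  by move=> y [/hr|/hr'] h; rewrite ge_min h // orbT.
- by move=> A B AB [r r0 hr]; exists r => // y /AB; exact: hr.
- move=> y Ky; have yx : 0 < cmod (y - x) by rewrite cmod_gt0 subr_eq0; apply/eqP => E; apply: nKx; rewrite -E.
  have d0 : 0 < cmod (y - x) / 2 by rewrite divr_gt0.
  exists [set z | cmod (z - y) < cmod (y - x) / 2]; split; first exact: nbhs_cmod_ball.
  exists (cmod (y - x) / 2) => // z [_ /= zy].
  by have := cmod_sub_triangle z y x; rewrite (cmodB y z); lra.
by exists r.
Qed.

Lemma compact_cmod_closed K : compact K -> closed K.
Proof.
move=> cK; apply: closed_cmodP => l hl; apply: contrapT => nKl.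
have [r r0 hr] := compact_away cK nKl.
by have [y [/hr ry]] := hl _ r0; rewrite ltNge ry.
Qed.

Lemma expR_log_sum s z : (forall y, y \in s -> z != y) -> expR (log_sum s z) = dist_prod s z.
Proof.
move=> zs; rewrite /log_sum prod_expR /dist_prod big_seq [RHS]big_seq.
by apply: eq_bigr => y /zs ys; rewrite lnK // posrE cmod_gt0 subr_eq0.
Qed.

Lemma eq_ninfty (x : \bar R) (b kappa : R) : 0 < kappa ->
  (forall T, 0 < T -> (x <= (b - T * kappa)%:E)%E) -> x = -oo%E.
Proof.
move=> k0 h; case: x h => [A h|h|//].
  pose T := (`|b - A| + 1) / kappa.
  have T0 : 0 < T by rewrite divr_gt0 // ltr_wpDl.
  have := h T T0; rewrite lee_fin /T divfK ?lt0r_neq0 //.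
  by move=> hA; exfalso; have := ler_norm (b - A); lra.
by have := h 1 ltr01; rewrite leNgt ltry.
Qed.

Lemma usc_bounded (U : set (Cplx R)) v x r : usc_on U v -> 0 <= r ->
  (forall z, cmod (z - x) <= r -> U z) ->
  exists b : R, forall z, cmod (z - x) <= r -> (v z <= b%:E)%E.
Proof.
move=> uscv r0 hU.
have [|||y yr ymax] := @usc_max R _ [set z | cmod (z - x) <= r] v (@compact_disc R x r).
- by exists x; rewrite /= subrr cmod0.
- by move=> z M /hU /uscv[_]; exact.
- by move=> z /hU /uscv[].
have [+ _] := uscv y (hU _ yr); case: (v y) ymax => [b hb _|_|hb _]; [by exists b|by rewrite ltxx|].
by exists 0 => z /hb; rewrite leeNy_eq => /eqP ->; rewrite leNye.
Qed.

(** A three-circles argument: [comparison] with the single root [x] applies for every [T], since [v]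
    is [-oo] on the inner disc. *)
Lemma ninfty_spread (U : set (Cplx R)) v x (rho r : R) : subharmonic_on U v ->
  0 < rho -> (forall z, cmod (z - x) < r -> U z) ->
  (forall z, cmod (z - x) <= rho -> v z = -oo%E) ->
  forall w, cmod (w - x) < r -> v w = -oo%E.
Proof.
move=> subv rho0 hU hrho w wr.
case: (leP (cmod (w - x)) rho) => [/hrho //|rw].
pose r1 := (cmod (w - x) + r) / 2.
have wr1 : cmod (w - x) < r1 by rewrite /r1; lra.
have r1r : r1 < r by rewrite /r1; lra.
have r10 : 0 < r1 by apply: le_lt_trans wr1.
have hU1 z : cmod (z - x) <= r1 -> U z by move=> zr; apply: hU; exact: le_lt_trans r1r.
have [b hb] := usc_bounded subv.1 (ltW r10) hU1.
have lw : ln (cmod (w - x)) < ln r1 by rewrite ltr_ln ?posrE // (lt_trans rho0).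
have lr : ln rho < ln r1 by rewrite ltr_ln ?posrE // (lt_trans rw).
apply: (@eq_ninfty _ b ((ln r1 - ln (cmod (w - x))) / (ln r1 - ln rho))).
  by rewrite divr_gt0 // subr_gt0.
move=> T T0.
have := @comparison R U v x [:: x] r1 rho r1 rho b T subv r10 isT rho0.
rewrite rho0 (lt_trans rw wr1) => /(_ isT T0 hU1 hb).
have -> : log_sum [:: x] = fun z => ln (cmod (z - x)).
  by apply/funext => z; rewrite /log_sum big_seq1.
move=> H; have := H _ _ _ w (ltW wr1).
have -> : b + T / ((size [:: x])%:R * (ln r1 - ln rho)) * (ln (cmod (w - x)) - (size [:: x])%:R * ln r1)
    = b - T * ((ln r1 - ln (cmod (w - x))) / (ln r1 - ln rho)).
  by rewrite /= !mul1r; ring.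
apply.
- by move=> z zeta; rewrite inE => /eqP -> _ /hrho ->; rewrite leNye.
- by move=> z zeta; rewrite inE => /eqP -> ->.
- move=> z /(_ x); rewrite mem_head => /(_ isT) h.
  by rewrite /= mul1r ler_ln ?posrE // (lt_le_trans rho0).
- by move=> zeta; rewrite inE => /eqP ->; exact: ltW.
Qed.

(* If no such polynomials existed, then Fekete polynomials would provide, for
   every [T], a comparison function bounding [v] by [b - kappa T] near [x]. *)
Lemma polar_thin K x : compact K -> polar K -> K x ->
  exists2 r : R, 0 < r & thin K (K `&` [set z | cmod (z - x) <= r]).
Proof.
move=> cK pK Kx; have [r0 [r00 [v /= [subv [[w [Bw vw]] vK]]]]] := pK x.
set B := [set y : Cplx R | _] in subv Bw vK.
have BE z : B z <-> cmod (z - x) < r0 by rewrite /B /= normE ltcR.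
exists (r0 / 8); first by rewrite divr_gt0.
set E := K `&` _; have cE : compact E.
  apply: (@subclosed_compact _ _ K) => //; last by move=> z [].
  apply: closedI; first exact: compact_cmod_closed.
  by apply: closed_cmod_le => z; exact: cont_cmodB.
have EK y : E y -> K y by case.
apply: contrapT => nthin.
have [e0 e00 hE] : exists2 e0, 0 < e0 & forall s, s != [::] -> (forall y, y \in s -> E y) ->
     exists2 z, E z & e0 ^+ size s < dist_prod s z.
  apply: contrapT => h; apply: nthin => e e0; apply: contrapT => h2; apply: h; exists e => // s s0 sE.
  apply: contrapT => h3; apply: h2; exists s; split=> // [y /sE/EK //|z Ez].
  by rewrite leNgt; apply/negP => lt; apply: h3; exists z.
have E0 : E !=set0 by exists x; split=> //=; rewrite subrr cmod0 divr_ge0 // ltW.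
have fek := fekete e00 cE E0 hE.
(* [E] lies within [r0 / 8] of [x], so the circle of radius [r] stays at distance [R1 = r - r0 / 8]
   from it, while points of the disc of radius [r0 / 8] are within [r0 / 4], which is below [R1].
   The bound [e0 / 8] in [c] is that of [fekete]. *)
pose r := r0 / 2; pose R1 := 3 * r0 / 8; pose c := Num.min (e0 / 8) (r0 / 8).
have rr0 : 0 < r by rewrite divr_gt0.
have c0 : 0 < c by rewrite lt_min !divr_gt0.
have c8 : c <= r0 / 8 by rewrite ge_min lexx orbT.
have cR1 : c < R1 by apply: le_lt_trans c8 _; rewrite /R1; lra.
have hU z : cmod (z - x) <= r -> B z by move=> zr; apply/BE; apply: le_lt_trans zr _; rewrite /r; lra.
have [b hb] := usc_bounded subv.1 (ltW rr0) hU.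
pose kappa := (ln R1 - ln (r0 / 4)) / (ln R1 - ln c).
have l1 : ln (r0 / 4) < ln R1.
  by rewrite ltr_ln ?posrE ?divr_gt0 // ?mulr_gt0 // /R1; lra.
have l2 : ln c < ln R1 by rewrite ltr_ln ?posrE // (lt_trans c0).
have l3 : ln c <= ln (r0 / 4).
  by rewrite ler_ln ?posrE ?divr_gt0 // (le_trans c8) //; lra.
have kappa0 : 0 < kappa by rewrite divr_gt0 // subr_gt0.
have kappa1 : kappa <= 1 by rewrite /kappa ler_pdivrMr ?subr_gt0 // mul1r lerD2l lerN2.
(* Upper semicontinuity and compactness give a neighbourhood of [E] of uniform width where
   [v <= b - T]; this width becomes the mesh of the net in [fekete]. *)
have near T : 0 < T -> exists2 delta : R, 0 < delta &
    forall y z, E y -> cmod (z - x) <= r -> cmod (z - y) <= delta -> (v z <= (b - T)%:E)%E.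
  move=> T0.
  have [||||d d0 hd] := @compact_ind _ E (fun A => exists2 delta : R, 0 < delta &
    forall y z, A y -> cmod (z - x) <= r -> cmod (z - y) <= delta -> (v z <= (b - T)%:E)%E) cE.
  - by exists 1.
  - move=> A A' [d1 d10 h1] [d2 d20 h2]; exists (Num.min d1 d2); first by rewrite lt_min d10 d20.
    by move=> y z [Ay|Ay] zr; rewrite le_min => /andP[z1 z2]; [exact: h1 z1|exact: h2 z2].
  - by move=> A A' AA' [d d0 h]; exists d => // y z /AA'; exact: h.
  - move=> y [Ky yr]; have By : B y.
      by apply/BE; apply: le_lt_trans yr _; lra.
    have vy : (v y < (b - T)%:E)%E by rewrite vK // ltNyr.
    have /nbhs_cmodP[d [d0 hd]] := (subv.1 y By).2 _ vy.
    have d2 : 0 < d / 2 by rewrite divr_gt0.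
    exists [set z | cmod (z - y) < d / 2]; split; first exact: nbhs_cmod_ball.
    exists (d / 4); first by rewrite divr_gt0.
    move=> y' z [_ y'y] _ zy'; apply/ltW/hd.
    have := cmod_sub_triangle y' z y; rewrite /= in y'y; lra.
  by exists d.
have vinf z : cmod (z - x) <= r0 / 8 -> v z = -oo%E.
  move=> zr; apply: (@eq_ninfty _ b kappa) => // T T0.
  have [d d0 hd] := near T T0; have [s [s0 sE hs]] := fek d d0.
  have zr' : cmod (z - x) <= r by apply: le_trans zr _; rewrite /r; lra.
  have N0 : 0 < (size s)%:R :> R by rewrite ltr0n lt0n size_eq0.
  case: (pselect (forall zeta, zeta \in s -> d <= cmod (z - zeta))) => hz; last first.
    have [zeta zs zd] : exists2 zeta, zeta \in s & cmod (z - zeta) <= d.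
      apply: contrapT => h; apply: hz => zeta zs; rewrite leNgt; apply/negP => lt.
      by apply: h; exists zeta => //; exact: ltW.
    apply: le_trans (hd _ _ (sE _ zs) zr' zd) _.
    by rewrite lee_fin lerD2l lerN2 ler_piMr // ltW.
  have := @comparison R B v x s r d R1 c b T subv rr0 s0 d0.
  rewrite c0 cR1 => /(_ isT T0 hU hb) H.
  apply: le_trans (H _ _ _ z zr' hz) _.
  - by move=> z' zeta /sE Ez z'r z'd; exact: hd Ez z'r z'd.
  - move=> z' zeta /sE[_ /= zeta8] z'r.
    by have := cmod_sub_triangle zeta z' x; rewrite z'r /R1 /r; lra.
  - move=> z' hz'; rewrite -ler_expR expR_log_sum => [|y /hz'].
      rewrite expRM_natl lnK ?posrE //; apply: le_trans (hs _ hz').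
      by rewrite lerXn2r ?nnegrE ?divr_ge0 ?(ltW c0) ?(ltW e00) // ge_min lexx.
    by apply: contraTneq => ->; rewrite subrr cmod0 -ltNge.
  rewrite lee_fin lerD2l /kappa.
  have : log_sum s z <= (size s)%:R * ln (r0 / 4).
    have -> : (size s)%:R * ln (r0 / 4) = \sum_(zeta <- s) ln (r0 / 4).
      by rewrite big_const_seq count_predT iter_addr_0 mulr_natl.
    rewrite /log_sum big_seq [leRHS]big_seq; apply: ler_sum => zeta zs.
    have zp : 0 < cmod (z - zeta) by apply: lt_le_trans (hz _ zs).
    rewrite ler_ln ?posrE ?divr_gt0 //.
    have [_ /= zeta8] := sE _ zs.
    by have := cmod_sub_triangle x z zeta; rewrite (cmodB x zeta); lra.
  move=> hls; set N := (size s)%:R in N0 hls *.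
  have -> : T / (N * (ln R1 - ln c)) * (log_sum s z - N * ln R1) =
     - (T * ((N * ln R1 - log_sum s z) / (N * (ln R1 - ln c)))) by ring.
  rewrite lerN2 ler_pM2l // ler_pdivlMr ?mulr_gt0 ?subr_gt0 //.
  have cancel (p q u : R) : q != 0 -> p / q * (u * q) = u * p by move=> q0; field.
  by rewrite cancel ?lt0r_neq0 ?subr_gt0 //; lra.
apply: vw; apply: (@ninfty_spread B v x (r0 / 8) r0 subv) => //; last exact/BE.
  by rewrite divr_gt0.
by move=> z /BE.
Qed.

Lemma dist_prod_cat s1 s2 z : dist_prod (s1 ++ s2) z = dist_prod s1 z * dist_prod s2 z.
Proof. by rewrite /dist_prod big_cat. Qed.

Lemma dist_prod_nseq n s z : dist_prod (flatten (nseq n s)) z = dist_prod s z ^+ n.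
Proof.
elim: n => [|n IH]; first by rewrite /dist_prod big_nil expr0.
by rewrite /= dist_prod_cat IH exprS.
Qed.

Lemma size_flatten_nseq n s : size (flatten (nseq n s)) = (n * size s)%N.
Proof. by elim: n => // n IH; rewrite /= size_cat IH mulSn. Qed.

Lemma mem_flatten_nseq n s y : y \in flatten (nseq n s) -> y \in s.
Proof. by elim: n => // n IH; rewrite /= mem_cat => /orP[|/IH]. Qed.

Lemma dist_prod_ge0 s z : 0 <= dist_prod s z.
Proof. by apply: prodr_ge0 => y _; exact: cmod_ge0. Qed.

Lemma dist_prod_le s z (M : R) : (forall y, y \in s -> cmod (z - y) <= M) ->
  dist_prod s z <= M ^+ size s.
Proof.
move=> h; have -> : M ^+ size s = \prod_(y <- s) M by rewrite big_const_seq count_predT iter_mulr_1.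
rewrite /dist_prod big_seq [leRHS]big_seq.
by apply: ler_prod => y ys; rewrite cmod_ge0 h.
Qed.

Lemma dist_prod_ge s z (M : R) : 0 <= M -> (forall y, y \in s -> M <= cmod (z - y)) ->
  M ^+ size s <= dist_prod s z.
Proof.
move=> M0 h; have -> : M ^+ size s = \prod_(y <- s) M by rewrite big_const_seq count_predT iter_mulr_1.
rewrite /dist_prod big_seq [leRHS]big_seq.
by apply: ler_prod => y ys; rewrite M0 h.
Qed.

Lemma compact_bounded_cmod K : compact K -> exists2 M : R, 1 <= M & forall y, K y -> cmod y <= M.
Proof.
move=> cK.
have [||||M M1 hM] := @compact_ind _ K (fun A => exists2 M : R, 1 <= M & forall y, A y -> cmod y <= M) cK.
- by exists 1.
- move=> A B [r r0 hr] [r' r'0 hr']; exists (Num.max r r'); first by rewrite le_max r0.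
  by move=> y [/hr|/hr'] h; rewrite le_max h // orbT.
- by move=> A B AB [r r0 hr]; exists r => // y /AB; exact: hr.
- move=> y Ky; exists [set z | cmod (z - y) < 1]; split; first exact: nbhs_cmod_ball.
  exists (cmod y + 1); first by rewrite lerDr.
  by move=> z [_ /= zy]; have := cmod_triangle (z - y) y; rewrite subrK; lra.
by exists M.
Qed.

(** Powers of the two polynomials are multiplied so that both have the same degree. On either set
    one factor is only known to be bounded through [M]; starting from [e ^+ 2 / M] compensates for
    it. *)
Lemma thinU K A B (M : R) : 0 < M ->
  (forall y z, K y -> (A `|` B) z -> cmod (z - y) <= M) ->
  thin K A -> thin K B -> thin K (A `|` B).
Proof.
move=> M0 hM tA tB e e0; have e'0 : 0 < e ^+ 2 / M by rewrite divr_gt0 // exprn_gt0.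
have [s1 [s10 s1K h1]] := tA _ e'0; have [s2 [s20 s2K h2]] := tB _ e'0.
have n1 : (0 < size s1)%N by rewrite lt0n size_eq0.
have n2 : (0 < size s2)%N by rewrite lt0n size_eq0.
exists (flatten (nseq (size s2) s1) ++ flatten (nseq (size s1) s2)).
have sz : size (flatten (nseq (size s2) s1) ++ flatten (nseq (size s1) s2)) = (2 * (size s1 * size s2))%N.
  by rewrite size_cat !size_flatten_nseq mulnC mul2n addnn.
split.
- by rewrite -size_eq0 sz -lt0n !muln_gt0 n1 n2.
- by move=> y; rewrite mem_cat => /orP[] /mem_flatten_nseq; [exact: s1K|exact: s2K].
move=> z ABz; rewrite sz dist_prod_cat !dist_prod_nseq exprM.
have -> : e ^+ 2 = e ^+ 2 / M * M by rewrite divfK // lt0r_neq0.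
have z1 : dist_prod s1 z <= M ^+ size s1 by apply: dist_prod_le => y /s1K Ky; exact: hM.
have z2 : dist_prod s2 z <= M ^+ size s2 by apply: dist_prod_le => y /s2K Ky; exact: hM.
rewrite exprMn.
case: ABz => [/h1 Az|/h2 Bz].
- apply: ler_pM; rewrite ?exprn_ge0 ?dist_prod_ge0 //.
    by rewrite exprM lerXn2r ?nnegrE ?dist_prod_ge0 // exprn_ge0 // ltW.
  by rewrite mulnC exprM lerXn2r ?nnegrE ?dist_prod_ge0 // exprn_ge0 // ltW.
- rewrite mulrC; apply: ler_pM; rewrite ?exprn_ge0 ?dist_prod_ge0 //.
    by rewrite mulnC exprM lerXn2r ?nnegrE ?dist_prod_ge0 // exprn_ge0 // ltW.
  by rewrite exprM lerXn2r ?nnegrE ?dist_prod_ge0 // exprn_ge0 // ltW.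
Qed.

Lemma polar_compact_thin K : compact K -> polar K -> K !=set0 -> thin K K.
Proof.
move=> cK pK [x0 Kx0].
have [M M1 hM] := compact_bounded_cmod cK.
have hM2 y z : K y -> K z -> cmod (z - y) <= 2 * M.
  move=> Ky Kz; apply: le_trans (cmod_triangle _ _) _; rewrite cmodN.
  by have := hM _ Ky; have := hM _ Kz; lra.
suff : thin K (K `&` K) by rewrite setIid.
apply: (@compact_ind _ K (fun A => thin K (K `&` A)) cK).
- move=> e e0; exists [:: x0]; split=> //; first by move=> y; rewrite inE => /eqP ->.
  by move=> z [].
- move=> A B tA tB; rewrite setIUr; apply: (@thinU _ _ _ (2 * M)) => //.
    by rewrite mulr_gt0 // (lt_le_trans ltr01).
  by move=> y z Ky [[Kz _]|[Kz _]]; exact: hM2.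
- move=> A B AB tB e /tB[s [s0 sK hs]]; exists s; split=> // z [Kz /AB Bz].
  by apply: hs.
move=> x Kx; have [r r0 tr] := polar_thin cK pK Kx.
exists [set z | cmod (z - x) < r]; split; first exact: nbhs_cmod_ball.
move=> e /tr[s [s0 sK hs]]; exists s; split=> // z [Kz [_ /= zr]].
by apply: hs; split=> //=; exact: ltW.
Qed.

End PolarThin.


(** * Construction of the plurisubharmonic function *)

Section Pairs.
Variable R : realType.
Local Notation C2 := (Cplx R * Cplx R)%type.
Implicit Types (p q a b : C2) (F : C2 -> R) (l : Cplx R) (e d : R).

Definition near2 p e q := cmod (q.1 - p.1) < e /\ cmod (q.2 - p.2) < e.

Lemma nbhs_near2 p (A : set C2) :
  nbhs p A <-> exists2 e, 0 < e & forall q, near2 p e q -> A q.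
Proof.
split.
  move=> [[U W] /= [/nbhs_cmodP[d [d0 hd]] /nbhs_cmodP[d' [d'0 hd']]] UW].
  exists (Num.min d d'); first by rewrite lt_min d0 d'0.
  move=> q; rewrite /near2 !lt_min => -[/andP[q1 _] /andP[_ q2]].
  by apply: UW; split; [exact: hd|exact: hd'].
move=> [e e0 he]; exists ([set z | cmod (z - p.1) < e], [set z | cmod (z - p.2) < e]) => /=.
  by split; exact: nbhs_cmod_ball.
by move=> q [/= q1 q2]; exact: he.
Qed.

Lemma contR2P F p : {for p, continuous F} <->
  forall e, 0 < e -> exists2 d, 0 < d & forall q, near2 p d q -> `|F q - F p| < e.
Proof.
have H := @cvgrPdist_lt R R^o C2 (nbhs p) _ F (F p); split.
  move=> /H h e /h /nbhs_near2[d d0 hd]; exists d => // q /hd.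
  by rewrite distrC.
move=> h; apply/H => e /h[d d0 hd]; apply/nbhs_near2; exists d => // q /hd.
by rewrite distrC.
Qed.

Definition line a b l : C2 := (a.1 + l * b.1, a.2 + l * b.2).

Lemma line_near a b l e : 0 < e -> exists2 d, 0 < d &
  forall l', cmod (l' - l) < d -> near2 (line a b l) e (line a b l').
Proof.
move=> e0; pose M := cmod b.1 + cmod b.2 + 1.
have M0 : 0 < M by rewrite ltr_wpDl ?addr_ge0.
exists (e / M); first by rewrite divr_gt0.
have M1 : cmod b.1 <= M by rewrite /M -addrA lerDl addr_ge0.
have M2 : cmod b.2 <= M by rewrite /M addrAC lerDr addr_ge0.
move=> l'; rewrite ltr_pdivlMr // => h; split=> /=.
  by rewrite opprD addrACA subrr add0r -mulrBl cmodM; apply: le_lt_trans h; rewrite ler_wpM2l.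
by rewrite opprD addrACA subrr add0r -mulrBl cmodM; apply: le_lt_trans h; rewrite ler_wpM2l.
Qed.

Lemma cont_line F a b l : {for line a b l, continuous F} ->
  {for l, continuous (fun l => F (line a b l))}.
Proof.
move=> /contR2P cF; apply/contRP => e /cF[d d0 hd].
by have [d' d'0 hd'] := line_near a b l d0; exists d'; split=> // y /hd' /hd.
Qed.

Lemma cont_line_circle F a b : (forall t : R, {for line a b (cexpi t), continuous F}) ->
  continuous (fun t : R => F (line a b (cexpi t))).
Proof.
move=> cF t; have E : (fun t : R => F (line a b (cexpi t))) =
    (fun t => F (line a b (0 + 1%:C%C * cexpi t))).
  by apply/funext => u; rewrite mul1r add0r.
rewrite E; apply: (@cont_cexpi_comp R (fun l => F (line a b l))).
by apply: cont_line; rewrite mul1r add0r.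
Qed.

End Pairs.

(** * Weighted sums of continuous functions with the submean property *)

Section Series.
Variable R : realType.
Local Notation C2 := (Cplx R * Cplx R)%type.
Local Notation mu := (@lebesgue_measure R).
Variables (O B : set C2) (V : nat -> C2 -> R).
Implicit Types (p q a b : C2) (l : Cplx R) (e d C : R).

Let S m p : R := \sum_(n < m) V n p / 2 ^+ n.

Let Dm C m p : R := S m p + 2 * C / 2 ^+ m.

(* The sum of [V n p / 2 ^ n], as the infimum of the nonincreasing sequences
   obtained by adding to the partial sums the tails for an upper bound [C];
   its value is junk if [V n p] is not bounded above in [n]. *)
Definition dyadic_series p : \bar R := ereal_inf [set x | exists m C,
  (forall n, V n p <= C) /\ x = (\sum_(n < m) V n p / 2 ^+ n + 2 * C / 2 ^+ m)%:E].

Let SS m p : S m.+1 p = S m p + V m p / 2 ^+ m.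
Proof. by rewrite /S big_ord_recr. Qed.

Let Dm_step C m p : V m p <= C -> Dm C m.+1 p <= Dm C m p.
Proof.
move=> h; rewrite /Dm SS -addrA lerD2l exprS.
have -> : 2 * C / (2 * 2 ^+ m) = C / 2 ^+ m by field.
by rewrite -mulrDl ler_pM2r ?invr_gt0 ?exprn_gt0 //; lra.
Qed.

Let Dm_mono C m m' p : (forall n, V n p <= C) -> (m <= m')%N -> Dm C m' p <= Dm C m p.
Proof.
move=> h; elim: m' => [|m' IH]; first by rewrite leqn0 => /eqP ->.
rewrite leq_eqVlt => /orP[/eqP -> //|]; rewrite ltnS => /IH.
exact: le_trans (Dm_step _).
Qed.

Let u_le C m p : (forall n, V n p <= C) -> (dyadic_series p <= (Dm C m p)%:E)%E.
Proof. by move=> h; apply: ereal_inf_lbound; exists m, C. Qed.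

(** The infimum ranges over all admissible bounds [C'], the hypothesis concerns one [C]; their tails
    differ by [2 * (C - C') / 2 ^+ m], which tends to 0. *)
Let u_ge C (M : R) p : (forall n, V n p <= C) -> (forall m, M <= Dm C m p) ->
  (M%:E <= dyadic_series p)%E.
Proof.
move=> hC hM; apply: le_ereal_inf_tmp => _ [m [C' [hC' ->]]]; rewrite -/(S m p) -/(Dm C' m p) lee_fin.
apply/ler_addgt0Pr => e e0.
have [k hk] := @small_pow2 R (2 * (C - C')) e e0.
pose m' := maxn m k.
have h1 := Dm_mono hC' (leq_maxl m k); have h2 := hM m'.
have h3 : Dm C m' p = Dm C' m' p + 2 * (C - C') / 2 ^+ m' by rewrite /Dm; field.
have h4 : 2 * (C - C') / 2 ^+ m' <= e.
  case: (leP 0 (C - C')) => CC; last first.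
    apply: le_trans (ltW e0); rewrite mulr_le0_ge0 ?invr_ge0 ?exprn_ge0 //.
    by rewrite mulr_ge0_le0 // ltW.
  apply: le_trans (ltW hk); rewrite ler_wpM2l ?mulr_ge0 // lef_pV2 ?posrE ?exprn_gt0 //.
  by rewrite ler_weXn2l ?ler1n // leq_maxr.
rewrite -/m' in h1; lra.
Qed.

Hypothesis contV : forall n p, O p -> {for p, continuous (V n)}.
Hypothesis subV : forall n a b, (forall l, cmod l <= 1 -> O (line a b l)) ->
  2 * pi * V n a <= \int[mu]_(t in `[0%R, 2 * pi]) V n (line a b (cexpi t)).
Hypothesis upV : forall p, O p -> exists C, exists2 e, 0 < e &
  forall q n, near2 p e q -> V n q <= C.
Hypothesis badV : forall p, B p -> exists C, forall n, V n p <= C - 4 ^+ n.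
Hypothesis goodV : forall p, O p -> ~ B p -> exists C, exists2 e, 0 < e &
  forall q n, near2 p e q -> - C <= V n q.
Hypothesis BO : B `<=` O.

Let near2_refl p e : 0 < e -> near2 p e p.
Proof. by move=> e0; split; rewrite subrr cmod0. Qed.

Let contDm C m p : O p -> {for p, continuous (Dm C m)}.
Proof.
move=> Op; apply: contRD; last exact: contR_cst.
apply: (@contR_sum R _ _ _ (fun (n : 'I_m) p => V n p / 2 ^+ n)) => n _.
by apply: contRM; [exact: contV|exact: contR_cst].
Qed.

Let u_lt C (M : R) p : (forall n, V n p <= C) -> (dyadic_series p < M%:E)%E ->
  exists m, Dm C m p < M.
Proof.
move=> hC uM; apply: contrapT => h; move: uM; rewrite ltNge => /negP; apply.
apply: (u_ge hC) => m; rewrite leNgt; apply/negP => hm; apply: h; by exists m.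
Qed.

Let usc_series : usc_on O dyadic_series.
Proof.
move=> p Op; have [C [e e0 hC]] := upV Op.
have hCp n : V n p <= C by apply: hC; exact: near2_refl.
split; first by apply: le_lt_trans (u_le 0 hCp) _; rewrite ltry.
move=> M /(u_lt hCp)[m hm].
have d0 : 0 < M - Dm C m p by rewrite subr_gt0.
have [d d0' hd] := (contR2P _ _).1 (@contDm C m p Op) _ d0.
apply/nbhs_near2; exists (Num.min d e); first by rewrite lt_min d0' e0.
move=> q [q1 q2]; move: q1 q2; rewrite !lt_min => /andP[qd1 qe1] /andP[qd2 qe2].
apply: le_lt_trans (u_le m (C := C) _) _; first by move=> n; apply: hC.
have := hd q (conj qd1 qd2); rewrite ltr_norml lte_fin => /andP[_]; lra.
Qed.

Let S_tail C m k p : (forall n, `|V n p| <= C) -> S m p - 2 * C / 2 ^+ m <= Dm C k p.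
Proof.
move=> h; have hC n : V n p <= C by exact: le_trans (ler_norm _) (h n).
have C0 : 0 <= C by exact: le_trans (normr_ge0 _) (h 0%N).
have low j : S m p - 2 * C / 2 ^+ m <= S (m + j) p - 2 * C / 2 ^+ (m + j).
  elim: j => [|j IH]; first by rewrite addn0.
  apply: le_trans IH _; rewrite addnS SS exprS.
  have -> : 2 * C / (2 * 2 ^+ (m + j)) = C / 2 ^+ (m + j) by field.
  have : 0 <= (V (m + j) p + C) / 2 ^+ (m + j).
    rewrite divr_ge0 ?exprn_ge0 //; have := h (m + j)%N; rewrite ler_norml => /andP[+ _]; lra.
  rewrite mulrDl; have -> : 2 * C / 2 ^+ (m + j) = C / 2 ^+ (m + j) + C / 2 ^+ (m + j) by field.
  lra.
have pos j : 0 <= 2 * C / 2 ^+ j by rewrite divr_ge0 ?mulr_ge0 ?exprn_ge0.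
apply: le_trans (low k) _.
apply: le_trans (Dm_mono hC (leq_addl m k)).
by rewrite /Dm; have := pos (m + k)%N; lra.
Qed.

Let series_good p : O p -> ~ B p -> exists C, exists2 e, 0 < e & forall q, near2 p e q ->
  exists2 r : R, dyadic_series q = r%:E & forall m, `|r - S m q| <= 2 * C / 2 ^+ m.
Proof.
move=> Op nBp; have [C1 [e1 e10 h1]] := upV Op; have [C2 [e2 e20 h2]] := goodV Op nBp.
pose C := Num.max C1 C2.
exists C, (Num.min e1 e2); first by rewrite lt_min e10 e20.
move=> q [q1 q2]; move: q1 q2; rewrite !lt_min => /andP[a1 a2] /andP[b1 b2].
have hV n : `|V n q| <= C.
  rewrite ler_norml; apply/andP; split.
    apply: le_trans (h2 q n (conj a2 b2)); rewrite lerN2 le_max lexx orbT //.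
  by apply: le_trans (h1 q n (conj a1 b1)) _; rewrite le_max lexx.
have hC n : V n q <= C by exact: le_trans (ler_norm _) (hV n).
have up m := u_le m hC.
have lo m : ((S m q - 2 * C / 2 ^+ m)%:E <= dyadic_series q)%E by apply: (u_ge hC) => k; exact: S_tail.
case E : (dyadic_series q) => [r| |].
- exists r => // m; have := up m; have := lo m; rewrite E !lee_fin /Dm => l1 l2.
  by rewrite ler_norml; apply/andP; split; lra.
- by have := up 0%N; rewrite E leNgt ltry.
- by have := lo 0%N; rewrite E leNgt ltNyr.
Qed.

(** Dividing by [2 ^+ n] turns [4 ^+ n] into [2 ^+ n], whose partial sums are unbounded. *)
Let series_bad p : B p -> dyadic_series p = -oo%E.
Proof.
move=> Bp; have [C hC] := badV Bp.
have hC' n : V n p <= C by apply: le_trans (hC n) _; rewrite gerBl exprn_ge0.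
have DmE m : Dm C m p <= 2 * C - 2 ^+ m + 1.
  elim: m => [|m IH]; first by rewrite /Dm /S big_ord0 !expr0; lra.
  rewrite /Dm SS; move: IH; rewrite /Dm => IH.
  have : V m p / 2 ^+ m <= C / 2 ^+ m - 2 ^+ m.
    have -> : C / 2 ^+ m - 2 ^+ m = (C - 4 ^+ m) / 2 ^+ m.
      have -> : (4 : R) ^+ m = 2 ^+ m * 2 ^+ m by rewrite -exprMn; congr (_ ^+ _); ring.
      by field.
    by rewrite ler_pM2r ?invr_gt0 ?exprn_gt0.
  have -> : 2 * C / 2 ^+ m.+1 = C / 2 ^+ m by rewrite exprS; field.
  have e2 : 2 * C / 2 ^+ m = C / 2 ^+ m + C / 2 ^+ m by field.
  rewrite [2 ^+ m.+1]exprS; lra.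
case E : (dyadic_series p) => [r| |] //; exfalso.
  have [m hm] := @unbounded_pow R 2 (2 * C + 1 - r) (ltac:(by rewrite ltr1n)).
  by have := u_le m hC'; rewrite E lee_fin; have := DmE m; lra.
by have := u_le 0 hC'; rewrite E leNgt ltry.
Qed.

(** On [B] the limit value is 0 and upper semicontinuity suffices; off [B] the series converges
    uniformly near [p]. *)
Let series_exp_cont p : O p -> exp_ext dyadic_series q @[q --> p] --> exp_ext dyadic_series p.
Proof.
move=> Op; suff : {for p, continuous (exp_ext dyadic_series)} by [].
have [Bp|nBp] := pselect (B p).
  apply/contR2P => e e0; have up := series_bad Bp.
  have : (dyadic_series p < (ln e)%:E)%E by rewrite up ltNyr.
  move=> /((usc_series Op).2 _) /nbhs_near2[d d0 hd]; exists d => // q /hd.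
  rewrite [exp_ext _ p]/exp_ext up subr0 /exp_ext; case: (dyadic_series q) => [r| |] //=.
    by rewrite lte_fin => re; rewrite ger0_norm ?expR_ge0 // -[e]lnK ?posrE // ltr_expR.
  by move=> _; rewrite normr0.
have [C [e e0 hC]] := series_good Op nBp.
pose r q := fine (dyadic_series q).
have rE q : near2 p e q -> dyadic_series q = (r q)%:E.
  by move=> /hC[x qx _]; rewrite /r qx.
have rS q m : near2 p e q -> `|r q - S m q| <= 2 * C / 2 ^+ m.
  by move=> /hC[x qx h]; rewrite /r qx; exact: h.
have cr : {for p, continuous r}.
  apply/contR2P => x x0; have x3 : 0 < x / 3 by rewrite divr_gt0.
  have [m hm] := @small_pow2 R (2 * C) (x / 3) x3.
  have [d d0 hd] := (contR2P _ _).1 (@contDm 0 m p Op) _ x3.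
  exists (Num.min d e); first by rewrite lt_min d0 e0.
  move=> q [q1 q2]; move: q1 q2; rewrite !lt_min => /andP[qd1 qe1] /andP[qd2 qe2].
  have h1 := rS q m (conj qe1 qe2); have h2 := rS p m (near2_refl p e0).
  have := hd q (conj qd1 qd2); rewrite /Dm mulr0 mul0r !addr0 => h3.
  move: h1 h2 h3; rewrite !ler_norml !ltr_norml => /andP[? ?] /andP[? ?] /andP[? ?].
  by apply/andP; split; lra.
have cexp : {for p, continuous (fun q => expR (r q))}.
  by apply: contR_comp => //; exact: continuous_expR.
apply/contR2P => x x0; have [d d0 hd] := (contR2P _ _).1 cexp _ x0.
exists (Num.min d e); first by rewrite lt_min d0 e0.
move=> q [q1 q2]; move: q1 q2; rewrite !lt_min => /andP[qd1 qe1] /andP[qd2 qe2].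
by rewrite /exp_ext (rE _ (conj qe1 qe2)) (rE _ (near2_refl p e0)); exact: hd.
Qed.

Let upper_on_disc a b : (forall l, cmod l <= 1 -> O (line a b l)) ->
  exists C, forall l n, cmod l <= 1 -> V n (line a b l) <= C.
Proof.
move=> hO; have cD := @compact_disc R 0 1.
have [||||C hC] := @compact_ind _ _ (fun A : set (Cplx R) => exists C, forall l n, A l -> V n (line a b l) <= C) cD.
- by exists 0.
- move=> A A' [C h] [C' h']; exists (Num.max C C') => l n [/h|/h'] hl; by rewrite le_max hl ?orbT.
- by move=> A A' AA' [C h]; exists C => l n Al; exact: (h l n (AA' l Al)).
- move=> l /=; rewrite subr0 => /hO Ol; have [C [e e0 hC]] := upV Ol.
  have [d d0 hd] := line_near a b l e0.
  exists [set l' | cmod (l' - l) < d]; split; first exact: nbhs_cmod_ball.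
  by exists C => l' n [_ /= /hd]; exact: hC.
by exists C => l n l1; apply: hC; rewrite /= subr0.
Qed.

(** With one [C] for the whole disc, the functions [Dm C m] decrease in [m], so monotone convergence
    applies to [f 0 - f m]. Only the inequality [f 0 - h <= dyadic_series] on the circle is used,
    and no measurability of the series. *)
Let series_submean a b : (forall l, cmod l <= 1 -> O (line a b l)) ->
  (dyadic_series a <= ((2 * pi)^-1)%:E *
     \int[mu]_(t in `[0%R, (2 * pi)%R]) dyadic_series (line a b (cexpi t)))%E.
Proof.
move=> hO; have [C hC] := upper_on_disc hO.
have p2 : 0 < 2 * pi :> R by rewrite mulr_gt0 // pi_gt0.
have la0 : line a b 0 = a by rewrite /line !mul0r !addr0; case: (a).
have hCa n : V n a <= C by rewrite -la0; apply: hC; rewrite cmod0.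
have ct t : cmod (cexpi t : Cplx R) <= 1 by rewrite cmod_cexpi.
have hCt t n : V n (line a b (cexpi t)) <= C by exact: hC.
case E : (dyadic_series a) => [x| |]; last by rewrite leNye.
  2: by have := u_le 0 hCa; rewrite E leNgt ltry.
have xle m : x <= Dm C m a by have := u_le m hCa; rewrite E lee_fin.
pose f m t := Dm C m (line a b (cexpi t)).
have cf m : continuous (f m) by apply: cont_line_circle => t; apply: contDm; exact: hO.
have If m : 2 * pi * x <= \int[mu]_(t in `[0%R, 2 * pi]) f m t.
  apply: (@le_trans _ _ (2 * pi * Dm C m a)); first by rewrite ler_pM2l.
  have cV n : continuous (fun t : R => V n (line a b (cexpi t))).
    by apply: cont_line_circle => t; apply: contV; exact: hO.
  have cS k : continuous (fun t : R => S k (line a b (cexpi t))).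
    move=> t; apply: (@contR_sum R R _ _ (fun (n : 'I_k) t => V n (line a b (cexpi t)) / 2 ^+ n)) => n _.
    by apply: contRM; [exact: cV|exact: contR_cst].
  have iC (F : R -> R) : continuous F -> mu.-integrable `[0%R, 2 * pi]%classic (EFin \o F).
    by move=> cF; exact: (@integrable_itv R F _ 0 (2 * pi)).
  have cstI (k : R) : \int[mu]_(t in `[0%R, 2 * pi]) (fun=> k) t = 2 * pi * k.
    have mu2 : fine (mu `[0%R, 2 * pi]%classic) = 2 * pi.
      by rewrite lebesgue_measure_itv /= lte_fin p2 /= subr0.
    by rewrite Rintegral_cst // mu2 mulrC.
  have IS k : 2 * pi * S k a <= \int[mu]_(t in `[0%R, 2 * pi]) S k (line a b (cexpi t)).
    elim: k => [|k IH].
      have -> : (fun t => S 0 (line a b (cexpi t))) = (fun=> 0) by apply/funext => t; rewrite /S big_ord0.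
      by rewrite cstI /S big_ord0.
    have -> : (fun t => S k.+1 (line a b (cexpi t))) =
        (fun t => S k (line a b (cexpi t)) + V k (line a b (cexpi t)) * (2 ^+ k)^-1).
      by apply/funext => t; rewrite SS.
    have cV' : continuous (fun t : R => V k (line a b (cexpi t)) * (2 ^+ k)^-1).
      move=> t; exact: (@contRM R R (fun t => V k (line a b (cexpi t))) (fun=> (2 ^+ k)^-1) t
        (cV k t) (@contR_cst R R _ t)).
    rewrite RintegralD //; [|exact: iC|exact: iC].
    rewrite RintegralZr //; last exact: iC.
    rewrite SS mulrDr mulrA; apply: lerD => //.
    by rewrite ler_wpM2r ?invr_ge0 ?exprn_ge0 //; exact: subV.
  rewrite /f /Dm RintegralD //; [|exact: iC|].
    2: exact: (iC (fun=> 2 * C / 2 ^+ m) (fun t => @contR_cst R R _ t)).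
  by rewrite (cstI (2 * C / 2 ^+ m)) mulrDr lerD2r.
pose g m t : R := f 0%N t - f m t.
have cg m : continuous (g m).
  move=> t; have -> : g m = (fun t => f 0%N t + (-1) * f m t).
    by apply/funext => y; rewrite mulN1r.
  exact: (@contRD R R (f 0%N) (fun t => -1 * f m t) t (cf 0%N t)
    (@contRM R R (fun=> -1) (f m) t (@contR_cst R R _ t) (cf m t))).
have ig m : mu.-integrable `[0%R, 2 * pi]%classic (EFin \o g m).
  exact: (@integrable_itv R _ _ 0 (2 * pi)).
have mg m := measurable_int mu (ig m).
have g0 m t : 0 <= g m t by rewrite subr_ge0; apply: Dm_mono.
have gmono t m n : (m <= n)%N -> g m t <= g n t.
  by move=> mn; rewrite lerD2l lerN2; apply: Dm_mono.
pose h t : \bar R := limn (fun m => (g m t)%:E).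
have gcvg t : (g m t)%:E @[m --> \oo] --> ereal_sup (range (fun m => (g m t)%:E)).
  by apply: ereal_nondecreasing_cvgn => m n mn; rewrite lee_fin; exact: gmono.
have hE t : h t = ereal_sup (range (fun m => (g m t)%:E)) by exact/cvg_lim.
have Ih : (\int[mu]_(t in `[0%R, (2 * pi)%R]) h t <=
    (\int[mu]_(t in `[0%R, 2 * pi]) f 0%N t - 2 * pi * x)%:E)%E.
  rewrite monotone_convergence //; last 2 first.
  - by move=> n t _; rewrite lee_fin.
  - by move=> t _ m n mn; rewrite lee_fin; exact: gmono.
  apply: lime_le.
    apply: ereal_nondecreasing_is_cvgn => m n mn; apply: le_integral_nomeas => t _.
    by rewrite lee_fin gmono.
  apply: nearW => m; rewrite integral_real // lee_fin /g.
  rewrite RintegralB //; try exact: (@integrable_itv R _ _ 0 (2 * pi)).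
  by rewrite lerD2l lerN2.
have h0 t : (0 <= h t)%E.
  by rewrite hE; apply: ereal_sup_ge; exists (g 0%N t)%:E; [exists 0%N|rewrite lee_fin].
have ih : mu.-integrable `[0%R, 2 * pi]%classic h.
  apply/integrableP; split.
    apply: (@measurable_realfun.emeasurable_fun_cvg _ _ _ _ (fun m => EFin \o g m)) => //.
    by move=> t _ /=; rewrite hE; exact: gcvg.
  under eq_integral do rewrite gee0_abs //.
  by apply: le_lt_trans Ih _; rewrite ltry.
have if0 : mu.-integrable `[0%R, 2 * pi]%classic (EFin \o f 0%N).
  exact: (@integrable_itv R _ _ 0 (2 * pi)).
have low : ((2 * pi * x)%:E <= \int[mu]_(t in `[0%R, (2 * pi)%R]) dyadic_series (line a b (cexpi t)))%E.
  apply: (@le_trans _ _ (\int[mu]_(t in `[0%R, (2 * pi)%R]) ((f 0%N t)%:E - h t))%E); last first.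
    apply: le_integral_nomeas => t _.
    case E' : (h t) => [y| |].
    - rewrite -EFinB; apply: (u_ge (hCt t)) => m.
      have : ((g m t)%:E <= h t)%E by rewrite hE; apply: ereal_sup_ubound; exists m.
      by rewrite E' lee_fin /g /f; lra.
    - by rewrite leNye.
    - by have := h0 t; rewrite E' leNgt ltNy0.
  rewrite integralB // integral_real //.
  have : (0 <= \int[mu]_(t in `[0%R, (2 * pi)%R]) h t)%E by apply: integral_ge0.
  move: Ih; case: (\int[mu]_(t in _) h t)%E => [y|//|//].
  by rewrite !lee_fin; lra.
move: low; case: (\int[mu]_(t in _) _)%E => [y| |//].
  rewrite -EFinM !lee_fin => h1; rewrite mulrC ler_pdivlMr // mulrC //.
by rewrite gt0_muley ?leey // lte_fin invr_gt0.
Qed.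

Lemma series_psh : exists u : C2 -> \bar R, cont_psh_on O u /\
  [set p | O p /\ u p = -oo%E] = B.
Proof.
exists dyadic_series; split.
  split; last by move=> p Op; exact: series_exp_cont.
  split; first exact: usc_series.
  move=> a b hO; apply: series_submean => l l1; apply: hO.
  by rewrite normE lecR.
apply/seteqP; split => p /=.
  move=> [Op up]; apply: contrapT => nBp.
  have [C [e e0 hC]] := series_good Op nBp.
  by have [r rE _] := hC p (near2_refl p e0); rewrite up in rE.
by move=> Bp; split; [exact: BO|exact: series_bad].
Qed.

End Series.


(** * Cutoff polynomials adapted to [f] *)

Section Cutoff.
Variable R : realType.
Implicit Types (z w k : Cplx R) (e d : R) (D K L : set (Cplx R)) (f Q : Cplx R -> Cplx R).

Lemma compact_collar D K : open D -> compact K -> K `<=` D ->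
  exists2 eta : R, 0 < eta & forall k z, K k -> cmod (z - k) <= eta -> D z.
Proof.
move=> oD cK KD.
have [||||d d0 hd] := @compact_ind _ K (fun A => exists2 eta : R, 0 < eta &
  forall k z, A k -> cmod (z - k) <= eta -> D z) cK.
- by exists 1.
- move=> A A' [d1 d10 h1] [d2 d20 h2]; exists (Num.min d1 d2); first by rewrite lt_min d10 d20.
  by move=> k z [Ak|Ak]; rewrite le_min => /andP[z1 z2]; [exact: (h1 k)|exact: (h2 k)].
- by move=> A A' AA' [d d0 h]; exists d => // k z /AA'; exact: h.
- move=> k /KD Dk; have /nbhs_cmodP[d [d0 hd]] : nbhs k D by exact: open_nbhs_nbhs.
  have d2 : 0 < d / 2 by rewrite divr_gt0.
  exists [set z | cmod (z - k) < d / 2]; split; first exact: nbhs_cmod_ball.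
  exists (d / 4); first by rewrite divr_gt0.
  move=> k' z [_ /= k'k] zk'; apply: hd.
  by have := cmod_sub_triangle k' z k; lra.
by exists d.
Qed.

Lemma compact_thickening K e : compact K ->
  compact [set z | exists2 k, K k & cmod (z - k) <= e].
Proof.
move=> cK; pose S := (K `*` [set z : Cplx R | cmod (z - 0) <= e]).
have cS : compact S by apply: compact_setX => //; exact: compact_disc.
pose h (p : Cplx R * Cplx R) : Cplx R := p.1 + p.2.
have ch : continuous h.
  move=> p; apply/(@cvg_cmod R (Cplx R * Cplx R)%type (nbhs p) _ h (h p)) => d d0.
  apply/nbhs_near2; exists (d / 2); first by rewrite divr_gt0.
  move=> q [q1 q2]; rewrite /h opprD addrACA (splitr d).
  exact: le_lt_trans (cmod_triangle _ _) (ltrD q1 q2).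
have cI : compact (h @` S) by apply: continuous_compact => //; exact: continuous_subspaceT.
suff -> : [set z | exists2 k, K k & cmod (z - k) <= e] = h @` S by [].
apply/seteqP; split => z.
  move=> [k Kk zk]; exists (k, z - k); last by rewrite /h /= addrC subrK.
  by split=> //=; rewrite subr0.
by move=> [[k y] [/= Kk]]; rewrite subr0 => ye <-; exists k => //; rewrite /h /= addrAC subrr add0r.
Qed.

Lemma bounded_on_compact f A : compact A ->
  (forall z, A z -> {for z, continuous f}) ->
  exists2 C : R, 0 <= C & forall z, A z -> cmod (f z) <= C.
Proof.
move=> cA cf.
have [||||C C0 hC] := @compact_ind _ A (fun E => exists2 C : R, 0 <= C & forall z, E z -> A z -> cmod (f z) <= C) cA.
- by exists 0.
- move=> E E' [C C0 h] [C' C'0 h']; exists (Num.max C C'); first by rewrite le_max C0.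
  by move=> z [Ez|Ez] Az; rewrite le_max ?(h z Ez Az) ?(h' z Ez Az) ?orbT.
- by move=> E E' EE' [C C0 h]; exists C => // z /EE'; exact: h.
- move=> x Ax; have /nbhs_cmodP[d [d0 hd]] := (contP _ _).1 (cf x Ax) 1 ltr01.
  exists [set z | cmod (z - x) < d]; split; first exact: nbhs_cmod_ball.
  exists (cmod (f x) + 1); first by rewrite addr_ge0.
  move=> z [_ /= /hd zx] _; have := cmod_triangle (f z - f x) (f x); rewrite subrK; lra.
by exists C => // z Az; exact: hC.
Qed.

(* For nonempty [K], [|cutQ|] is the [cutA]-th power of a geometric mean of
   distances to points of [K]; [f] is controlled on the part of the collar [L]
   where [cut_lo <= |cutQ|]. *)
Record cutoff (K L : set (Cplx R)) (f : Cplx R -> Cplx R) (Delta : R) := Cutoff {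
  cutQ : Cplx R -> Cplx R;
  cutA : nat;
  cut_lo : R;
  cut_hi : R;
  cut_floor : R;
  cut_bound : R;
  cutA_gt0 : (0 < cutA)%N;
  cutQ_cdiff : forall z, cdiff cutQ z;
  cut_lo_gt0 : 0 < cut_lo;
  cut_lo_hi : cut_lo < cut_hi;
  cutQ_K : forall z, K z -> cmod (cutQ z) < cut_lo;
  cutQ_hi : forall z, cmod (cutQ z) < cut_hi -> L z;
  cut_bound_ge0 : 0 <= cut_bound;
  cut_f : forall z, L z -> cut_lo <= cmod (cutQ z) -> cmod (f z) <= cut_bound;
  cut_floor_gt0 : 0 < cut_floor;
  cut_floor_ge : (1 + cut_bound) * cut_hi <= cut_floor;
  cutQ_upper : forall z, cmod (cutQ z) <= (cmod z + Delta) ^+ cutA;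
  cutQ_lower : forall z (rho : R), 0 < rho <= 1 -> (forall k, K k -> rho <= cmod (z - k)) ->
    rho ^+ cutA <= cmod (cutQ z) /\ (cmod (cutQ z) < cut_lo -> rho ^+ cutA <= cut_floor);
  cut_bound_le : 1 + cut_bound <= 2 ^+ cutA
}.

(** With no points of [K] to serve as roots, the constant 1 takes the place of the polynomial; the
    levels are below 1, so the region near [K] is empty. *)
Lemma cutoff_empty L f (Delta m : R) : (forall z, ~ L z) -> 1 <= Delta -> 0 < m ->
  exists c : cutoff set0 L f Delta, cut_floor c <= expR (- m) ^+ cutA c.
Proof.
move=> L0 D1 m0; pose c : R := expR (- m).
have c0 : 0 < c by exact: expR_gt0.
have c1 : c < 1 by rewrite expR_lt1 oppr_lt0.
have c2 : c / 2 < c by rewrite ltr_pdivrMr // mulr_natr mulr2n ltrDl.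
unshelve eexists.
  apply: (@Cutoff set0 L f Delta (fun=> 1) 1%N (c / 2) c c 0) => //.
  - by move=> z; exact: cdiff_cst.
  - by rewrite divr_gt0.
  - by move=> z h; exfalso; have := lt_trans h c1; rewrite cmod1 ltxx.
  - by move=> z /L0.
  - by rewrite addr0 mul1r.
  - by move=> z; rewrite cmod1 expr1 (le_trans D1) // lerDr.
  - move=> z rho /andP[_ r1] _; rewrite cmod1 expr1; split=> //.
    by rewrite ltNge => /negP[]; rewrite ltW // (lt_trans c2).
  - by rewrite addr0 expr1 ler1n.
by rewrite /= expr1.
Qed.

Lemma ltr_exp (x y : R) n : (0 < n)%N -> 0 <= x -> x < y -> x ^+ n < y ^+ n.
Proof. by move=> n0 x0 xy; rewrite ltr_pXn2r // nnegrE (le_trans x0) // ltW. Qed.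

Lemma ler_exp (x y : R) n : 0 <= x -> x <= y -> x ^+ n <= y ^+ n.
Proof. by move=> x0 xy; rewrite lerXn2r // nnegrE (le_trans x0). Qed.

Lemma cdiff_sub_cst (y z : Cplx R) : cdiff (fun z => z - y) z.
Proof. by apply: cdiffB; [exact: cdiff_id|exact: cdiff_cst]. Qed.

Lemma cont_dist_prod s z : {for z, continuous (dist_prod s : Cplx R -> R)}.
Proof. by apply: contR_prod => y _; exact: cont_cmodB. Qed.

Lemma cutoff_exists K L D f (Delta eta m : R) :
  compact K -> K !=set0 -> thin K K ->
  compact L -> 0 < eta -> (forall k z, K k -> cmod (z - k) <= eta -> L z) -> L `<=` D ->
  (forall z, D z -> ~ K z -> cdiff f z) ->
  (forall k, K k -> cmod k <= Delta) ->
  exists c : cutoff K L f Delta, cut_floor c <= expR (- m) ^+ cutA c.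
Proof.
move=> cK K0 tK cL eta0 KL LD hf hDelta.
(* The first bound makes the floor [(6 * e) ^+ A] small. The second puts the region where
   [|Q| < (3 * e) ^+ A] into [L], since some root must then be closer than [3 * e]. *)
pose e := Num.min (expR (- m) / 6) (eta / 6).
have e0 : 0 < e by rewrite lt_min !divr_gt0 // expR_gt0.
have em : 6 * e <= expR (- m).
  by rewrite mulrC -ler_pdivlMr // ge_min lexx.
have ee : 6 * e <= eta by rewrite mulrC -ler_pdivlMr // ge_min lexx orbT.
have [s [s0 sK hs]] := tK e e0.
set N := size s in hs; have N0 : (0 < N)%N by rewrite lt0n size_eq0.
(* Values of the polynomial on [K] are at most [e ^+ N], so this part of [L] is a compact set
   disjoint from [K], on which [f] is continuous. *)
have [C C0 hC] : exists2 C : R, 0 <= C & forall z, L z -> (2 * e) ^+ N <= dist_prod s z -> cmod (f z) <= C.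
  pose A := L `&` [set z | - dist_prod s z <= - (2 * e) ^+ N].
  have cA : compact A.
    have clL := compact_cmod_closed cL.
    apply: subclosed_compact cL _; last by move=> z [].
    apply: closedI; first exact: clL.
    apply: closed_cmod_le => z; have -> : (fun z => - dist_prod s z) = (fun z => (-1) * dist_prod s z).
      by apply/funext => y; rewrite mulN1r.
    by apply: contRM; [exact: contR_cst|exact: cont_dist_prod].
  have [|C C0 hC] := @bounded_on_compact f A cA.
    move=> z [Lz]; rewrite /= lerN2 => hz; apply/cdiff_continuous/hf; first exact: LD.
    move=> /hs /(le_trans hz); rewrite leNgt => /negP; apply.
    by apply: ltr_exp => //; lra.
  by exists C => // z Lz hz; apply: hC; split=> //=; rewrite lerN2.
(* The exponent is chosen after [C]. It leaves the level sets unchanged, and [1 + C <= 2 ^+ A] lets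
   the floor [(6 * e) ^+ A] absorb [(1 + C) * (3 * e) ^+ A]. *)
have [a' ha'] := @unbounded_pow R 2 (1 + C) (ltac:(by rewrite ltr1n)).
pose a := a'.+1; pose A := (N * a)%N.
have A0 : (0 < A)%N by rewrite muln_gt0 N0.
have aA : (a <= A)%N by rewrite leq_pmull.
have ha : 1 + C <= 2 ^+ A.
  apply: le_trans (ltW ha') _; rewrite ler_weXn2l ?ler1n //.
  by rewrite (leq_trans (leqnSn a')).
pose Q z : Cplx R := (\prod_(y <- s) (z - y)) ^+ a.
have QE z : cmod (Q z) = dist_prod s z ^+ a by rewrite cmodX cmod_prod.
have e20 : 0 < 2 * e by rewrite mulr_gt0.
have e30 : 0 < 3 * e by rewrite mulr_gt0.
have e60 : 0 < 6 * e by rewrite mulr_gt0.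
have powA (x : R) : x ^+ A = (x ^+ N) ^+ a by rewrite exprM.
have low z : ((2 * e) ^+ A <= cmod (Q z)) = ((2 * e) ^+ N <= dist_prod s z).
  by rewrite QE powA ler_pXn2r ?nnegrE ?dist_prod_ge0 ?exprn_ge0 // ltW.
unshelve eexists.
  apply: (@Cutoff K L f Delta Q A ((2 * e) ^+ A) ((3 * e) ^+ A) ((6 * e) ^+ A) C) => //.
  - by move=> z; apply: cdiffX; apply: cdiff_prod => y; exact: cdiff_sub_cst.
  - by rewrite exprn_gt0.
  - by apply: ltr_exp => //; lra.
  - move=> z Kz; rewrite ltNge low -ltNge; apply: le_lt_trans (hs z Kz) _.
    by apply: ltr_exp => //; lra.
  - move=> z; rewrite QE powA ltr_pXn2r ?nnegrE ?dist_prod_ge0 ?exprn_ge0 ?(ltW e30) // => hz.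
    apply: contrapT => nLz; move: hz; rewrite ltNge => /negP; apply.
    apply: dist_prod_ge => [|y ys]; first exact: ltW.
    rewrite leNgt; apply/negP => zy; apply: nLz; apply: (KL y); first exact: sK.
    by lra.
  - by move=> z Lz; rewrite low; exact: hC.
  - by rewrite exprn_gt0.
  - have -> : 6 * e = 2 * (3 * e) by ring.
    by rewrite [leRHS]exprMn; apply: ler_wpM2r => //; rewrite exprn_ge0 // ltW.
  - move=> z; rewrite QE powA; apply: ler_exp; first exact: dist_prod_ge0.
    apply: dist_prod_le => y /sK /hDelta yD.
    by apply: le_trans (cmod_triangle _ _) _; rewrite cmodN lerD2l.
  - move=> z rho /andP[r0 r1] hz; have rQ : rho ^+ A <= cmod (Q z).
      rewrite QE powA; apply: ler_exp; first by rewrite exprn_ge0 // ltW.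
      by apply: dist_prod_ge => [|y /sK /hz //]; exact: ltW.
    split=> // /(le_lt_trans rQ) /ltW h; apply: le_trans h _.
    by apply: ler_exp; lra.
by rewrite /=; apply: ler_exp => //; exact: ltW.
Qed.

End Cutoff.


Section ContinuityPairs.
Variables (R : realType).
Local Notation C2 := (Cplx R * Cplx R)%type.

Lemma contR_max (T : topologicalType) (u v : T -> R) x :
  {for x, continuous u} -> {for x, continuous v} ->
  {for x, continuous (fun y => Num.max (u y) (v y))}.
Proof.
move=> cu cv.
have -> : (fun y => Num.max (u y) (v y)) =
    (fun y => 2^-1 * ((u y + v y) + `|u y + (-1) * v y|)).
  by apply/funext => y; rewrite maxr_absE mulN1r mulrC.
apply: contRM; first exact: contR_cst.
apply: contRD; first exact: contRD.
apply: (@contR_comp R T (fun x => `|x|) (fun y => u y + (-1) * v y)); last exact: norm_continuous.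
by apply: contRD => //; apply: contRM => //; exact: contR_cst.
Qed.

Lemma cont_fst (u : Cplx R -> R) (p : C2) : {for p.1, continuous u} ->
  {for p, continuous (fun q : C2 => u q.1)}.
Proof.
move=> /contRP cu; apply/contR2P => e /cu[d [d0 hd]].
by exists d => // q [q1 _]; exact: hd.
Qed.

Lemma cont_snd (u : Cplx R -> R) (p : C2) : {for p.2, continuous u} ->
  {for p, continuous (fun q : C2 => u q.2)}.
Proof.
move=> /contRP cu; apply/contR2P => e /cu[d [d0 hd]].
by exists d => // q [_ q2]; exact: hd.
Qed.

Lemma cont_graph_dist (f : Cplx R -> Cplx R) (p : C2) : {for p.1, continuous f} ->
  {for p, continuous (fun q : C2 => cmod (q.2 - f q.1))}.
Proof.
move=> cf; apply/contR2P => e e0; have e2 : 0 < e / 2 by rewrite divr_gt0.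
have /nbhs_cmodP[d [d0 hd]] := (contP _ _).1 cf _ e2.
exists (Num.min d (e / 2)); first by rewrite lt_min d0 e2.
move=> q [q1 q2]; move: q1 q2; rewrite !lt_min => /andP[/hd q1 _] /andP[_ q2].
apply: le_lt_trans (cmod_dist _ _) _; rewrite (splitr e).
have -> : q.2 - f q.1 - (p.2 - f p.1) = (q.2 - p.2) - (f q.1 - f p.1) by ring.
by apply: le_lt_trans (cmod_triangle _ _) _; rewrite cmodN; exact: ltrD.
Qed.

Lemma cont2_near (F G : C2 -> R) p e : 0 < e -> (forall q, near2 p e q -> F q = G q) ->
  {for p, continuous G} -> {for p, continuous F}.
Proof.
move=> e0 FG /contR2P cG; apply/contR2P => x /cG[d d0 hd].
exists (Num.min d e); first by rewrite lt_min d0 e0.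
move=> q [q1 q2]; move: q1 q2; rewrite !lt_min => /andP[qd1 qe1] /andP[qd2 qe2].
rewrite (FG q) // (FG p); first exact: hd.
by split; rewrite subrr cmod0.
Qed.

End ContinuityPairs.

(** * The plurisubharmonic function attached to one cutoff *)

Section Model.
Variables (R : realType) (D K L : set (Cplx R)) (f : Cplx R -> Cplx R) (Delta : R).
Hypothesis oD : open D.
Hypothesis hf : forall z, D z -> ~ K z -> cdiff f z.
Variable c : cutoff K L f Delta.
Local Notation C2 := (Cplx R * Cplx R)%type.
Implicit Types (p q a b : C2) (z w l : Cplx R) (e d : R).

Let Q := cutQ c. Let A := cutA c.
Let lo := cut_lo c. Let hi := cut_hi c.
Let kap := cut_floor c. Let C := cut_bound c.

(** Grows like [|w|] so that the cap dominates the graph term over the shell for all [w]; the lower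
    bound 1 keeps the model positive. *)
Definition height w : R := Num.max (cmod w) 1.

Definition model p : R :=
  if cmod (cutQ c p.1) < cut_lo c then height p.2 * cut_floor c
  else Num.max (cmod (p.2 - f p.1) * cmod (cutQ c p.1)) (height p.2 * cut_floor c).

Let kap0 : 0 < kap. Proof. exact: cut_floor_gt0. Qed.

Lemma height_ge1 w : 1 <= height w. Proof. by rewrite le_max lexx orbT. Qed.

Let h0 w : 0 < height w. Proof. exact: lt_le_trans ltr01 (height_ge1 w). Qed.

Let hw w : cmod w <= height w. Proof. by rewrite le_max lexx. Qed.

Lemma model_ge p : height p.2 * cut_floor c <= model p.
Proof. by rewrite /model; case: ifP => // _; rewrite le_max lexx orbT. Qed.

Lemma model_gt0 p : 0 < model p.
Proof. by apply: lt_le_trans (model_ge p); rewrite mulr_gt0. Qed.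

Let cQ z : {for z, continuous (fun z => cmod (Q z))}.
Proof.
apply/contRP => e e0; have := (contP _ _).1 (cdiff_continuous (cutQ_cdiff c z)) _ e0.
move=> /nbhs_cmodP[d [d0 hd]]; exists d; split => // y /hd.
exact: le_lt_trans (cmod_dist _ _).
Qed.

Let not_K z : lo <= cmod (Q z) -> ~ K z.
Proof. by move=> hz /(cutQ_K c); rewrite ltNge hz. Qed.

(* On the overlap [lo <= |Q| < hi] the two expressions agree, because the cap dominates there. *)
Let model_low p : cmod (Q p.1) < hi -> model p = height p.2 * kap.
Proof.
move=> phi; rewrite /model; case: ifP => // /negbT; rewrite -leNgt => plo.
apply: max_r; have fp := cut_f (cutQ_hi phi) plo.
have C0 := cut_bound_ge0 c.
apply: le_trans (_ : height p.2 * (1 + C) * hi <= _); last first.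
  by rewrite -mulrA; apply: ler_wpM2l; [exact: ltW|exact: cut_floor_ge].
apply: ler_pM => //; last exact: ltW.
apply: le_trans (cmod_triangle _ _) _; rewrite cmodN mulrDr mulr1; apply: lerD => //.
by apply: le_trans fp _; rewrite ler_peMl // height_ge1.
Qed.

Let model_high p : lo <= cmod (Q p.1) ->
  model p = Num.max (cmod (p.2 - f p.1) * cmod (Q p.1)) (height p.2 * kap).
Proof. by move=> plo; rewrite /model ltNge plo. Qed.

Let near_low z : cmod (Q z) < hi -> exists2 d, 0 < d & forall y, cmod (y - z) < d -> cmod (Q y) < hi.
Proof.
move=> zhi; have e0 : 0 < hi - cmod (Q z) by rewrite subr_gt0.
have [d [d0 hd]] := (contRP _ _).1 (@cQ z) _ e0.
by exists d => // y /hd; rewrite ltr_norml => /andP[_]; lra.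
Qed.

Let near_high z : hi <= cmod (Q z) -> exists2 d, 0 < d & forall y, cmod (y - z) < d -> lo <= cmod (Q y).
Proof.
move=> zhi; have e0 : 0 < cmod (Q z) - lo by rewrite subr_gt0 (lt_le_trans (cut_lo_hi c)).
have [d [d0 hd]] := (contRP _ _).1 (@cQ z) _ e0.
by exists d => // y /hd; rewrite ltr_norml => /andP[+ _]; lra.
Qed.

Let cheight p : {for p, continuous (fun q : C2 => height q.2 * kap)}.
Proof.
apply: contRM; last exact: contR_cst.
apply: (@cont_snd R height); apply: contR_max; [exact: cont_cmod|exact: contR_cst].
Qed.

Lemma cont_model p : D p.1 -> {for p, continuous model}.
Proof.
move=> Dp; case: (ltP (cmod (Q p.1)) hi) => ph.
  have [d d0 hd] := near_low ph.
  apply: (@cont2_near R model (fun q => height q.2 * kap) p d d0 _ (@cheight p)) => q [q1 _].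
  by rewrite model_low // hd.
have [d d0 hd] := near_high ph.
have nK : ~ K p.1 by apply: not_K; apply: le_trans ph; exact/ltW/cut_lo_hi.
apply: (@cont2_near R model (fun q => Num.max (cmod (q.2 - f q.1) * cmod (Q q.1)) (height q.2 * kap)) p d d0).
  by move=> q [q1 _]; rewrite model_high // hd.
apply: contR_max; last exact: cheight.
apply: contRM; first exact/cont_graph_dist/cdiff_continuous/hf.
exact: (@cont_fst R (fun z => cmod (Q z))).
Qed.

Let near_D z : D z -> exists2 d, 0 < d & forall y, cmod (y - z) < d -> D y.
Proof.
move=> Dz; have /nbhs_cmodP[d [d0 hd]] : nbhs z D by exact: open_nbhs_nbhs.
by exists d.
Qed.

(** A maximum is supported by whichever function attains it: [kap], [w * kap] or [(w - f z) * Q z].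
    The last is used only where [hi <= |Q|], so that nearby [lo <= |Q|] and the model still contains
    it. *)
Lemma model_log_support a b l : D (line a b l).1 -> log_support (fun l => model (line a b l)) l.
Proof.
move=> Dl; set p := line a b l.
have cap : model p = height p.2 * kap -> log_support (fun l => model (line a b l)) l.
  move=> E; case: (leP (cmod p.2) 1) => w1.
    exists (fun=> kap%:C%C), 1; split=> //.
      by rewrite -/p E cmod_real gtr0_norm // /height max_r // mul1r.
    move=> y _; split; first exact: cdiff_cst.
    apply: le_trans (model_ge _); rewrite cmod_real gtr0_norm //.
    by rewrite ler_peMl ?height_ge1 // ltW.
  exists (fun l => (a.2 + l * b.2) * kap%:C%C), 1; split=> //.
    by rewrite -/p E cmodM cmod_real gtr0_norm // /height max_l // ltW.
  move=> y _; split.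
    apply: cdiffM; last exact: cdiff_cst.
    by apply: (@cdiff_comp_affine R id); exact: cdiff_id.
  apply: le_trans (model_ge _); rewrite cmodM cmod_real gtr0_norm //.
  by rewrite ler_wpM2r // ltW.
case: (ltP (cmod (Q p.1)) hi) => ph; first exact/cap/model_low.
have plo : lo <= cmod (Q p.1) by apply: le_trans ph; exact/ltW/cut_lo_hi.
have := model_high plo; case: (leP (cmod (p.2 - f p.1) * cmod (Q p.1)) (height p.2 * kap)) => [_ /cap //|_ E].
have [d1 d10 hd1] := near_high ph; have [d2 d20 hd2] := near_D Dl.
have d12 : 0 < Num.min d1 d2 by rewrite lt_min d10 d20.
have [d d0 hd] := line_near a b l d12.
exists (fun l => (a.2 + l * b.2 - f (a.1 + l * b.1)) * Q (a.1 + l * b.1)), d; split=> //.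
  by rewrite -/p E cmodM.
move=> y /hd[]; rewrite lt_min => /andP[/hd1 y1 /hd2 y2] _; split.
  apply: cdiffM; last by apply: cdiff_comp_affine; exact: cutQ_cdiff.
  apply: cdiffB; first by apply: (@cdiff_comp_affine R id); exact: cdiff_id.
  by apply: cdiff_comp_affine; apply: hf => //; exact: not_K.
by rewrite model_high // cmodM le_max lexx.
Qed.

(** Division by the degree makes the bounds of different cutoffs comparable, as the series
    requires. *)
Definition log_model p : R := ln (model p) * (cutA c)%:R^-1.

Let A0 : 0 < A%:R :> R. Proof. by rewrite ltr0n; exact: cutA_gt0. Qed.

Lemma cont_log_model p : D p.1 -> {for p, continuous log_model}.
Proof.
move=> Dp; apply: contRM; last exact: contR_cst.
apply: contR_comp; first exact: cont_model.
by apply: continuous_ln; exact: model_gt0.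
Qed.

Lemma log_model_submean a b : (forall l, cmod l <= 1 -> D (line a b l).1) ->
  2 * pi * log_model a <=
  \int[@lebesgue_measure R]_(t in `[0%R, 2 * pi]) log_model (line a b (cexpi t)).
Proof.
move=> hD; pose Phi l := model (line a b l).
have la0 : line a b 0 = a by rewrite /line !mul0r !addr0; case: (a).
have cD t : D (line a b (cexpi t)).1 by apply: hD; rewrite cmod_cexpi.
have := @submean_log R Phi _ _ _; rewrite /Phi la0 => H.
rewrite /log_model RintegralZr //; last first.
  have ci : continuous (fun t : R => ln (model (line a b (cexpi t)))).
    apply: (@cont_line_circle R (fun p => ln (model p)) a b) => t.
    by apply: contR_comp; [exact: cont_model|apply: continuous_ln; exact: model_gt0].
  exact: (@integrable_itv R _ _ 0 (2 * pi) ci).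
rewrite mulrA ler_wpM2r ?invr_ge0 ?(ltW A0) //; apply: H => l l1.
- exact: model_gt0.
- by apply: cont_line; apply: cont_model; exact: hD.
- by apply: model_log_support; apply: hD; exact: ltW.
Qed.

Lemma log_model_le p x : 0 < x -> model p <= x ^+ cutA c -> log_model p <= ln x.
Proof.
move=> x0 h; rewrite /log_model ler_pdivrMr // mulrC -ler_expR expRM_natl !lnK ?posrE //.
exact: model_gt0.
Qed.

Lemma log_model_ge p x : 0 < x -> x ^+ cutA c <= model p -> ln x <= log_model p.
Proof.
move=> x0 h; rewrite /log_model ler_pdivlMr // mulrC -ler_expR expRM_natl !lnK ?posrE //.
exact: model_gt0.
Qed.

(** A bound of the form [x ^+ cutA c] becomes free of the degree in [log_model_le]. Where [|Q|] is
    below [cut_lo] the model does not involve [f], so the bound persists across [K], where [f] may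
    be unbounded. *)
Lemma model_upper p (Y : R) : 1 <= Y -> 1 <= Delta -> cut_floor c <= 1 ->
  cmod (cutQ c p.1) < cut_lo c \/ cmod (f p.1) + 1 <= Y ^+ cutA c ->
  model p <= (height p.2 * Y * (cmod p.1 + Delta)) ^+ cutA c.
Proof.
move=> Y1 D1 k1 hY; have Ap := cutA_gt0 c.
have zD : 1 <= cmod p.1 + Delta by rewrite (le_trans D1) // lerDr.
have X1 := height_ge1 p.2.
have big1 : 1 <= Y ^+ A * (cmod p.1 + Delta) ^+ A.
  by rewrite -[1]mulr1 ler_pM // exprn_ege1.
have XA : height p.2 <= height p.2 ^+ A.
  by rewrite -{1}[height p.2]expr1 ler_weXn2l.
have capX : height p.2 * kap <= (height p.2 * Y * (cmod p.1 + Delta)) ^+ A.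
  rewrite -mulrA exprMn [(Y * _) ^+ A]exprMn; apply: ler_pM; rewrite ?(ltW kap0) ?(ltW (h0 _)) //.
  exact: le_trans k1 big1.
rewrite /model; case: ifP => // /negbT plo; case: hY => [hY|hY]; first by rewrite hY in plo.
rewrite ge_max capX andbT -mulrA exprMn [(Y * _) ^+ A]exprMn mulrA; apply: ler_pM => //; last exact: cutQ_upper.
apply: le_trans (cmod_triangle _ _) _; rewrite cmodN.
apply: (@le_trans _ _ (height p.2 * (cmod (f p.1) + 1))).
  rewrite mulrDr mulr1 addrC; apply: lerD => //.
  by rewrite ler_peMl.
by apply: ler_pM => //; [exact: ltW|rewrite addr_ge0].
Qed.

(** Where the graph term is dropped, the second half of [cutQ_lower] bounds the cap instead: a point
    far from [K] with small [|Q|] forces a large floor. *)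
Lemma model_lower p (sigma rho : R) : 0 < sigma <= 1 -> 0 < rho <= 1 ->
  (forall k, K k -> rho <= cmod (p.1 - k)) -> sigma <= cmod (p.2 - f p.1) ->
  (sigma * rho) ^+ cutA c <= model p.
Proof.
move=> /andP[s0 s1] /andP[r0 r1] hK hs.
have [q1 q2] := cutQ_lower c (rho := rho) (z := p.1) (ltac:(by rewrite r0 r1)) hK.
have Ap := cutA_gt0 c.
rewrite exprMn /model; case: ifP => [/q2 h|_].
  apply: (@le_trans _ _ (1 * rho ^+ cutA c)).
    rewrite ler_wpM2r ?exprn_ge0 ?(ltW r0) // exprn_ile1 // ltW //.
  rewrite ler_pM ?exprn_ge0 ?(ltW r0) // height_ge1 //.
rewrite le_max; apply/orP; left; apply: ler_pM; rewrite ?exprn_ge0 ?(ltW r0) ?(ltW s0) //.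
by apply: le_trans hs; rewrite -[leRHS]expr1 ler_wiXn2l // ltW.
Qed.

Lemma model_bad p : K p.1 \/ p.2 = f p.1 -> model p = height p.2 * cut_floor c.
Proof.
move=> h; rewrite /model; case: ifP => // /negbT plo; case: h => [/(cutQ_K c) Kp|E].
  by rewrite Kp in plo.
by rewrite E subrr cmod0 mul0r max_r // mulr_ge0 // ltW.
Qed.

End Model.


(** * Choice of the cutoffs and bounds uniform in [n] *)

Theorem theorem2p1 (R : realType) (D K : set (Cplx R))
    (f : Cplx R -> Cplx R) :
  domain D -> compact K -> K `<=` D -> polar K ->
  holomorphic_on (D `\` K) f ->
  exists u : Cplx R * Cplx R -> \bar R,
    cont_psh_on (D `*` setT) u /\
    [set p | (D `*` setT) p /\ u p = -oo%E] =
      [set p | (D `\` K) p.1 /\ p.2 = f p.1] `|` (K `*` setT).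
Proof.
move=> [oD _] cK KD pK hol.
have hf z : D z -> ~ K z -> cdiff f z by move=> Dz nKz; apply/derivable_cdiff/hol.
have [Delta D1 hDelta] := compact_bounded_cmod cK.
have [eta eta0 heta] := compact_collar oD cK KD.
pose L := [set z | exists2 k, K k & cmod (z - k) <= eta].
have cL : compact L by exact: compact_thickening.
have LD : L `<=` D by move=> z [k Kk zk]; exact: heta zk.
have KL k z : K k -> cmod (z - k) <= eta -> L z by move=> Kk zk; exists k.
have m0 n : 0 < 4 ^+ n :> R by rewrite exprn_gt0.
have cuts (n : nat) : exists c : cutoff K L f Delta, cut_floor c <= expR (- 4 ^+ n) ^+ cutA c.
  have [K0|/set0P K0] := eqVneq K set0.
    have L0 z : ~ L z by move=> [k]; rewrite K0.
    by rewrite K0; exact: cutoff_empty.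
  exact: cutoff_exists (polar_compact_thin cK pK K0) cL eta0 KL LD hf hDelta.
have [c hc] := choice cuts.
pose V n := log_model (c n).
have em1 n : expR (- 4 ^+ n) <= 1 :> R by rewrite -expR0 ler_expR oppr_le0 ltW.
have floor1 n : cut_floor (c n) <= 1.
  by apply: le_trans (hc n) _; apply: exprn_ile1; rewrite ?expR_ge0.
apply: (@series_psh R (D `*` setT) _ V).
- by move=> n p [Dp _]; exact: (cont_log_model hf).
- by move=> n a b hO; apply: (log_model_submean oD hf) => l /hO[].
- move=> p [Dp _].
  (* [Y] must not depend on [n]. Near [K] the value 2 works by [cut_bound_le], although the bound of
     [f] on the shell varies with [n]; elsewhere a local bound of [f] serves. *)
  have [Y [Y1 [e e0 hY]]] : exists Y : R, 1 <= Y /\ exists2 e : R, 0 < e & forall z n, cmod (z - p.1) < e ->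
      cmod (cutQ (c n) z) < cut_lo (c n) \/ cmod (f z) + 1 <= Y ^+ cutA (c n).
    have [Kp|nKp] := pselect (K p.1).
      exists 2; split; first by rewrite ler1n.
      exists eta => // z n zp; case: (ltP (cmod (cutQ (c n) z)) (cut_lo (c n))) => h; first by left.
      right; apply: le_trans (cut_bound_le (c n)).
      by rewrite addrC lerD2l; apply: cut_f => //; apply: KL Kp _; exact: ltW.
    have Y1 : 1 <= cmod (f p.1) + 2 by have := cmod_ge0 (f p.1); lra.
    exists (cmod (f p.1) + 2); split=> //.
    have /nbhs_cmodP[d [d0 hd]] := (contP _ _).1 (cdiff_continuous (hf _ Dp nKp)) 1 ltr01.
    exists d => // z n /hd zp; right; apply: (@le_trans _ _ (cmod (f p.1) + 2)).
      by have := cmod_triangle (f z - f p.1) (f p.1); rewrite subrK; lra.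
    by rewrite -[leLHS]expr1 ler_weXn2l // cutA_gt0.
  exists (ln ((cmod p.2 + 1) * Y * (cmod p.1 + 1 + Delta))), (Num.min e 1).
    by rewrite lt_min e0 ltr01.
  move=> q n [q1 q2]; move: q1 q2; rewrite !lt_min => /andP[qe q1] /andP[_ q2].
  have Y0 : 0 < Y by apply: lt_le_trans Y1.
  have Delta0 : 0 < Delta by apply: lt_le_trans D1.
  have hq0 : 0 < height q.2 by apply: lt_le_trans (height_ge1 _).
  have x0 : 0 < height q.2 * Y * (cmod q.1 + Delta).
    by rewrite mulr_gt0 ?ltr_wpDl // mulr_gt0.
  have hq : height q.2 <= cmod p.2 + 1.
    rewrite ge_max lerDr cmod_ge0 andbT.
    by have := cmod_triangle (q.2 - p.2) p.2; rewrite subrK; lra.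
  have zq : cmod q.1 + Delta <= cmod p.1 + 1 + Delta.
    by have := cmod_triangle (q.1 - p.1) p.1; rewrite subrK; lra.
  have le1 : height q.2 * Y * (cmod q.1 + Delta) <= (cmod p.2 + 1) * Y * (cmod p.1 + 1 + Delta).
    apply: ler_pM => //; first by rewrite ltW // mulr_gt0.
      by rewrite addr_ge0 // ltW.
    by apply: ler_pM => //; exact: ltW.
  apply: (@le_trans _ _ (ln (height q.2 * Y * (cmod q.1 + Delta)))); last first.
    by rewrite ler_ln ?posrE // (lt_le_trans x0).
  by apply: log_model_le => //; apply: model_upper => //; exact: hY.
- move=> p Bp; exists (ln (height p.2)) => n.
  have h1 := height_ge1 p.2; have hp : 0 < height p.2 by apply: lt_le_trans h1.
  have -> : ln (height p.2) - 4 ^+ n = ln (height p.2 * expR (- 4 ^+ n)).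
    by rewrite lnM ?posrE ?expR_gt0 // expRK.
  apply: log_model_le; first by rewrite mulr_gt0 // expR_gt0.
  rewrite model_bad; last by case: Bp => [[_ ->]|[Kp _]]; [right|left].
  rewrite exprMn; apply: ler_pM => //; [exact: ltW|exact/ltW/cut_floor_gt0|].
  by rewrite -{1}[height p.2]expr1 ler_weXn2l // cutA_gt0.
- move=> p [Dp _] nB.
  have nK : ~ K p.1 by move=> Kp; apply: nB; right.
  have nf : p.2 - f p.1 != 0.
    by rewrite subr_eq0; apply/eqP => E; apply: nB; left.
  have [r r0 hr] := compact_away cK nK.
  (* Half the distance to [K], and below half the distance of [p.2] to [f p.1], so that both bounds
     survive on a neighbourhood of [p]. *)
  pose rho := Num.min (r / 2) 1.
  have rho1 : 0 < rho <= 1 by rewrite lt_min divr_gt0 // ltr01 ge_min lexx orbT.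
  pose s0 := cmod (p.2 - f p.1) / 2; have s00 : 0 < s0 by rewrite divr_gt0 // cmod_gt0.
  pose sigma := Num.min s0 1.
  have sigma1 : 0 < sigma <= 1 by rewrite lt_min s00 ltr01 ge_min lexx orbT.
  have [d d0 hd] := (contR2P _ _).1 (cont_graph_dist (cdiff_continuous (hf _ Dp nK))) _ s00.
  exists (- ln (sigma * rho)), (Num.min d (r / 2)); first by rewrite lt_min d0 divr_gt0.
  move=> q n [q1 q2]; move: q1 q2; rewrite !lt_min => /andP[qd1 qr] /andP[qd2 _].
  rewrite opprK; apply: log_model_ge; first by move: sigma1 rho1 => /andP[? _] /andP[? _]; rewrite mulr_gt0.
  apply: model_lower => //.
    move=> k Kk; have := hr k Kk; have := cmod_sub_triangle q.1 p.1 k.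
    have : rho <= r / 2 by rewrite ge_min lexx.
    by rewrite (cmodB k) (cmodB p.1 q.1); lra.
  have := hd q (conj qd1 qd2); rewrite ltr_norml => /andP[+ _].
  have : sigma <= s0 by rewrite ge_min lexx.
  by rewrite /s0; lra.
- move=> p [[[Dp _] _]|[Kp _]]; split=> //; exact: KD.
Qed.
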